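(* For each $M \in \mathbb{N}$ let $N_M \in \mathbb{N}$ and suppose that, for some $\rho \in (0,\infty)$, $$\lim_{M \to \infty} N_M = \infty \quad\text{and}\quad \lim_{M \to \infty} \frac{M}{N_M^2} = \rho .$$ Consider the finite-capacity $(N_M, M, z_M)$ model with $z_M = (1,M)$ and lifetime $\lambda$. Then, under $\mathbb{P}^{N_M,M}_{(1,M)}$, as $M \to \infty$, $$\frac{\lambda}{M} \ \overset{d}{\longrightarrow}\ 1 + \xi_\rho, \qquad \frac{\mathbb{E}^{N_M,M}_{(1,M)} \lambda}{M} \to 1 + \mu(\rho),$$ where $\xi_\rho$ is a random variable with moment generating function $\mathbb{E}[e^{s\xi_\rho}] = \phi_\rho(s)$ for $s < s_\rho$, and expectation $\mathbb{E}\,\xi_\rho = \mu(\rho)$. Moreover, $$\lim_{\rho \downarrow 0} \mu(\rho) = 1, \qquad\text{and}\qquad \mu(\rho) = \frac{e^{\pi^2\rho/2}}{4\rho}(1 + o(1)) \ \text{ as } \rho \to \infty .$$ Here $\phi_\rho$, $s_\rho$, and $\mu$ are defined in the context.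
   Context: Notation: $\mathbb{N}=\{1,2,\dots\}$, $\mathbb{Z}_+=\{0,1,2,\dots\}$. For $N\in\mathbb{N}$ with $N\ge 2$, $I_N = \{0,1,\dots,N\}$ with boundary $\partial I_N=\{0,N\}$ and interior $I_N^\circ = I_N\setminus\partial I_N$; similarly $I_M=\{0,1,\dots,M\}$. Finite-capacity $(N,M,z)$ model ($M\in\mathbb{N}$, $z\in I_N\times I_M$): the Markov chain $\zeta_n=(X_n,\eta_n)$, $n\in\mathbb{Z}_+$, with $\zeta_0=z$ and transitions: (1) from $(x,i)$ with $x\in I_N^\circ$, $i\ge 1$, move to $(x+1,i-1)$ or $(x-1,i-1)$ with probability $1/2$ each; (2) states $(x,0)$ with $x\in I_N^\circ$ are absorbing; (3) from $(x,i)$ with $x\in\partial I_N$, move with probability 1 to $(y,M)$, where $y\in I_N^\circ$ is the unique interior site with $|y-x|=1$. Its law and expectation are $\mathbb{P}^{N,M}_z$, $\mathbb{E}^{N,M}_z$. The lifetime is $\lambda=\min\{n\in\mathbb{Z}_+: X_n\in I_N^\circ,\ \eta_n=0\}$ ($\min\emptyset=+\infty$). Functions: for $y>0$, $H(y)=\sum_{k=1}^\infty \exp\{-\pi^2(2k-1)^2y/2\}$. For $\rho>0$ and $s\in\mathbb{R}$, $$G(\rho,s)=\frac{s}{H(\rho)}\int_0^1 e^{sv}\bigl(H(v\rho)-H(\rho)\bigr)\,dv,$$ which is finite, strictly increasing in $s$, with $G(\rho,0)=0$. Set $s_\rho=\sup\{s>0: G(\rho,s)<1\}$, $\phi_\rho(s)=\dfrac{1}{1-G(\rho,s)}$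 for $s<s_\rho$, and $$\mu(\rho)=\frac{1}{\rho H(\rho)}\int_0^\rho H(y)\,dy-1 .$$ *)

(* Defs.v *)
From HB Require Import structures.
From mathcomp Require Import all_boot all_order all_algebra.
From mathcomp Require Import all_classical all_reals all_analysis.

Set Implicit Arguments.
Unset Strict Implicit.
Unset Printing Implicit Defensive.
Import Order.TTheory GRing.Theory Num.Theory.
Import numFieldNormedType.Exports.

Local Open Scope classical_set_scope.
Local Open Scope ring_scope.

(* The Markov property with the conditioning multiplied out, so that no
   division by the probability of a null event occurs. Only the values
   [a 0, ..., a n] of the path [a] matter. *)
Record markov_chain (R : realType) (d : measure_display) (T : measurableType d)
    (P : probability T R) (S : finType) (p : S -> S -> R) (z : S)
    (Z : nat -> T -> S) : Prop := MarkovChain {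
  markov_measurable : forall n s, measurable (Z n @^-1` [set s]) ;
  markov_init : P [set w | Z 0%N w = z] = 1%E ;
  markov_step : forall (n : nat) (a : nat -> S) (s : S),
    P [set w | (forall k, (k <= n)%N -> Z k w = a k) /\ Z n.+1 w = s] =
    (P [set w | forall k, (k <= n)%N -> Z k w = a k] * (p (a n) s)%:E)%E }.

(* [(x, i) : fc_state N M] is a position [x] in [I_N = {0, ..., N}] together
   with a remaining energy [i] in [I_M = {0, ..., M}]. *)
Definition fc_state (N M : nat) : finType := ('I_N.+1 * 'I_M.+1)%type.

Definition interior_site (N : nat) (x : 'I_N.+1) : bool := (0 < x < N)%N.

Definition adjacent_site (N : nat) (x y : 'I_N.+1) : bool :=
  ((y == x.+1 :> nat) || (x == y.+1 :> nat))%N.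

Definition fc_transition (R : realType) (N M : nat) (a b : fc_state N M) : R :=
  if interior_site a.1 then
    if (a.2 == 0 :> nat)%N then (b == a)%:R
    else if adjacent_site a.1 b.1 && (a.2 == b.2.+1 :> nat)%N then 2^-1
    else 0
  else [&& interior_site b.1, adjacent_site a.1 b.1 & (b.2 == M :> nat)%N]%:R.

(* Meaningful for [1 < N]. *)
Definition fc_model (R : realType) (d : measure_display) (T : measurableType d)
    (P : probability T R) (N M : nat) (z : fc_state N M)
    (zeta : nat -> T -> fc_state N M) : Prop :=
  markov_chain P (@fc_transition R N M) z zeta.

(* [ereal_inf set0 = +oo]; on a nonempty set of naturals this is the minimum. *)
Definition lifetime (R : realType) (T : Type) (N M : nat)
    (zeta : nat -> T -> fc_state N M) (w : T) : \bar R :=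
  ereal_inf [set (n%:R)%:E | n in
    [set n : nat | interior_site (zeta n w).1 /\ (zeta n w).2 = 0%N :> nat]].

Definition distribution_function (R : realType) (d : measure_display)
    (T : measurableType d) (P : probability T R) (X : T -> \bar R) (x : R) :
    \bar R :=
  P [set w | (X w <= x%:E)%E].

(* The [X n] may take infinite values (the lifetime is [+oo] on a null event)
   and live on different spaces; the limit [Y] is real-valued, so that no mass
   may escape to infinity. *)
Definition cvg_in_distribution (R : realType) (d : nat -> measure_display)
    (T : forall n, measurableType (d n)) (P : forall n, probability (T n) R)
    (X : forall n, T n -> \bar R)
    (d' : measure_display) (T' : measurableType d') (P' : probability T' R)
    (Y : T' -> R) : Prop :=
  let F := distribution_function P' (EFin \o Y) in
  forall x : R, {for x, continuous F} ->
    distribution_function (P n) (X n) x @[n --> \oo] --> F x.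

Section limit_functions.
Context {R : realType}.
Implicit Types (rho s y : R).

Definition H y : R :=
  limn (fun n => \sum_(1 <= k < n)
    expR (- (pi ^+ 2 * (2 * k%:R - 1) ^+ 2 * y / 2))).

(* [H y] blows up like [y^(-1/2)] at [0], so the integrals over [0, 1] and
   [0, rho] are Lebesgue integrals of unbounded integrable functions. *)
Definition G rho s : R :=
  s / H rho * \int[lebesgue_measure]_(v in `]0, 1])
                (expR (s * v) * (H (v * rho) - H rho)).

Definition s_ rho : \bar R :=
  ereal_sup [set s%:E | s in [set s : R | 0 < s /\ G rho s < 1]].

Definition phi rho s : R := (1 - G rho s)^-1.

Definition mu rho : R :=
  (rho * H rho)^-1 * (\int[lebesgue_measure]_(y in `]0, rho]) H y) - 1.

End limit_functions.

(* Main.v *)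
(* Each visit to the boundary resets the energy to M, so P(lambda > n) solves a
   renewal equation driven by the survival probabilities q of the simple random
   walk killed at the boundary, and the generating function of lambda at
   z = exp(s/M) is an explicit quotient in q. The spectral formula for q and
   dominated convergence give N q(m) -> 4 H(y) when m / N^2 -> y, with the
   integrable bound C / sqrt y, and hence E exp(s lambda / M) tends to
   exp(s) phi(s); at s = 0 the same computation gives the limit of the means.

   No continuity theorem for Laplace transforms is used: convergence of the
   moments of exp(-lambda / M), which lies in [0, 1], separates the distribution
   functions at any two points by means of the polynomials (1 - y^n)^K, so that
   all admissible sequences N have the same limit law, and the law of xi is built
   from one reference sequence. Its moment generating function and mean are read
   off the integrals of exp(s x) P(lambda / M > x), where the exponential tail
   bound supplied by any t > 0 with G(rho, t) < 1 gives domination.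

   The behaviour of mu at 0 follows from 2 sqrt y H(y) = I + O(sqrt y), with I a
   Gaussian integral, and at infinity from the sum of the odd inverse squares,
   a limit of the sums of 1 / sin^2 over the eigenfrequencies of the walk. *)

Require Import Defs.
From HB Require Import structures.
From mathcomp Require Import all_boot all_order all_algebra.
From mathcomp Require Import all_classical all_reals all_analysis.
From mathcomp Require Import measurable_realfun.
From mathcomp Require Import zify ring lra.

Set Implicit Arguments.
Unset Strict Implicit.
Unset Printing Implicit Defensive.
Import Order.TTheory GRing.Theory Num.Theory.
Import numFieldNormedType.Exports.

Local Open Scope classical_set_scope.
Local Open Scope ring_scope.

(** * Survival probabilities of the chain *)

(** Each refill restarts the walk next to the boundary, so a cycle avoids the boundary for [M] steps
    only with probability q(M) ~ 4 H(rho) / N. With F the generating function of the hitting time of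
    the boundary, restricted to times at most [M], E z^lambda = z^M q(M) / (1 - z F(z)). Both q(M)
    and 1 - z F(z) are of order 1/N; their ratio has a finite limit, and 1 - G(rho, s) is exactly
    the limit of (1 - z F(z)) / q(M). The factor z beside F is the step spent on the boundary; it
    adds a term of order N/M, which tends to 0. The period two of the walk causes no oscillation:
    eigenvalues near -1 carry the small weight 1 + cos theta, and their total contribution is
    controlled by a geometric sum. Nothing says in advance that phi_rho is a moment generating
    function, so the law of xi has to be constructed. Convergence in distribution does not transfer
    exponential moments with s > 0 either; this is why a tail bound uniform in M is established for
    some t > s before passing to the limit. *)

Section avoidance.
Context {R : realType} {d : measure_display} {T : measurableType d}.
Context {S : finType}.
Implicit Types (P : probability T R) (p : S -> S -> R) (A : pred S)
  (Z : nat -> T -> S).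

Fixpoint avoid p A n (a : S) : R :=
  if A a then 0 else
  if n is n'.+1 then \sum_b p a b * avoid p A n' b else 1.

Lemma measure_preimage_sum (P : {measure set T -> \bar R}) (f : T -> S) (E : set T) :
  (forall s, measurable (f @^-1` [set s])) -> measurable E ->
  P E = (\sum_s P (E `&` f @^-1` [set s]))%E.
Proof.
move=> mf mE.
have {1}-> : E = \bigcup_(s in [set: S]) (E `&` f @^-1` [set s]).
  by apply/seteqP; split=> [w Ew|w [s _ []]//]; exists (f w).
rewrite measure_fin_bigcup//.
- have -> : [set: S] = [set` index_enum S].
    by apply/seteqP; split=> // s _ /=; rewrite mem_index_enum.
  by rewrite -fsbig_seq ?index_enum_uniq.
- exact: finite_finset.
- by apply/trivIsetP => i j _ _ /eqP ij; rewrite -subset0 => w [[_ /= wi] [_ /= wj]]; apply: ij; rewrite -wi -wj.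
- by move=> s _; exact: measurableI.
Qed.

Lemma measurable_prefix Z (n : nat) (B : nat -> set S) :
  (forall n s, measurable (Z n @^-1` [set s])) ->
  measurable [set w | forall k, (k <= n)%N -> B k (Z k w)].
Proof.
move=> mZ.
have -> : [set w | forall k, (k <= n)%N -> B k (Z k w)] =
    \bigcap_(k in `I_n.+1) \bigcup_(s in B k) Z k @^-1` [set s].
  apply/seteqP; split=> [w h k /= kn|w h k kn]; first by exists (Z k w) => //; apply: h.
  by have [s Bs /= ->] := h k kn.
apply: bigcap_measurableType => k _; apply: fin_bigcup_measurable => [|s _].
  exact: finite_finset.
exact: mZ.
Qed.

(** [markov_step] speaks only of completely specified prefixes, so the induction is on the number
    [m] of remaining steps, for all [n] and all paths [a] at once: splitting over the state at time
    [n.+1] turns one step into a longer prefix. The clause [(n <= k)%N] tests [A] at time [n] but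
    not before, because [avoid] tests its starting state. *)
Lemma avoid_prefix P p A z Z : markov_chain P p z Z -> forall m n (a : nat -> S),
  P [set w | forall k, (k <= n + m)%N ->
       if (k <= n)%N then Z k w = a k /\ ((n <= k)%N -> ~~ A (Z k w))
       else ~~ A (Z k w)] =
  (P [set w | forall k, (k <= n)%N -> Z k w = a k] * (avoid p A m (a n))%:E)%E.
Proof.
move=> [mZ _ Zstep]; elim=> [|m IH] n a /=.
  case: ifPn => Aan.
    rewrite mule0 (_ : [set _ | _] = set0) ?measure0// -subset0 => w.
    by move=> /(_ n); rewrite addn0 leqnn => /(_ isT)[-> /(_ isT)]; rewrite Aan.
  rewrite mule1; congr (P _); apply/seteqP; split=> w h k.
    by move=> kn; have := h k; rewrite addn0 kn => /(_ isT)[].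
  rewrite addn0 => kn; rewrite kn; split; first exact: h.
  by move=> nk; rewrite (h _ kn) (_ : k = n)//; apply/eqP; rewrite eqn_leq kn.
case: ifPn => Aan.
  rewrite mule0 (_ : [set _ | _] = set0) ?measure0// -subset0 => w.
  by move=> /(_ n); rewrite leqnn leq_addr => /(_ isT)[-> /(_ isT)]; rewrite Aan.
rewrite (@measure_preimage_sum P (Z n.+1)); last 2 first.
- exact: mZ.
- apply: (@measurable_prefix Z _ (fun k s => if (k <= n)%N then s = a k /\
    ((n <= k)%N -> ~~ A s) else ~~ A s)) => //.
rewrite -sumEFin fin_num_sume_distrr//; last exact: fin_num_measure (@measurable_prefix Z _ (fun k => [set a k]) mZ).
apply: eq_bigr => s _.
(* The prefix [a] prolonged by the new state [s] at time [n.+1]. *)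
pose a' k := if (k <= n)%N then a k else s.
rewrite EFinM muleA.
have := Zstep n a s.
have -> : [set w | (forall k, (k <= n)%N -> Z k w = a k) /\ Z n.+1 w = s] =
  [set w | forall k, (k <= n.+1)%N -> Z k w = a' k].
  apply/seteqP; split=> [w [h e] k|w h].
    by rewrite /a' leq_eqVlt => /orP[/eqP ->|]; [rewrite ltnn|rewrite ltnS => kn; rewrite kn; apply: h].
  split=> [k kn|]; last by rewrite h// /a' ltnn.
  by rewrite h ?(leq_trans kn)// /a' kn.
have a's : a' n.+1 = s by rewrite /a' ltnn.
move=> <-; have := IH n.+1 a'; rewrite a's => <-.
congr (P _); apply/seteqP; split=> [w [h e] k|w h].
  rewrite addSnnS => /h; case: (ltngtP k n.+1) => [kn|kn|->].
  - by rewrite -ltnS kn => -[-> _]; split=> //; rewrite /a' -ltnS kn.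
  - by rewrite leqNgt (ltnW kn).
  - by rewrite ltnn a's; split.
split=> /= [k|]; last first.
  by have := h n.+1; rewrite leqnn leq_addr => /(_ isT)[-> _]; rewrite a's.
rewrite -addSnnS => /h; case: (ltngtP k n.+1) => [kn|kn|->].
- move=> [-> _]; rewrite -ltnS kn /a' -ltnS kn; split=> // nk.
  by rewrite (_ : k = n)//; apply/eqP; rewrite eqn_leq nk andbT -ltnS.
- by rewrite leqNgt (ltnW kn).
- by rewrite ltnn => -[_]; apply.
Qed.

Lemma avoid_prob P p A z Z n : markov_chain P p z Z ->
  P [set w | forall k, (k <= n)%N -> ~~ A (Z k w)] = (avoid p A n z)%:E.
Proof.
move=> Zmc; have := avoid_prefix A Zmc n 0 (fun=> z).
have Pz : P [set w | forall k, (k <= 0)%N -> Z k w = z] = 1%E.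
  rewrite -(markov_init Zmc); congr (P _); apply/seteqP; split=> w /=; first exact.
  by move=> h k; rewrite leqn0 => /eqP ->.
rewrite Pz mul1e => <-.
have mZ := markov_measurable Zmc.
have Pz0 : P [set w | Z 0%N w = z] = 1%E := markov_init Zmc.
rewrite add0n.
set E := [set w | forall k, _].
set F := [set w | forall k, _].
have mE : measurable E by apply: (@measurable_prefix Z _ (fun=> [set s | ~~ A s])).
have FE : F = E `&` Z 0%N @^-1` [set z].
  apply/seteqP; split=> [w h|w [h e]].
    split=> [k kn|/=]; last by have := h 0%N (leq0n _); rewrite leqnn => -[].
    have := h k kn; case: ifP => // _ [_]; apply; exact: leq0n.
  move=> k kn; case: ifPn; rewrite ?leqn0; last by move=> _; exact: h.
  by move=> /eqP ->; split=> // _; apply: h.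
(* The chain starts at [z] only almost surely: the slices of [E] with another initial state lie in a
   null set, so [E] and [F] have the same probability. *)
have := @measure_preimage_sum P (Z 0%N) E (mZ 0%N) mE.
rewrite (bigD1 z)//= -FE big1 ?adde0// => s sz.
apply/eqP; rewrite eq_le measure_ge0 andbT.
have mz : measurable (Z 0%N @^-1` [set z]) by exact: mZ.
have <- : P (~` (Z 0%N @^-1` [set z])) = 0%E.
  by rewrite probability_setC// Pz0 subee.
apply: le_measure; rewrite ?inE//; first exact: measurableI.
  exact: measurableC.
by move=> w [_ /= -> szE]; move: sz; rewrite szE eqxx.
Qed.

End avoidance.

(** * Recursions for the killed walk and the refilled chain *)

Section survival.
Context {R : realType}.

(* Probabilities that the simple random walk started at [x] is interior at the
   times [0, ..., n], and that the chain started at [(x, i)] is not absorbed at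
   any of these times. *)
Fixpoint walk_surv (N n x : nat) : R :=
  if (0 < x < N)%N then
    if n is n'.+1 then (walk_surv N n' x.+1 + walk_surv N n' x.-1) / 2 else 1
  else 0.

Fixpoint fc_surv (N M n x i : nat) : R :=
  if (0 < x < N)%N && (i == 0)%N then 0 else
  if n is n'.+1 then
    if (0 < x < N)%N then (fc_surv N M n' x.+1 i.-1 + fc_surv N M n' x.-1 i.-1) / 2
    else fc_surv N M n' (if x == 0%N then 1%N else N.-1) M
  else 1.

Definition absorbed N M : pred (fc_state N M) :=
  fun a => interior_site a.1 && (a.2 == 0 :> nat)%N.

Lemma avoid_fc N M n (a : fc_state N M) : (1 < N)%N ->
  avoid (@fc_transition R N M) (@absorbed N M) n a = fc_surv N M n a.1 a.2.
Proof.
move=> N1; elim: n a => [|n IH] a; first by [].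
have -> : avoid (@fc_transition R N M) (@absorbed N M) n.+1 a =
  if absorbed a then 0 else \sum_b fc_transition R a b * fc_surv N M n b.1 b.2.
  by rewrite /=; case: ifP => // _; apply: eq_bigr => b _; rewrite IH.
case: a => [x i]; rewrite /absorbed /interior_site [RHS]/=.
have xN := ltn_ord x; have iM := ltn_ord i.
case: ifPn => // /=; case: ifPn => /= xint; last first.
  move=> _; set y := (if _ then 1%N else N.-1).
  have yE : (x = 0%N :> nat /\ y = 1%N) \/ (x = N :> nat /\ y = N.-1).
    rewrite /y; case: eqP => [->|x0]; [by left|right]; split=> //; lia.
  have yN : (y < N.+1)%N by lia.
  rewrite (bigD1 (Ordinal yN, ord_max))//= big1 ?addr0.
    rewrite /fc_transition /= /interior_site /adjacent_site/= (negbTE xint) eqxx andbT.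
    by rewrite [X in (nat_of_bool X)%:R](_ : _ = true) ?mul1r//; lia.
  move=> [y' j] yj; rewrite /fc_transition /interior_site /adjacent_site /= (negbTE xint).
  case h: [&& _, _ & _]; last by rewrite mul0r.
  exfalso; move/eqP: yj; apply; congr pair; apply: val_inj => /=; last by lia.
  by have := ltn_ord y'; lia.
move=> i0.
have x1 : (x.+1 < N.+1)%N by lia.
have x2 : (x.-1 < N.+1)%N by lia.
have i1 : (i.-1 < M.+1)%N by lia.
rewrite (bigD1 (Ordinal x1, Ordinal i1))//= (bigD1 (Ordinal x2, Ordinal i1))/=; last first.
  by apply/eqP => -[]; lia.
rewrite big1 ?addr0.
  rewrite /fc_transition /interior_site /adjacent_site /= xint (negbTE i0).
  rewrite (_ : _ && _ = true); last by lia.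
  by rewrite (_ : _ && _ = true) ?mulrDl ?(mulrC 2^-1)//; lia.
move=> [y' j] /andP[yj1 yj2]; rewrite /fc_transition /interior_site /adjacent_site /= xint (negbTE i0).
case: ifPn => [h|]; last by rewrite mul0r.
have [hy|hy] : (y' = x.+1 :> nat) \/ (y' = x.-1 :> nat) by lia.
  by exfalso; move/eqP: yj1; apply; congr pair; apply: val_inj => //=; lia.
by exfalso; move/eqP: yj2; apply; congr pair; apply: val_inj => //=; lia.
Qed.

(** Reflection of the interval. It replaces a restart at [N.-1] by a restart at 1, so that the
    single sequence [fc_tail] describes both ends. *)
Lemma fc_surv_sym N M n x i : (1 < N)%N -> (x <= N)%N ->
  fc_surv N M n (N - x) i = fc_surv N M n x i.
Proof.
move=> N1; elim: n x i => [|n IH] x i xN /=.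
  by rewrite (_ : (0 < N - x < N)%N = (0 < x < N)%N)//; lia.
rewrite (_ : (0 < N - x < N)%N = (0 < x < N)%N); last by lia.
case: ifP => // _; case: ifPn => xint.
  rewrite (_ : (N - x).+1 = (N - x.-1)%N); last by lia.
  rewrite (_ : (N - x).-1 = (N - x.+1)%N); last by lia.
  by rewrite !IH ?(addrC (fc_surv _ _ _ x.-1 _))//; lia.
have [->|->] : x = 0%N \/ x = N by lia.
  by rewrite subn0 (gtn_eqF (ltnW N1)) eqxx -subn1 IH//; lia.
by rewrite subnn eqxx (gtn_eqF (ltnW N1)) -subn1 IH//; lia.
Qed.

Definition fc_tail N M n := fc_surv N M n 1 M.

(** Survival from a boundary site, whatever energy is left there. The shift by one is the step back
    into the interior; at time 0 a boundary state is alive even with energy 0. *)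
Definition fc_refill N M n := if n is n'.+1 then fc_tail N M n' else 1.

Lemma fc_surv_bd N M n x i : (1 < N)%N -> (x <= N)%N -> ~~ (0 < x < N)%N ->
  fc_surv N M n x i = fc_refill N M n.
Proof.
move=> N1 xN xb; case: n => [|n] /=; rewrite (negbTE xb)//=.
have [->|->] : x = 0%N \/ x = N by lia.
  by rewrite eqxx.
by rewrite (gtn_eqF (ltnW N1)) -subn1 fc_surv_sym//; lia.
Qed.

Lemma walk_surv_bd N n x : ~~ (0 < x < N)%N -> walk_surv N n x = 0.
Proof. by case: n => [|n] /= /negbTE ->. Qed.

(** Decomposition at the first visit to the boundary: the start is already there, or no visit occurs
    up to time [n] and the energy lasts ([n < i]), or the visit occurs at time [m.+1]. Times up to
    [i] included count, since a walk that arrives with energy 0 is still refilled. *)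
Lemma fc_surv_renewal N M n x i : (1 < N)%N -> (x <= N)%N ->
  fc_surv N M n x i = (~~ (0 < x < N)%N)%:R * fc_refill N M n +
    (n < i)%N%:R * walk_surv N n x +
    \sum_(m < minn n i) (walk_surv N m x - walk_surv N m.+1 x) *
      fc_refill N M (n - m.+1)%N.
Proof.
move=> N1; elim: n x i => [|n IH] x i xN.
  rewrite min0n big_ord0 addr0 /=.
  by case: (0 < x < N)%N; case: i => //= *; rewrite ?(mul0r, mul1r, mulr0, addr0, add0r).
case xint : (0 < x < N)%N; last first.
  rewrite fc_surv_bd ?xint// (walk_surv_bd _ (negbT xint)) mulr0 addr0 mul1r.
  by rewrite big1 ?addr0// => m _; rewrite !(walk_surv_bd _ (negbT xint)) subrr mul0r.
rewrite mul0r add0r; case: i => [|i]; first by rewrite /= xint /= minn0 big_ord0 mul0r addr0.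
have fcE : fc_surv N M n.+1 x i.+1 = (fc_surv N M n x.+1 i + fc_surv N M n x.-1 i) / 2.
  by rewrite /= xint.
have wE m : walk_surv N m.+1 x = (walk_surv N m x.+1 + walk_surv N m x.-1) / 2.
  by rewrite /= xint.
have w0 y : walk_surv N 0 y = 1 - (~~ (0 < y < N)%N)%:R.
  by rewrite /=; case: ifP; rewrite ?subr0 ?subrr.
rewrite fcE !IH; [|lia..].
rewrite minnSS big_ord_recl subn1 [nat_of_ord _]/= ltnS !wE !w0 xint subr0.
under [X in _ = _ + (_ + X)]eq_bigr do rewrite lift0 !wE subSS.
set A := \sum_(_ < _) _; set B := \sum_(_ < _) _; set C := \sum_(_ < _) _.
have -> : C = (A + B) / 2.
  rewrite /A /B /C -big_split mulr_suml; apply: eq_bigr => m _.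
  set u := walk_surv N m.+1 x.+1; set v := walk_surv N m.+1 x.-1.
  set u' := walk_surv N m x.+1; set v' := walk_surv N m x.-1.
  set r := fc_refill _ _ _.
  by rewrite -[RHS]/(((u' - u) * r + (v' - v) * r) / 2); field.
rewrite ltnS -[n.+1.-1]/n.
set b1 := (nat_of_bool (~~ (0 < x.+1 < N)%N))%:R.
set b2 := (nat_of_bool (~~ (0 < x.-1 < N)%N))%:R.
by field.
Qed.

Lemma fc_tail_renewal N M n : (1 < N)%N ->
  fc_tail N M n = (n < M)%N%:R * walk_surv N n 1 +
    \sum_(m < minn n M) (walk_surv N m 1 - walk_surv N m.+1 1) *
      fc_refill N M (n - m.+1)%N.
Proof.
by move=> N1; rewrite /fc_tail fc_surv_renewal ?(ltnW N1)// N1 mul0r add0r.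
Qed.

Lemma walk_surv_itv N n x : 0 <= walk_surv N n x <= 1.
Proof.
elim: n x => [|n IH] x /=; case: ifP; rewrite ?lexx ?ler01// => _.
by have := IH x.+1; have := IH x.-1; lra.
Qed.

Lemma walk_surv_ni N n x : walk_surv N n.+1 x <= walk_surv N n x.
Proof.
elim: n x => [|n IH] x.
  have h y : walk_surv N 0 y <= 1 by have /andP[] := walk_surv_itv N 0 y.
  rewrite [leLHS]/= [leRHS]/=; case: ifP => // _.
  by have := h x.+1; have := h x.-1; rewrite /=; lra.
rewrite [leLHS]/= [leRHS]/=; case: ifP => // _.
by have := IH x.+1; have := IH x.-1; rewrite /=; lra.
Qed.

Lemma fc_surv_itv N M n x i : 0 <= fc_surv N M n x i <= 1.
Proof.
elim: n x i => [|n IH] x i /=; case: ifP; rewrite ?lexx ?ler01// => _.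
case: ifP => _; last exact: IH.
by have := IH x.+1 i.-1; have := IH x.-1 i.-1; lra.
Qed.

Lemma fc_surv_ni N M n x i : fc_surv N M n.+1 x i <= fc_surv N M n x i.
Proof.
elim: n x i => [|n IH] x i.
  by have /andP[_] := fc_surv_itv N M 1 x i; rewrite /=; case: ifP => //; rewrite lexx.
rewrite [leLHS]/= [leRHS]/=; case: ifP => // _; case: ifP => _; last exact: IH.
by have := IH x.+1 i.-1; have := IH x.-1 i.-1; rewrite /=; lra.
Qed.

End survival.

(** * Distribution and mean of the lifetime in terms of survival probabilities *)

Section lifetime_law.
Context {R : realType} {d : measure_display} {T : measurableType d}.
Context (P : probability T R) (N M : nat) (Z : nat -> T -> fc_state N M).

Let alive n := [set w | forall k, (k <= n)%N -> ~~ absorbed (Z k w)].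

Lemma lifetime_gt n : [set w | ((n%:R)%:E < lifetime R Z w)%E] = alive n.
Proof.
apply/seteqP; split=> w /=.
  move=> h k kn; apply/negP => /andP[Ik /eqP Ek]; move: h; rewrite ltNge => /negP; apply.
  apply: (@le_trans _ _ (k%:R)%:E); last by rewrite lee_fin ler_nat.
  by apply: ereal_inf_lbound; exists k.
move=> h; apply: (@lt_le_trans _ _ (n.+1%:R)%:E); first by rewrite lte_fin ltr_nat.
apply: le_ereal_inf_tmp => _ [k [Ik Ek] <-]; rewrite lee_fin ler_nat ltnNge.
by apply/negP => /h; rewrite /absorbed Ik Ek.
Qed.

End lifetime_law.

Definition fc_cdf {R : realType} N M (x : R) : R :=
  if x < 0 then 0 else 1 - fc_tail N M (Num.truncn (x * M%:R)).

Section lifetime_distribution.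
Context {R : realType} {d : measure_display} {T : measurableType d}.
Context (P : probability T R) (N M : nat) (Z : nat -> T -> fc_state N M).
Hypotheses (M0 : (0 < M)%N) (N1 : (1 < N)%N).
Hypothesis fcZ : fc_model P (inord 1, ord_max) Z.

Let alive n := [set w | forall k, (k <= n)%N -> ~~ absorbed (Z k w)].

Let malive n : measurable (alive n).
Proof.
exact: (@measurable_prefix _ _ _ Z n (fun=> [set a | ~~ absorbed a]) (markov_measurable fcZ)).
Qed.

Lemma alive_prob n : P (alive n) = (fc_tail N M n)%:E.
Proof.
rewrite /alive (avoid_prob _ _ fcZ) avoid_fc//= inordK//.
by rewrite ltnS ltnW.
Qed.

Lemma lifetime_distribution x : distribution_function P
  (fun w => (M%:R^-1)%:E * lifetime R Z w)%E x = (fc_cdf N M x)%:E.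
Proof.
have M0' : 0 < M%:R :> R by rewrite ltr0n.
rewrite /distribution_function /fc_cdf.
under eq_set do rewrite lee_pdivrMl//.
case: ltP => x0.
  rewrite (_ : [set _ | _] = set0) ?measure0// -subset0 => w /=.
  apply/negP; rewrite -ltNge; apply: (@lt_le_trans _ _ 0%E).
    by rewrite -EFinM lte_fin pmulr_rlt0.
  by apply: le_ereal_inf_tmp => _ [k _ <-]; rewrite lee_fin.
rewrite EFinB -alive_prob -probability_setC//; congr (P _).
have xM : 0 <= x * M%:R by rewrite mulr_ge0// ltW.
rewrite /alive -(@lifetime_gt R); apply/seteqP; split=> w /= h; last first.
  apply: (@le_trans _ _ ((Num.truncn (x * M%:R))%:R)%:E); first by rewrite leNgt; apply/negP.
  by rewrite -EFinM lee_fin (mulrC M%:R) truncn_le.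
apply/negP; rewrite -leNgt.
(* The infimum is over integers: with no absorption time up to x M it would be at least the
   truncation plus one, which exceeds x M. *)
have [k [Ik Ek] kx] : exists2 k, interior_site (Z k w).1 /\ (Z k w).2 = 0%N :> nat & (k%:R <= x * M%:R).
  apply: contrapT => hk.
  have : ((Num.truncn (x * M%:R)).+1%:R%:E <= lifetime R Z w)%E.
    apply: le_ereal_inf_tmp => _ [k Ik <-]; rewrite lee_fin ler_nat.
    rewrite truncn_lt_nat// ltNge; apply/negP => kx; apply: hk; by exists k.
  move=> /le_trans/(_ h); rewrite -EFinM lee_fin (mulrC M%:R) leNgt => /negP; apply.
  exact: truncnS_gt.
apply: (@le_trans _ _ (k%:R)%:E); first by apply: ereal_inf_lbound; exists k.
by rewrite lee_fin ler_nat leqNgt truncn_lt_nat// -leNgt.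
Qed.

(** Layer-cake formula, valid pointwise: on a path that is never absorbed both sides are [+oo], so
    the mean can be computed without first proving that the lifetime is almost surely finite. *)
Lemma lifetime_series w : lifetime R Z w = (\sum_(0 <= n <oo) (\1_(alive n) w : R)%:E)%E.
Proof.
have [[n0 An0]|nA] := pselect (exists n, absorbed (Z n w)); last first.
  have al n : alive n w by move=> k _; apply/negP => Ak; apply: nA; exists k.
  rewrite /lifetime (_ : [set n | _] = set0); last first.
    by rewrite -subset0 => n [In En]; apply: nA; exists n; rewrite /absorbed In En.
  rewrite image_set0 ereal_inf0; apply/esym/cvg_lim => //.
  under eq_fun do under eq_bigr do rewrite indicE mem_set//.
  under eq_fun do rewrite sumEFin big_const_nat subn0 iter_addr_0.
  by apply/cvgeryP; exact: cvgr_idn.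
have exA : exists n, absorbed (Z n w) by exists n0.
case: (ex_minnP exA) => m Am mmin.
have alE n : alive n w = (n < m)%N.
  apply/propext; split=> [al|nm k kn].
    by rewrite ltnNge; apply/negP => /al; rewrite Am.
  by apply/negP => /mmin mk; move: nm; rewrite ltnNge (leq_trans mk).
transitivity (m%:R%:E : \bar R).
  apply/eqP; rewrite eq_le; apply/andP; split.
    by have /andP[Im /eqP Em] := Am; apply: ereal_inf_lbound; exists m.
  apply: le_ereal_inf_tmp => _ [k [Ik Ek] <-]; rewrite lee_fin ler_nat mmin//.
  by rewrite /absorbed Ik Ek.
rewrite (@nneseries_split _ _ 0 m)//.
rewrite add0n eseries0 ?adde0; last first.
  by move=> k mk _; rewrite indicE memNset// alE; apply/negP; rewrite -leqNgt.
rewrite big_nat (eq_bigr (fun=> 1%E)) => [|k /andP[_ km]]; last first.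
  by rewrite indicE mem_set// alE.
by rewrite -big_nat sumEFin big_const_nat subn0 iter_addr_0.
Qed.

Lemma lifetime_mean : (\int[P]_w lifetime R Z w)%E =
  (\sum_(0 <= n <oo) (fc_tail N M n)%:E)%E.
Proof.
under eq_integral do rewrite lifetime_series.
rewrite integral_nneseries//.
- by apply: eq_eseriesr => n _; rewrite integral_indic// setIT; exact: alive_prob.
- by move=> n; apply/measurable_EFinP; exact: measurable_indic.

Qed.

End lifetime_distribution.

(** * The renewal equation *)

Section renewal.
Context {R : realType}.
Variables (M : nat) (q T : nat -> R) (z : R).

Definition refill n : R := if n is n'.+1 then T n' else 1.

(* Generating function of the hitting time [m.+1 <= M] of the boundary, when
   [q m] is the probability that it exceeds [m]. *)
Definition cycle_gf : R := \sum_(m < M) (q m - q m.+1) * z ^+ m.+1.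

Definition tail_gf : R := \sum_(m < M) q m * z ^+ m.

Hypothesis q0 : q 0 = 1.

(** Summation by parts. It trades the increments of [q] for [q] itself, whose scaling limit is
    accessible. *)
Lemma cycle_gfE : cycle_gf = 1 + (z - 1) * tail_gf - q M * z ^+ M.
Proof.
rewrite /cycle_gf /tail_gf; elim: M => [|m IH].
  by rewrite !big_ord0 mulr0 expr0 q0; ring.
by rewrite !big_ord_recr/= IH !exprS; ring.
Qed.

Hypothesis q_ni : forall n, q n.+1 <= q n.
Hypothesis T_ge0 : forall n, 0 <= T n.
Hypothesis T_renewal : forall n, T n = (n < M)%N%:R * q n +
  \sum_(m < minn n M) (q m - q m.+1) * refill (n - m.+1)%N.

Let bsum K := \sum_(n < K) refill n * z ^+ n.
Let tsum K := \sum_(n < K) T n * z ^+ n.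

(** The convolution in the renewal equation, summed up to [K] and reordered by the cycle length.
    Truncated subtraction makes [bsum] empty for cycles longer than the horizon. *)
Lemma tsum_renewal K : tsum K = \sum_(n < K) (n < M)%N%:R * (q n * z ^+ n) +
  \sum_(m < M) (q m - q m.+1) * z ^+ m.+1 * bsum (K - m.+1)%N.
Proof.
elim: K => [|K IH].
  by rewrite /tsum !big_ord0 add0r big1// => m _; rewrite /bsum big_ord0 mulr0.
rewrite /tsum big_ord_recr -/(tsum K) IH big_ord_recr/= -!addrA; congr (_ + _).
rewrite T_renewal mulrDl addrCA mulrA; congr (_ + _).
have -> : \sum_(m < minn K M) (q m - q m.+1) * refill (K - m.+1)%N =
   \sum_(m < M) (m < K)%N%:R * ((q m - q m.+1) * refill (K - m.+1)%N).
  rewrite (big_ord_widen M (fun m => (q m - q m.+1) * refill (K - m.+1)%N) (geq_minr _ _)).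
  rewrite big_mkcond; apply: eq_bigr => m _; rewrite leq_min ltn_ord andbT.
  by case: ifP; rewrite ?mul1r ?mul0r.
rewrite mulr_suml -big_split/=; apply: eq_bigr => m _; rewrite subSS.
case: ltnP => mK; last first.
  by rewrite (_ : (K - m)%N = (K - m.+1)%N) ?mul0r ?addr0//; lia.
have -> : (K - m)%N = (K - m.+1).+1 by lia.
have -> : z ^+ K = z ^+ m.+1 * z ^+ (K - m.+1) by rewrite -exprD; congr (_ ^+ _); lia.
by rewrite /bsum big_ord_recr/=; ring.
Qed.

Lemma bsumS K : bsum K.+1 = 1 + z * tsum K.
Proof.
rewrite /bsum big_ord_recl/= expr0 mulr1 /tsum mulr_sumr; congr (_ + _).
by apply: eq_bigr => i _; rewrite /= exprS; ring.
Qed.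

Hypothesis z_gt0 : 0 < z.
Hypothesis cycle_lt1 : 0 < 1 - z * cycle_gf.
Hypothesis q_ge0 : forall n, 0 <= q n.

Let bsum_nd K L : (K <= L)%N -> bsum K <= bsum L.
Proof.
move=> KL; rewrite -(subnKC KL) /bsum big_split_ord/= lerDl sumr_ge0// => i _.
by rewrite mulr_ge0 ?exprn_ge0 ?(ltW z_gt0)//; case: (K + i)%N => //= n.
Qed.

(** Enlarging every [bsum (K - m.+1)] to [bsum K.+1] closes the recursion into a linear inequality
    for [tsum K], which [cycle_lt1] allows to solve. *)
Lemma tsum_le K : tsum K <= (tail_gf + cycle_gf) / (1 - z * cycle_gf).
Proof.
rewrite ler_pdivlMr// mulrBr mulr1 lerBlDr.
have -> : tail_gf + cycle_gf + tsum K * (z * cycle_gf) = tail_gf + cycle_gf * bsum K.+1.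
  by rewrite bsumS; ring.
rewrite {1}tsum_renewal lerD//.
  case: (leqP K M) => KM.
    rewrite /tail_gf (big_ord_widen M (fun n => (n < M)%N%:R * (q n * z ^+ n)) KM).
    rewrite big_mkcond; apply: ler_sum => i _; rewrite ltn_ord mul1r.
    by case: ifP => // _; rewrite mulr_ge0// exprn_ge0// ltW.
  rewrite /tail_gf (big_ord_widen K (fun n => q n * z ^+ n) (ltnW KM)).
  rewrite [leRHS]big_mkcond; apply: ler_sum => i _.
  by case: ifP; rewrite ?mul1r ?mul0r.
rewrite mulr_suml ler_sum// => m _; rewrite ler_wpM2l ?bsum_nd//; [|lia].
by rewrite mulr_ge0 ?subr_ge0// exprn_ge0// ltW.
Qed.

(** The partial sums increase and are bounded, so they have a limit; passing to the limit in
    [tsum_renewal] gives a linear equation that determines it. *)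
Lemma tsum_cvg : tsum K @[K --> \oo] --> (tail_gf + cycle_gf) / (1 - z * cycle_gf).
Proof.
have tnd : nondecreasing_seq tsum.
  apply/nondecreasing_seqP => K; rewrite /tsum big_ord_recr/= lerDl.
  by rewrite mulr_ge0// exprn_ge0// ltW.
have tcvg : cvgn tsum.
  apply: nondecreasing_is_cvgn => //; exists ((tail_gf + cycle_gf) / (1 - z * cycle_gf)).
  by move=> _ [K _ <-]; exact: tsum_le.
set l := limn tsum.
have bcvg : bsum K @[K --> \oo] --> 1 + z * l.
  rewrite -(cvg_shiftS bsum); under eq_fun do rewrite bsumS.
  by apply: cvgD; [exact: cvg_cst|apply: cvgMr].
suff -> : (tail_gf + cycle_gf) / (1 - z * cycle_gf) = l by [].
suff lE : l = tail_gf + cycle_gf * (1 + z * l).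
  have : l * (1 - z * cycle_gf) = tail_gf + cycle_gf by rewrite mulrBr mulr1 {1}lE; ring.
  by move=> <-; rewrite mulfK// gt_eqF.
apply/cvg_lim => //.
have -> : tsum = (fun K => \sum_(n < K) (n < M)%N%:R * (q n * z ^+ n)) \+
    (fun K => \sum_(m < M) (q m - q m.+1) * z ^+ m.+1 * bsum (K - m.+1)%N).
  by apply/funext => K; rewrite /= tsum_renewal.
apply: cvgD.
  apply: cvg_near_cst; exists M => // K /= MK.
  rewrite /tail_gf (big_ord_widen K (fun n => q n * z ^+ n) MK) [RHS]big_mkcond.
  by apply: eq_bigr => i _; case: ifP; rewrite ?mul1r ?mul0r.
rewrite /cycle_gf mulr_suml; apply: cvg_big => [|m _]; first exact: add_continuous.
  apply: cvgMr.
apply: (cvg_comp _ _ _ bcvg); apply/cvgnyPge => A; exists (A + m.+1)%N => // K /= AK.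
by rewrite -(addnK m.+1 A) leq_sub2r.
Qed.

End renewal.

(** * Spectral formula for the walk *)

Section spectral.
Context {R : realType}.
Implicit Types N n x j : nat.

Definition theta N j : R := pi * (2 * j%:R + 1) / N%:R.

Lemma sin_pi_nat n : sin (pi * n%:R : R) = 0.
Proof.
elim: n => [|n IH]; first by rewrite mulr0 sin0.
by rewrite -natr1 mulrDr mulr1 sinDpi IH oppr0.
Qed.

Lemma theta_half_itv N j : (j < N)%N -> 0 < theta N j / 2 < pi.
Proof.
move=> jN; have N0 : 0 < N%:R :> R by rewrite ltr0n; lia.
have pi0 := @pi_gt0 R.
have j0 : 0 <= j%:R :> R by rewrite ler0n.
have jN' : j%:R + 1 <= N%:R :> R by rewrite natr1 ler_nat.
have -> : theta N j / 2 = pi * ((2 * j%:R + 1) / (N%:R * 2)).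
  by rewrite /theta; field; rewrite gt_eqF.
apply/andP; split; first by apply: mulr_gt0 => //; apply: divr_gt0; lra.
by rewrite gtr_pMr// ltr_pdivrMr; lra.
Qed.

Lemma sin_half_neq0 N j : (j < N)%N -> sin (theta N j / 2) != 0.
Proof. by move=> /theta_half_itv h; rewrite gt_eqF// sin_gt0_pi. Qed.

(** After multiplication by 2 sin(pi x / N) each summand is a difference of two sines, and the sum
    telescopes to sin(2 pi x) - sin 0 = 0. *)
Lemma sum_cos_theta N x : (0 < x < N)%N -> \sum_(j < N) cos (theta N j * x%:R) = 0.
Proof.
move=> /andP[x0 xN].
have N0 : N%:R != 0 :> R by rewrite pnatr_eq0; lia.
have s0 : sin (pi * x%:R / N%:R : R) != 0.
  rewrite gt_eqF// sin_gt0_pi// !divr_gt0 ?mulr_gt0 ?pi_gt0 ?ltr0n//=; [|lia].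
  by rewrite ltr_pdivrMr ?ltr0n; [rewrite ltr_pM2l ?pi_gt0// ltr_nat|lia].
apply: (mulfI (mulf_neq0 (_ : 2 != 0) s0)) => //; rewrite mulr0 mulr_sumr.
pose f j := sin (pi * (2 * j%:R) * x%:R / N%:R : R).
transitivity (\sum_(j < N) (f j.+1 - f j)).
  apply: eq_bigr => j _; rewrite /f.
  rewrite (_ : theta N j * _ = pi * (2 * j%:R) * x%:R / N%:R + pi * x%:R / N%:R); last first.
    by rewrite /theta; field.
  rewrite (_ : pi * (2 * j.+1%:R) * x%:R / N%:R = pi * (2 * j%:R) * x%:R / N%:R + pi * x%:R / N%:R + pi * x%:R / N%:R); last first.
    by rewrite -natr1; field.
  move: (pi * (2 * j%:R) * _ / _) (pi * x%:R / _) => a b.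
  rewrite !(sinD, cosD); have := cos2Dsin2 b.
  move: (sin a) (cos a) (sin b) (cos b) => sa ca sb cb e.
  apply/eqP; rewrite -subr_eq0.
  rewrite [X in X == 0](_ : _ = - sa * (cb ^+ 2 + sb ^+ 2 - 1)); last by ring.
  by rewrite e subrr mulr0.
rewrite -(big_mkord xpredT (fun j => f j.+1 - f j)) telescope_sumr// /f.
rewrite (_ : pi * (2 * N%:R) * x%:R / N%:R = pi * (2 * x)%:R); last by rewrite natrM; field.
by rewrite sin_pi_nat mulr0 mulr0 !mul0r sin0 subrr.
Qed.

Lemma sin_double (h : R) : sin (h * 2) = 2 * sin h * cos h.
Proof. by rewrite mulr_natr sin_mulr2n -mulr_natr; ring. Qed.

Lemma cos_double (h : R) : cos (h * 2) = 2 * cos h ^+ 2 - 1.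
Proof. by rewrite mulr_natr cos_mulr2n -mulr_natr; ring. Qed.

(** With h a half-angle, the factor cot h turns an increment of the sine into a sum of cosines, and
    those vanish when summed over the modes by [sum_cos_theta]. *)
Lemma sin_step (y h : R) : sin h != 0 ->
  (sin (y + h * 2) - sin y) * (cos h / sin h) = cos y + cos (y + h * 2).
Proof.
move=> s0; rewrite sinD cosD sin_double cos_double.
have := cos2Dsin2 h; move: s0; move: (sin h) (cos h) (sin y) (cos y) => s c sy cy s0 e.
apply: (mulIf s0); rewrite mulrA divfK//; apply/eqP; rewrite -subr_eq0.
rewrite [X in X == 0](_ : _ = 2 * sy * c * (c ^+ 2 + s ^+ 2 - 1)); last by ring.
by rewrite e subrr mulr0.
Qed.

Lemma cos_step (y h : R) : sin h != 0 ->
  (cos y - cos (y + h * 2)) / (2 * sin h ^+ 2) = cos y + sin y * (cos h / sin h).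
Proof.
move=> s0; rewrite cosD sin_double cos_double.
have := cos2Dsin2 h; move: s0; move: (sin h) (cos h) (sin y) (cos y) => s c sy cy s0 e.
have s2 : 2 * s ^+ 2 != 0 by rewrite mulf_neq0 ?expf_neq0.
apply: (mulIf s2); rewrite divfK// [RHS]mulrDl.
rewrite (_ : sy * (c / s) * _ = 2 * sy * c * s); last by field.
apply/eqP; rewrite -subr_eq0.
rewrite [X in X == 0](_ : _ = 2 * cy * (1 - (c ^+ 2 + s ^+ 2))); last by ring.
by rewrite e subrr mulr0.
Qed.

(* [N%:R * walk_surv N n x] expanded in the eigenfunctions
   [x |-> sin (theta N j * x)] of the killed walk; only the odd modes
   charge the constant function 1. *)
Definition cotan_kernel N n x : R := \sum_(j < N)
  sin (theta N j * x%:R) * (cos (theta N j / 2) / sin (theta N j / 2)) *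
  cos (theta N j) ^+ n.

Lemma theta_mulS N j x : theta N j * x.+1%:R = theta N j * x%:R + theta N j / 2 * 2.
Proof. by rewrite divfK// -natr1; ring. Qed.

Lemma cotan_kernel_step N x : cotan_kernel N 0 x.+1 - cotan_kernel N 0 x =
  \sum_(j < N) (cos (theta N j * x%:R) + cos (theta N j * x.+1%:R)).
Proof.
rewrite -sumrB; apply: eq_bigr => j _; rewrite !expr0 !mulr1 -mulrBl theta_mulS.
by rewrite sin_step// sin_half_neq0.
Qed.

Lemma cotan_kernel_bd N n x : (x == 0)%N || (x == N)%N -> cotan_kernel N n x = 0.
Proof.
move=> xN; apply: big1 => j _; suff -> : sin (theta N j * x%:R : R) = 0 by rewrite !mul0r.
case/orP: xN => /eqP ->; first by rewrite mulr0 sin0.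
have N0 : N%:R != 0 :> R by rewrite pnatr_eq0; have := ltn_ord j; lia.
by rewrite /theta divfK// (_ : 2 * j%:R + 1 = (2 * j + 1)%:R) ?sin_pi_nat// natrD natrM.
Qed.

(** The kernel is 0 at x = 0, its first increment is the sum of [N] values cos 0, and every later
    increment inside the interval is 0. *)
Lemma cotan_kernel0 N x : (0 < x < N)%N -> cotan_kernel N 0 x = N%:R.
Proof.
case: x => // x; elim: x => [|x IH] xN.
  rewrite -[LHS]subr0 -(cotan_kernel_bd (N := N) 0 (_ : (0 == 0)%N || _))//.
  rewrite cotan_kernel_step big_split (sum_cos_theta xN); rewrite -[LHS]/(_ + 0) addr0.
  by under eq_bigr do rewrite mulr0 cos0; rewrite sumr_const card_ord.
have := cotan_kernel_step N x.+1; rewrite big_split (sum_cos_theta xN) (sum_cos_theta (x := x.+1)) -?[RHS]/(0 + 0); [|lia].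
by rewrite addr0 => /eqP; rewrite subr_eq0 IH => [/eqP//|]; lia.
Qed.

Lemma cotan_kernelS N n x :
  cotan_kernel N n x.+2 + cotan_kernel N n x = 2 * cotan_kernel N n.+1 x.+1.
Proof.
rewrite -big_split mulr_sumr; apply: eq_bigr => j _ /=.
rewrite (_ : theta N j * x.+2%:R = theta N j * x.+1%:R + theta N j); last first.
  by rewrite -(natr1 x.+1); ring.
rewrite (_ : theta N j * x%:R = theta N j * x.+1%:R - theta N j); last first.
  by rewrite -(natr1 x); ring.
by rewrite sinD sinB exprSr; ring.
Qed.

Lemma walk_surv_kernel N n x : (x <= N)%N -> (1 < N)%N ->
  N%:R * walk_surv N n x = cotan_kernel N n x.
Proof.
move=> + N1; elim: n x => [|n IH] x xN /=; case: ifPn => xint.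
- by rewrite mulr1 cotan_kernel0.
- by rewrite mulr0 cotan_kernel_bd//; lia.
- case: x xN xint => // x xN xint.
  rewrite /= mulrA mulrDr !IH ?cotan_kernelS; [|lia..].
  by rewrite mulrAC divff ?mul1r.
- by rewrite mulr0 cotan_kernel_bd//; lia.
Qed.

Lemma walk_surv1 N n : (1 < N)%N ->
  N%:R * walk_surv N n 1 = \sum_(j < N) (1 + cos (theta N j)) * cos (theta N j) ^+ n.
Proof.
move=> N1; rewrite walk_surv_kernel ?(ltnW N1)//; apply: eq_bigr => j _; congr (_ * _).
rewrite theta_mulS mulr0 add0r.
have := @sin_step 0 _ (sin_half_neq0 (ltn_ord j)).
rewrite sin0 subr0 cos0 add0r => ->.
by rewrite divfK.
Qed.

(** By [cos_step] the function [U] has the constant increment [N]: at x = 0 it comes from the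
    cosines, inside from [cotan_kernel0]. At x = N every cosine equals -1, so that [U N] is the
    wanted sum. *)
Lemma sum_inv_sin2 N : (1 < N)%N -> \sum_(j < N) (sin (theta N j / 2) ^- 2) = N%:R ^+ 2 :> R.
Proof.
move=> N1.
pose U x := \sum_(j < N) (1 - cos (theta N j * x%:R)) / (2 * sin (theta N j / 2) ^+ 2).
have US x : (x < N)%N -> U x.+1 - U x = N%:R.
  move=> xN; rewrite -sumrB.
  transitivity (\sum_(j < N) (cos (theta N j * x%:R) +
      sin (theta N j * x%:R) * (cos (theta N j / 2) / sin (theta N j / 2)) * cos (theta N j) ^+ 0)).
    apply: eq_bigr => j _; rewrite expr0 mulr1 theta_mulS -cos_step ?sin_half_neq0//.
    by rewrite -mulrBl; congr (_ / _); ring.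
  rewrite big_split/= -/(cotan_kernel N 0 x); case: (posnP x) => [->|x0].
    rewrite cotan_kernel_bd// addr0.
    by under eq_bigr do rewrite mulr0 cos0; rewrite sumr_const card_ord.
  by rewrite cotan_kernel0 ?x0// sum_cos_theta ?x0// add0r.
have UN x : (x <= N)%N -> U x = x%:R * N%:R.
  elim: x => [|x IH] xN; first by rewrite mul0r /U big1// => j _; rewrite mulr0 cos0 subrr mul0r.
  by have := US x xN => /eqP; rewrite subr_eq IH 1?ltnW// => /eqP ->; rewrite -natr1; ring.
have := UN N (leqnn _); rewrite expr2 => <-; apply: eq_bigr => j _.
have -> : cos (theta N j * N%:R) = - 1 :> R.
  have N0 : N%:R != 0 :> R by rewrite pnatr_eq0; lia.
  rewrite /theta divfK//; elim: (j : nat) => [|k IH]; first by rewrite mulr0 add0r mulr1 cospi.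
  rewrite (_ : pi * _ = pi * (2 * k%:R + 1) + pi *+ 2) ?cosD2pi//.
  by rewrite -natr1; ring.
by field; exact: sin_half_neq0.
Qed.

End spectral.

(** * The function H and the diffusive limit of the walk *)

Section theta_series.
Context {R : realType}.
Implicit Types (y t a : R) (j n : nat).

(* The exponents of [H], with the summation index shifted to start at [0]. *)
Definition rate j : R := pi ^+ 2 * (2 * j%:R + 1) ^+ 2 / 2.

Lemma rate_ge1 j : 1 <= rate j.
Proof.
have p2 := @pi_ge2 R; have j0 : 0 <= j%:R :> R by rewrite ler0n.
by rewrite /rate; nra.
Qed.

Lemma rate_gt0 j : 0 < rate j. Proof. exact: lt_le_trans (rate_ge1 j). Qed.

Lemma rate_ge j : j.+1%:R ^+ 2 <= rate j.
Proof.
have p2 := @pi_ge2 R; have j0 : 0 <= j%:R :> R by rewrite ler0n.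
have pp : 4 <= pi ^+ 2 :> R by nra.
by rewrite /rate -natr1; nra.
Qed.

Lemma H_partial y n : \sum_(1 <= k < n.+1) expR (- (pi ^+ 2 * (2 * k%:R - 1) ^+ 2 * y / 2)) =
  \sum_(j < n) expR (- (rate j * y)).
Proof.
rewrite big_add1/= big_mkord; apply: eq_bigr => j _; congr expR.
by rewrite /rate -natr1; field.
Qed.

Lemma expR_le_inv a : 0 < a -> expR (- a) <= a^-1.
Proof.
move=> a0; rewrite expRN lef_pV2 ?posrE ?expR_gt0//.
by apply: le_trans (expR_ge1Dx a); rewrite lerDr.
Qed.

(** Telescoping: 1/(n+1)^2 is below 1/((n+1)^2 - 1/4) = 2/(2n+1) - 2/(2n+3). *)
Lemma sum_inv_sq_le n : \sum_(j < n) (j.+1%:R ^- 2 : R) <= 2 - 2 / (2 * n%:R + 1).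
Proof.
elim: n => [|n IH]; first by rewrite big_ord0 mulr0 add0r divr1 subrr.
rewrite big_ord_recr/= (le_trans (lerD IH (lexx _)))//.
rewrite -(natr1 n); set u := n%:R; have u0 : 0 <= u by rewrite ler0n.
rewrite -subr_ge0 (_ : _ - _ = ((u + 1) ^+ 2 * (2 * u + 1) * (2 * u + 3))^-1).
  by rewrite invr_ge0 !mulr_ge0 ?exprn_ge0; lra.
by field; do ?[apply/andP; split]; lra.
Qed.

Lemma sum_inv_rate_le n : \sum_(j < n) (rate j)^-1 <= 2.
Proof.
apply: (@le_trans _ _ (\sum_(j < n) (j.+1%:R ^- 2 : R))).
  by apply: ler_sum => j _; rewrite lef_pV2 ?posrE ?rate_gt0 ?exprn_gt0// rate_ge.
by rewrite (le_trans (sum_inv_sq_le n))// lerBlDr lerDl divr_ge0 ?addr_ge0 ?mulr_ge0.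
Qed.

Lemma theta_sum_le y n : 0 < y -> \sum_(j < n) expR (- (rate j * y)) <= 2 / y.
Proof.
move=> y0; apply: (@le_trans _ _ (\sum_(j < n) (rate j)^-1 / y)).
  apply: ler_sum => j _; rewrite -invfM; apply: expR_le_inv.
  by rewrite mulr_gt0 ?rate_gt0.
by rewrite -mulr_suml ler_pM2r ?invr_gt0// sum_inv_rate_le.
Qed.

Lemma H_cvg y : 0 < y -> \sum_(j < n) expR (- (rate j * y)) @[n --> \oo] --> H y.
Proof.
move=> y0; rewrite /H.
have nd : nondecreasing_seq (fun n => \sum_(j < n) expR (- (rate j * y))).
  by apply/nondecreasing_seqP => n; rewrite big_ord_recr/= lerDl expR_ge0.
have cv : cvgn (fun n => \sum_(j < n) expR (- (rate j * y))).
  apply: nondecreasing_is_cvgn => //; exists (2 / y) => _ [n _ <-].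
  exact: theta_sum_le.
set u := fun n => \sum_(1 <= k < n) _.
have uS n : u n.+1 = \sum_(j < n) expR (- (rate j * y)) by exact: H_partial.
have ul : u @ \oo --> limn (fun n => \sum_(j < n) expR (- (rate j * y))).
  by rewrite -(cvg_shiftS u) /=; under eq_fun do rewrite uS; exact: cv.
by rewrite (cvg_lim _ ul).
Qed.

Lemma H_ge_partial y n : 0 < y -> \sum_(j < n) expR (- (rate j * y)) <= H y.
Proof.
move=> y0; rewrite -(cvg_lim _ (H_cvg y0))//; apply: nondecreasing_cvgn_le.
  by apply/nondecreasing_seqP => k; rewrite big_ord_recr/= lerDl expR_ge0.
by apply/cvg_ex; exists (H y); exact: H_cvg.
Qed.

Lemma H_gt0 y : 0 < y -> 0 < H y.
Proof.
by move=> y0; apply: lt_le_trans (H_ge_partial 1 y0); rewrite big_ord1 expR_gt0.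
Qed.

Lemma H_ni y t : 0 < y -> y <= t -> H t <= H y.
Proof.
move=> y0 yt; have t0 := lt_le_trans y0 yt.
apply: (ler_cvg_to (H_cvg t0) (H_cvg y0)); apply: nearW => n.
by apply: ler_sum => j _; rewrite ler_expR lerN2 ler_pM2l ?rate_gt0.
Qed.

End theta_series.

(** * Bounds on the cosine and Tannery's theorem *)

Section trigonometric_bounds.
Context {R : realType}.
Implicit Types x y : R.

Lemma sin_le_id x : 0 <= x -> sin x <= x.
Proof.
move=> x0.
have [c _] : exists2 c, c \in `[0, x] & sin x - sin 0 = cos c * (x - 0).
  apply: MVT_segment => //.
  by apply: continuous_subspaceT; exact: continuous_sin.
by rewrite sin0 !subr0 => ->; rewrite ler_piMl// cos_le1.
Qed.

Lemma mul_cos_le_sin x : 0 <= x <= pi / 2 -> x * cos x <= sin x.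
Proof.
move=> /andP[x0 xp].
pose f y := sin y - y * cos y; pose df y : R := y * sin y.
have [c] : exists2 c, c \in `[0, x] & f x - f 0 = df c * (x - 0).
  apply: MVT_segment => //.
    move=> y _; rewrite /f /df.
    apply: is_derive_eq.
    by rewrite /GRing.scale/=; ring.
  apply: continuous_subspaceT => y; apply: cvgB; first exact: continuous_sin.
  by apply: cvgM; [exact: cvg_id|exact: continuous_cos].
rewrite in_itv/= => /andP[c0 cx].
rewrite /f /df sin0 mul0r !subr0 => e; rewrite -subr_ge0 e !mulr_ge0// sin_ge0_pi// c0/=.
by have := @pi_ge0 R; lra.
Qed.

Lemma cos_half x : cos x = 1 - 2 * sin (x / 2) ^+ 2.
Proof.
have {1}-> : x = x / 2 *+ 2 by rewrite -mulr_natr divfK.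
by rewrite cos_mulr2n cos2sin2; ring.
Qed.

Lemma cos_ge_sq x : 0 <= x <= pi -> 1 - x ^+ 2 / 2 <= cos x.
Proof.
move=> /andP[x0 xp]; rewrite cos_half.
have s0 : 0 <= sin (x / 2) by rewrite sin_ge0_pi//; lra.
have sx : sin (x / 2) <= x / 2 by rewrite sin_le_id//; lra.
by nra.
Qed.

(** With h = x/2, sin^2 h >= h^2 cos^2 h = h^2 (1 - sin^2 h) >= h^2 (1 - h^2); the constant 1/8
    comes from there. *)
Lemma cos_le_quartic x : 0 <= x <= pi -> cos x <= 1 - x ^+ 2 / 2 + x ^+ 4 / 8.
Proof.
move=> /andP[x0 xp]; rewrite cos_half.
have y0 : 0 <= x / 2 <= pi / 2 by lra.
have s0 : 0 <= sin (x / 2) by rewrite sin_ge0_pi//; lra.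
have sx : sin (x / 2) <= x / 2 by rewrite sin_le_id//; lra.
have cx := mul_cos_le_sin y0.
have c0 : 0 <= cos (x / 2) by rewrite cos_ge0_pihalf//; lra.
have := cos2Dsin2 (x / 2); move: (sin (x / 2)) (cos (x / 2)) s0 sx cx c0 => s c s0 sx cx c0 e.
have h1 : (x / 2 * c) ^+ 2 <= s ^+ 2 by rewrite ler_sqr ?nnegrE ?mulr_ge0//; lra.
have h2 : s ^+ 2 <= (x / 2) ^+ 2 by rewrite ler_sqr ?nnegrE//; lra.
have c2 : c ^+ 2 = 1 - s ^+ 2 by lra.
have h3 : (x / 2) ^+ 2 * (1 - (x / 2) ^+ 2) <= s ^+ 2.
  apply: le_trans h1; rewrite [leRHS]exprMn c2 ler_wpM2l ?exprn_ge0//; lra.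
have e4 : (x / 2) ^+ 2 * (1 - (x / 2) ^+ 2) = x ^+ 2 / 4 - x ^+ 4 / 16 by field.
by lra.
Qed.

(** On this range cos^2(x/2) >= 1/2, hence sin^2(x/2) >= x^2/8. The exponent is half the
    asymptotically correct one; this loss reappears as a factor 1/2 in the bounds on the walk. *)
Lemma cos_le_expR x : 0 <= x <= pi / 2 -> cos x <= expR (- (x ^+ 2 / 4)).
Proof.
move=> /andP[x0 xp]; apply: le_trans (expR_ge1Dx _); rewrite cos_half.
have pi0 := @pi_ge0 R.
have y0 : 0 <= x / 2 <= pi / 2 by lra.
have cx := mul_cos_le_sin y0.
have c0 : 0 <= cos (x / 2) by rewrite cos_ge0_pihalf//; lra.
have cc : 0 <= cos x by rewrite cos_ge0_pihalf//; lra.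
move: cc; rewrite cos_half => cc.
have := cos2Dsin2 (x / 2); move: (sin (x / 2)) (cos (x / 2)) cx c0 cc => s c cx c0 cc e.
have h1 : (x / 2 * c) ^+ 2 <= s ^+ 2.
  have xc : 0 <= x / 2 * c by rewrite mulr_ge0//; lra.
  by rewrite ler_sqr ?nnegrE//; lra.
have h3 : (x / 2) ^+ 2 * 2^-1 <= s ^+ 2.
  apply: le_trans h1; rewrite [leRHS]exprMn ler_wpM2l ?exprn_ge0//; lra.
by move: h3; rewrite exprMn; lra.
Qed.

Lemma expR_bounds_1Bx x n : 0 <= x < 1 ->
  expR (- (n%:R * x / (1 - x))) <= (1 - x) ^+ n <= expR (- (n%:R * x)).
Proof.
move=> /andP[x0 x1].
have e1 : expR (- (n%:R * x)) = expR (- x) ^+ n by rewrite -expRM_natl; congr expR; ring.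
have e2 : expR (- (n%:R * x / (1 - x))) = expR (- (x / (1 - x))) ^+ n.
  by rewrite -expRM_natl; congr expR; ring.
rewrite e1 e2; apply/andP; split; apply: lerXn2r; rewrite ?nnegrE ?expR_ge0//; try lra.
  rewrite expRN -[leRHS]invrK lef_pV2 ?posrE ?invr_gt0 ?expR_gt0//; last lra.
  apply: le_trans (expR_ge1Dx _); rewrite le_eqVlt; apply/orP; left; apply/eqP; field; lra.
exact: expR_ge1Dx.
Qed.

(** Dominated convergence for series, in the version where the number [n k] of terms grows together
    with the parameter. *)
Lemma tannery (a : nat -> nat -> R) (l b : nat -> R) (n : nat -> nat) :
  (forall j, a k j @[k --> \oo] --> l j) ->
  (\forall k \near \oo, forall j, (j < n k)%N -> `|a k j| <= b j) ->
  n k @[k --> \oo] --> \oo ->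
  cvgn (fun m => \sum_(j < m) b j) ->
  (forall L : R, \sum_(j < m) l j @[m --> \oo] --> L ->
    \sum_(j < n k) a k j @[k --> \oo] --> L).
Proof.
move=> al ab nk bc L lL; apply/cvgrPdist_le => e e0.
(* Each index [j] is eventually below [n k], and there [b j] dominates an absolute value. *)
have b0 j : 0 <= b j.
  have [k [kab kn]] : exists k, (forall j, (j < n k)%N -> `|a k j| <= b j) /\ (j < n k)%N.
    have : \forall k \near \oo, (j < n k)%N by move/cvgnyPgt : nk; apply.
    by move=> /(filterI ab)/filter_ex[k [? ?]]; exists k.
  exact: le_trans (kab j kn).
have e3 : 0 < e / 3 by lra.
(* One cut-off [m] makes both the tail of [b] and the tail of [l] small; the finitely many terms
   below it converge. *)
have [m [mb mL]] : exists m, `|limn (fun m => \sum_(j < m) b j) - \sum_(j < m) b j| <= e / 3 /\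
    `|L - \sum_(j < m) l j| <= e / 3.
  have h1 : \forall m \near \oo, `|limn (fun m => \sum_(j < m) b j) - \sum_(j < m) b j| <= e / 3.
    by move/cvgrPdist_le : bc; apply.
  have h2 : \forall m \near \oo, `|L - \sum_(j < m) l j| <= e / 3.
    by move/cvgrPdist_le : lL; apply.
  exact: filter_ex (filterI h1 h2).
have tail p : (m <= p)%N -> \sum_(m <= j < p) b j <= e / 3.
  move=> mp; rewrite -(lerD2l (\sum_(0 <= j < m) b j)) -big_cat_nat//= !big_mkord.
  apply: (@le_trans _ _ (limn (fun m => \sum_(j < m) b j))).
    apply: nondecreasing_cvgn_le bc _ => //.
    by apply/nondecreasing_seqP => i; rewrite big_ord_recr/= lerDl.
  by rewrite -lerBlDl; apply: le_trans mb; exact: ler_norm.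
have am : \sum_(j < m) a k j @[k --> \oo] --> \sum_(j < m) l j.
  by apply: cvg_big => [|j _]; [exact: add_continuous|exact: al].
have ham : \forall k \near \oo, `|\sum_(j < m) l j - \sum_(j < m) a k j| <= e / 3.
  by move/cvgrPdist_le : am; apply.
have hn : \forall k \near \oo, (m < n k)%N by move/cvgnyPgt : nk; apply.
near=> k.
have mk : (m <= n k)%N by apply: ltnW; near: k.
have abk : forall j, (j < n k)%N -> `|a k j| <= b j by near: k.
have -> : \sum_(j < n k) a k j = \sum_(j < m) a k j + \sum_(m <= j < n k) a k j.
  by rewrite -2!(big_mkord xpredT) -big_cat_nat.
have h1 : `|\sum_(j < m) l j - \sum_(j < m) a k j| <= e / 3 by near: k.
have h2 : `|\sum_(m <= j < n k) a k j| <= e / 3.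
  apply: le_trans (tail _ mk); apply: le_trans (ler_norm_sum _ _ _) _.
  by rewrite big_nat [leRHS]big_nat; apply: ler_sum => j /andP[_ jn]; exact: abk.
rewrite (_ : L - _ = (L - \sum_(j < m) l j) + (\sum_(j < m) l j - \sum_(j < m) a k j) -
  \sum_(m <= j < n k) a k j); last by ring.
rewrite (le_trans (ler_normB _ _))// (le_trans (lerD (ler_normD _ _) (lexx _)))//.
lra.
Unshelve. all: by end_near. Qed.

End trigonometric_bounds.

(** * Step functions and the integral of the inverse square root *)

Section integral_tools.
Context {R : realType}.
Let leb : {measure set _ -> \bar R} := @lebesgue_measure R.

Lemma nneseries_EFin (u : nat -> R) (l : R) :
  \sum_(j < n) u j @[n --> \oo] --> l -> (\sum_(0 <= j <oo) (u j)%:E)%E = l%:E.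
Proof.
move=> ul; apply/cvg_lim => //.
under eq_fun do rewrite sumEFin big_mkord.
by apply: cvg_EFin => //; exact: nearW.
Qed.

Lemma step_itv (a h x : R) : 0 < h -> a <= x ->
  x \in `[a + (Num.truncn ((x - a) * h))%:R / h, a + (Num.truncn ((x - a) * h)).+1%:R / h[.
Proof.
move=> h0 ax; rewrite in_itv/=; have /truncn_itv/andP[n1 n2] : 0 <= (x - a) * h by rewrite mulr_ge0 ?subr_ge0// ltW.
by rewrite -lerBrDl ler_pdivrMr// n1 -ltrBlDl ltr_pdivlMr.
Qed.

Lemma bigcup_step_itv (a h : R) : 0 < h ->
  \bigcup_n `[a + n%:R / h, a + n.+1%:R / h[%classic = `[a, +oo[%classic :> set R.
Proof.
move=> h0; apply/seteqP; split=> x /=.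
  move=> [n _]; rewrite /= !in_itv/= andbT => /andP[+ _]; apply: le_trans.
  by rewrite lerDl divr_ge0// ltW.
rewrite in_itv/= andbT => ax; exists (Num.truncn ((x - a) * h)) => //=.
exact: step_itv.
Qed.

Lemma truncn_step_itv (a h x : R) n : 0 < h -> x \in `[a + n%:R / h, a + n.+1%:R / h[ ->
  Num.truncn ((x - a) * h) = n.
Proof.
move=> h0; rewrite in_itv/= => /andP[x1 x2]; apply: truncn_def.
by rewrite -ler_pdivrMr// lerBrDl x1 -ltr_pdivlMr// ltrBlDl.
Qed.

Lemma measurable_step (a h : R) (c : nat -> R) : 0 < h ->
  measurable_fun (`[a, +oo[%classic : set R) (fun x => c (Num.truncn ((x - a) * h))).
Proof.
move=> h0; rewrite -(bigcup_step_itv a h0).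
apply/measurable_fun_bigcup => [n|n]; first exact: measurable_itv.
apply: (eq_measurable_fun (cst (c n))); last exact: measurable_cst.
by move=> x; rewrite inE/= => xn; rewrite (truncn_step_itv h0 xn).
Qed.

(** The bridge between sums over discrete time and Lebesgue integrals: [h] is the inverse mesh. It
    serves with mesh 1/M for the walk and the chain, and with mesh 2t for the Gaussian. *)
Lemma integral_step (a h : R) (c : nat -> R) : 0 < h -> (forall n, 0 <= c n) ->
  (\int[leb]_(x in `[a, +oo[%classic) (c (Num.truncn ((x - a) * h)))%:E)%E =
  (\sum_(0 <= n <oo) (c n / h)%:E)%E.
Proof.
move=> h0 c0; rewrite -(bigcup_step_itv a h0) ge0_integral_bigcup.
- apply: eq_eseriesr => n _.
  rewrite (eq_integral (cst (c n)%:E)) => [|x].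
    rewrite integral_cst//= /leb lebesgue_measure_itv/= lte_fin ltrD2l ltr_pM2r ?invr_gt0// ltr_nat ltnSn.
    rewrite -EFinB -EFinM; congr EFin; rewrite -natr1.
    by field; rewrite gt_eqF.
  by rewrite inE/= => xn; rewrite (truncn_step_itv h0 xn).
- by move=> n; exact: measurable_itv.
- by rewrite (bigcup_step_itv a h0); apply/measurable_EFinP; exact: measurable_step.
- by move=> x _; rewrite lee_fin.
- apply/trivIsetP => i j _ _ ij; rewrite -subset0 => x [/= xi xj]; move/eqP: ij; apply.
  by rewrite -(truncn_step_itv h0 xi) (truncn_step_itv h0 xj).
Qed.

Lemma measurable_sqrt_inv (rho : R) : measurable_fun (`]0, rho]%classic : set R) (fun y => (Num.sqrt y)^-1).
Proof.
apply: (measurable_funS (measurable_itv `]0, +oo[)).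
  by move=> x /=; rewrite !in_itv/= andbT => /andP[].
apply: open_continuous_measurable_fun; first exact: interval_open.
move=> x; rewrite inE/= in_itv/= andbT => x0.
apply: cvgV; first by rewrite gt_eqF// sqrtr_gt0.
exact: sqrt_continuous.
Qed.

Lemma integral_sqrt_inv_itv (a b : R) : 0 < a -> a < b ->
  (\int[leb]_(y in `[a, b]%classic) ((Num.sqrt y)^-1)%:E)%E =
  (2 * Num.sqrt b - 2 * Num.sqrt a)%:E.
Proof.
move=> a0 ab; pose F y : R := 2 * Num.sqrt y.
have cF : continuous F by move=> y; apply: cvgMr; exact: sqrt_continuous.
have dF (y : R) : 0 < y -> is_derive y 1 F (Num.sqrt y)^-1.
  move=> y0; have := is_derive1_sqrt y0 => h; rewrite /F.
  apply: is_derive_eq.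
  rewrite /GRing.scale/= mulr1.
  by field; rewrite gt_eqF// sqrtr_gt0.
rewrite -/(F b) -/(F a) EFinB; apply: continuous_FTC2 => //.
- apply: continuous_in_subspaceT => y; rewrite inE/= in_itv/= => /andP[ay _].
  apply: cvgV; last exact: sqrt_continuous.
  by rewrite gt_eqF// sqrtr_gt0 (lt_le_trans a0).
- split.
  + move=> y; rewrite in_itv/= => /andP[ay _]; have := dF y (lt_trans a0 ay).
    by move=> h; exact: ex_derive.
  + by apply: cvg_at_right_filter; exact: cF.
  + by apply: cvg_at_left_filter; exact: cF.
- move=> y; rewrite in_itv/= => /andP[ay _]; rewrite derive1E.
  by have h := dF y (lt_trans a0 ay); exact: derive_val.
Qed.

Lemma integral_sqrt_inv (rho : R) : 0 < rho ->
  (\int[leb]_(y in `]0%R, rho]%classic) ((Num.sqrt y)^-1)%:E)%E = (2 * Num.sqrt rho)%:E.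
Proof.
move=> rho0.
(* The integral is improper at 0, so the interval is exhausted from the right; [n.+2] keeps the left
   end strictly below [rho]. *)
pose F n : set R := `[rho / n.+2%:R, rho]%classic.
have n2 n : 0 < n.+2%:R :> R by rewrite ltr0n.
have Frho n : rho / n.+2%:R < rho by rewrite ltr_pdivrMr// ltr_pMr// ltr1n.
have FE : \bigcup_n F n = `]0, rho]%classic.
  apply/seteqP; split=> x /=.
    move=> [n _]; rewrite /F /= !in_itv/= => /andP[x1 ->]; rewrite andbT.
    by apply: lt_le_trans x1; rewrite divr_gt0.
  rewrite in_itv/= => /andP[x0 xr]; exists (Num.truncn (rho / x)) => //.
  rewrite /F /= in_itv/= xr andbT ler_pdivrMr// mulrC -ler_pdivrMr//.
  by apply: ltW; apply: lt_trans (truncnS_gt _) _; rewrite ltr_nat.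
have h := @ge0_nondecreasing_set_cvg_integral _ (measurableTypeR R) _ F (fun y => ((Num.sqrt y)^-1)%:E) leb.
have lim : (\int[leb]_(x in F i) ((Num.sqrt x)^-1)%:E)%E @[i --> \oo] --> (2 * Num.sqrt rho)%:E.
  under eq_fun do rewrite integral_sqrt_inv_itv ?divr_gt0//.
  apply: cvg_EFin; first by apply: nearW.
  rewrite -[X in _ --> X]subr0; apply: cvgB; first exact: cvg_cst.
  rewrite -[X in _ --> X](mulr0 2); apply: cvgMr.
  rewrite -[X in _ --> X](@sqrtr0 R); apply: continuous_cvg; first exact: sqrt_continuous.
  rewrite -[X in _ --> X](mulr0 rho); apply: cvgMr.
  have := @cvg_harmonic R; rewrite -(cvg_shiftS (@harmonic R)); exact.
have lim2 : (\int[leb]_(x in F i) ((Num.sqrt x)^-1)%:E)%E @[i --> \oo] -->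
    (\int[leb]_(x in \bigcup_i F i) ((Num.sqrt x)^-1)%:E)%E.
  apply: h => //=.
  - move=> i j ij; rewrite subsetEset /F => x /=; rewrite !in_itv/= => /andP[x1 ->].
    rewrite andbT; apply: le_trans x1; rewrite ler_pM2l// lef_pV2 ?posrE// ler_nat.
    by rewrite !ltnS.
  - by move=> n; exact: measurable_itv.
  - move=> n; apply/measurable_EFinP; apply: (measurable_funS (measurable_itv `]0, rho])).
      by move=> x /=; rewrite /F /= !in_itv/= => /andP[x1 ->]; rewrite andbT (lt_le_trans _ x1)// divr_gt0.
    exact: measurable_sqrt_inv.
by rewrite -FE -(cvg_lim _ lim2)// (cvg_lim _ lim).
Qed.

End integral_tools.

Section dominated.
Context {R : realType}.
Let leb : {measure set _ -> \bar R} := @lebesgue_measure R.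

(** The bounds in the applications hold only for large [M]; the sequence is therefore shifted by
    [M0]. *)
Lemma lebesgue_dominated_cvg (D : set R) (f_ : nat -> R -> R) (f g : R -> R) M0 :
  measurable D ->
  (forall M, (M0 <= M)%N -> measurable_fun D (f_ M)) -> measurable_fun D f ->
  leb.-integrable D (EFin \o g) ->
  {ae leb, forall x, D x -> f_ M x @[M --> \oo] --> f x} ->
  (forall M x, (M0 <= M)%N -> D x -> `|f_ M x| <= g x) ->
  (\int[leb]_(x in D) (f_ M x)%:E @[M --> \oo] --> \int[leb]_(x in D) (f x)%:E)%E.
Proof.
move=> mD mf_ mf ig cf fg.
rewrite -(cvg_shiftn M0).
have [] := @dominated_convergence _ _ _ leb D mD (fun M x => (f_ (M + M0)%N x)%:E) (EFin \o f) (EFin \o g).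
- by move=> M; apply/measurable_EFinP; apply: mf_; rewrite leq_addl.
- exact/measurable_EFinP.
- case: cf => B [mB B0 sB]; exists B; split=> // x nh; apply: sB => h; apply: nh => Dx.
  apply: cvg_EFin; first exact: nearW.
  by have := h Dx; rewrite -(cvg_shiftn M0).
- exact: ig.
- by apply: aeW => x M Dx; rewrite abse_EFin lee_fin; apply: fg => //; rewrite leq_addl.
by [].
Qed.

End dominated.

(** * Size of the spectral terms of the walk *)

Section walk_asymptotics.
Context {R : realType}.
Implicit Types (N m j : nat) (y : R).

Lemma theta_rev N j : (j < N)%N -> @theta R N (N - j.+1) = pi *+ 2 - @theta R N j.
Proof.
move=> jN; have N0 : N%:R != 0 :> R by rewrite pnatr_eq0; lia.
by rewrite /theta natrB// -natr1 -mulr_natr; field.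
Qed.

Definition walk_term N m j : R := (1 + cos (@theta R N j)) * cos (@theta R N j) ^+ m.

Lemma walk_term_rev N m j : (j < N)%N -> walk_term N m (N - j.+1) = walk_term N m j.
Proof.
move=> jN; rewrite /walk_term theta_rev//.
by have -> : cos (pi *+ 2 - @theta R N j) = cos (theta N j) by rewrite addrC cosD2pi cosN.
Qed.

(* The angles are symmetric about [pi], where the term vanishes. *)
Lemma walk_surv_fold N m : (1 < N)%N ->
  N%:R * walk_surv N m 1 = 2 * \sum_(j < N./2) walk_term N m j.
Proof.
move=> N1; rewrite walk_surv1//.
have half (n : nat) : (n <= N)%N -> (N <= 2 * n)%N -> (2 * n <= N.+1)%N ->
   \sum_(n <= j < N) walk_term N m j = \sum_(0 <= j < N - n) walk_term N m j.
  move=> nN _ _; rewrite -{1}(add0n n) big_addn big_nat_rev/= big_nat [RHS]big_nat.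
  apply: eq_bigr => j /= jn; rewrite add0n.
  by rewrite (_ : (N - n - j.+1 + n)%N = (N - j.+1)%N) ?walk_term_rev//; lia.
rewrite -(big_mkord xpredT (walk_term N m)) -(big_mkord xpredT (fun j => walk_term N m j)).
have Ne := odd_double_half N; rewrite -mul2n in Ne.
rewrite (@big_cat_nat _ _ _ (uphalf N))//=; [|by rewrite uphalf_half; lia..].
rewrite half; [|by rewrite ?uphalf_half; lia..].
have -> : (N - uphalf N)%N = N./2 by rewrite uphalf_half; lia.
rewrite mulr2n mulrDl mul1r; congr (_ + _).
rewrite uphalf_half; case: (boolP (odd N)) => [oN|_]; last by rewrite add0n.
rewrite add1n big_nat_recr//= -[RHS]addr0; congr (_ + _).
suff tp : @theta R N N./2 = pi by rewrite /walk_term tp cospi subrr mul0r.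
have N0 : N%:R != 0 :> R by rewrite pnatr_eq0; lia.
rewrite /theta -natrM natr1 (_ : (2 * N./2).+1 = N)//; last by lia.
by rewrite mulfK.
Qed.

(** (1 - c) c^m is the smallest of the m + 1 terms of a geometric sum that is at most 1. *)
Lemma mul_pow_le (c : R) m : 0 <= c <= 1 -> m.+1%:R * ((1 - c) * c ^+ m) <= 1.
Proof.
move=> /andP[c0 c1].
have : \sum_(i < m.+1) (1 - c) * c ^+ i = 1 - c ^+ m.+1.
  by rewrite -mulr_sumr -[RHS]opprB subrX1 -mulNr opprB.
move=> h; have : m.+1%:R * ((1 - c) * c ^+ m) <= \sum_(i < m.+1) (1 - c) * c ^+ i.
  rewrite -[X in X%:R * _](card_ord m.+1) mulr_natl -sumr_const.
  apply: ler_sum => i _; rewrite ler_wpM2l ?subr_ge0//.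
  by apply: ler_wiXn2l => //; rewrite -ltnS.
by move=> /le_trans; apply; rewrite h lerBlDr lerDl exprn_ge0.
Qed.

Lemma theta_lt_pi N j : (j < N./2)%N -> 0 <= @theta R N j <= pi.
Proof.
move=> jN; have N0 : 0 < N%:R :> R by rewrite ltr0n; lia.
have pi0 := @pi_gt0 R; have j0 : 0 <= j%:R :> R by rewrite ler0n.
rewrite /theta divr_ge0 ?mulr_ge0 ?(ltW pi0) ?(ltW N0) ?addr_ge0 ?mulr_ge0//=.
rewrite ler_pdivrMr// ler_pM2l// -natrM natr1 ler_nat.
have := odd_double_half N; lia.
Qed.

Lemma theta_sq N j : @theta R N j ^+ 2 = 2 * @rate R j / N%:R ^+ 2.
Proof. by rewrite /theta /rate expr_div_n exprMn; congr (_ / _); field. Qed.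

(** The exponent carries [m.+1] instead of [m], so that the bound stays informative at time 0. The
    factor e pays for the extra t^2/4, which is at most 1 because t <= pi/2 < 2. *)
Lemma walk_term_pos_bound N m j : (j < N./2)%N -> 0 <= cos (@theta R N j) ->
  `|walk_term N m j| <= 2 * expR 1 * expR (- (@rate R j * ((m.+1)%:R / N%:R ^+ 2 / 2))).
Proof.
move=> jN c0; have /andP[t0 tp] := theta_lt_pi jN.
have pi0 := @pi_ge0 R; have p2 := pihalf_lt2 R.
rewrite /walk_term; set t := @theta R N j in t0 tp c0 *.
have c1 := cos_le1 t.
rewrite ger0_norm; last by rewrite mulr_ge0 ?exprn_ge0//; lra.
have th : t <= pi / 2.
  rewrite leNgt; apply/negP => h; move: c0; rewrite leNgt => /negP; apply.
  by rewrite -(cos_pihalf R) ltr_cos ?in_itv//=; lra.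
have ct : cos t ^+ m <= expR (- (m%:R * (t ^+ 2 / 4))).
  rewrite (_ : - (_ * _) = m%:R * - (t ^+ 2 / 4)); last by ring.
  rewrite expRM_natl; apply: lerXn2r; rewrite ?nnegrE ?expR_ge0//.
  by apply: cos_le_expR; lra.
have h1 : 0 <= 1 + cos t by lra.
have h2 : 1 + cos t <= 2 by lra.
have h3 : 0 <= cos t ^+ m by exact: exprn_ge0.
rewrite -(mulrA 2); apply: ler_pM => //.
apply: le_trans ct _; rewrite -expRD ler_expR -(natr1 m).
have -> : @rate R j * ((m%:R + 1) / N%:R ^+ 2 / 2) = (m%:R + 1) * (t ^+ 2 / 4).
  by rewrite theta_sq; move: (rate j) (m%:R : R) ((N%:R ^+ 2)^-1 : R) => r u v; field.
have t2 : 0 <= (2 - t) * (2 + t) by rewrite mulr_ge0//; lra.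
have t2E : (2 - t) * (2 + t) = 4 - t ^+ 2 by ring.
by rewrite mulrDl mul1r; lra.
Qed.

(** Here 1 + cos = 1 - |cos|, so [mul_pow_le] applies. Fewer than [N] such terms add up to at most
    N/(m+1), negligible when m is of order N^2. *)
Lemma walk_term_neg_bound N m j : cos (@theta R N j) < 0 ->
  `|walk_term N m j| <= m.+1%:R^-1.
Proof.
move=> c0; rewrite /walk_term; set t := @theta R N j in c0 *.
have cN1 := cos_geN1 t.
have e1 : `|1 + cos t| = 1 + cos t by rewrite ger0_norm//; lra.
have e2 : `|cos t| = - cos t by rewrite ltr0_norm.
rewrite normrM normrX e1 e2.
have h : 0 <= - cos t <= 1 by lra.
have := mul_pow_le m h; rewrite opprK => h'.
by rewrite -[leRHS]mulr1 ler_pdivlMl.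
Qed.

End walk_asymptotics.

(** * Behaviour of [H] near 0 by comparison with a Gaussian integral *)

Section theta_integrals.
Context {R : realType}.
Let leb : {measure set _ -> \bar R} := @lebesgue_measure R.
Implicit Types (y t rho : R).

(** H(t^2) is the sum of [gauss] over the odd multiples of t, so 2 t H(t^2) is a Riemann sum of mesh
    2t. *)
Let gauss (x : R) : R := expR (- (pi ^+ 2 * x ^+ 2 / 2)).

Let gauss_ni x t : 0 <= x -> x <= t -> gauss t <= gauss x.
Proof.
move=> x0 xt; rewrite ler_expR lerN2 ler_pM2r// ler_wpM2l ?exprn_ge0 ?pi_ge0//.
by rewrite lerXn2r// nnegrE// (le_trans x0).
Qed.

Let gauss_le1 x : gauss x <= 1.
Proof. by rewrite -expR0 ler_expR oppr_le0 divr_ge0// mulr_ge0// sqr_ge0. Qed.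

Let measurable_gauss D : measurable_fun D gauss.
Proof.
apply: measurable_funTS; apply: continuous_measurable_fun => x.
apply: continuous_comp; last exact: continuous_expR.
apply: cvgN; apply: cvgMl; apply: cvgMr.
exact: exprn_continuous.
Qed.

Let gauss_rate t j : gauss (2 * j%:R * t + t) = expR (- (rate j * t ^+ 2)).
Proof. by congr expR; rewrite /rate; field. Qed.

Lemma gauss_sum t : 0 < t -> \sum_(j < n) gauss (2 * j%:R * t + t) @[n --> \oo] --> H (t ^+ 2).
Proof.
move=> t0; under eq_fun do under eq_bigr do rewrite gauss_rate.
by apply: H_cvg; rewrite exprn_gt0.
Qed.

Let tail t := (\int[leb]_(x in `[t, +oo[%classic) (gauss x)%:E)%E.

(** On [[t, +oo[] the odd multiples of t are the left ends of the steps, where a decreasing function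
    is largest. *)
Lemma gauss_tail_le t : 0 < t -> (tail t <= (2 * t * H (t ^+ 2))%:E)%E.
Proof.
move=> t0; have h0 : 0 < (2 * t)^-1 by rewrite invr_gt0 mulr_gt0.
pose c n := gauss (2 * n%:R * t + t).
have <- : (\sum_(0 <= n <oo) (c n / (2 * t)^-1)%:E)%E = (2 * t * H (t ^+ 2))%:E.
  apply: nneseries_EFin; under eq_fun do rewrite -mulr_suml invrK mulrC.
  by apply: cvgMr; exact: gauss_sum.
rewrite -(integral_step t h0) => [|n]; last exact: expR_ge0.
apply: ge0_le_integral => //.
- by move=> x _; rewrite lee_fin expR_ge0.
- by apply/measurable_EFinP; exact: measurable_gauss.
- by apply/measurable_EFinP; exact: measurable_step.
- move=> x /=; rewrite in_itv/= andbT => tx; rewrite lee_fin /c.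
  have := step_itv h0 tx; rewrite in_itv/= invrK => /andP[x1 _].
  apply: gauss_ni; first by rewrite addr_ge0 ?mulr_ge0// ltW.
  by apply: le_trans x1; rewrite le_eqVlt; apply/orP; left; apply/eqP; ring.
Qed.

(** The same steps with their right ends, which start at 3t; hence the first term of the series is
    subtracted. *)
Lemma gauss_tail_ge t : 0 < t -> ((2 * t * (H (t ^+ 2) - gauss t))%:E <= tail t)%E.
Proof.
move=> t0; have h0 : 0 < (2 * t)^-1 by rewrite invr_gt0 mulr_gt0.
pose c n := gauss (2 * n.+1%:R * t + t).
have <- : (\sum_(0 <= n <oo) (c n / (2 * t)^-1)%:E)%E = (2 * t * (H (t ^+ 2) - gauss t))%:E.
  apply: nneseries_EFin; under eq_fun do rewrite -mulr_suml invrK mulrC.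
  apply: cvgMr.
  have := gauss_sum t0; rewrite -(cvg_shiftS (fun n => \sum_(j < n) _)) /=.
  under eq_fun do rewrite big_ord_recl/=.
  rewrite !mulr0 mul0r add0r => h.
  have -> : (fun n => \sum_(j < n) c j) = (fun n => gauss t + \sum_(i < n) gauss (2 * (bump 0 i)%:R * t + t) - gauss t).
    by apply/funext => n; rewrite addrAC subrr add0r.
  by apply: cvgB => //; exact: cvg_cst.
rewrite -(integral_step t h0) => [|n]; last exact: expR_ge0.
apply: ge0_le_integral => //.
- by move=> x _; rewrite lee_fin expR_ge0.
- by apply/measurable_EFinP; exact: measurable_step.
- by apply/measurable_EFinP; exact: measurable_gauss.
- move=> x /=; rewrite in_itv/= andbT => tx; rewrite lee_fin /c.
  have := step_itv h0 tx; rewrite in_itv/= invrK => /andP[_ x1].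
  apply: gauss_ni; first by rewrite (le_trans (ltW t0)).
  by apply: (le_trans (ltW x1)); rewrite le_eqVlt; apply/orP; left; apply/eqP; ring.
Qed.

Lemma gauss_total t : 0 < t -> (tail t <= tail 0)%E /\ (tail 0 <= t%:E + tail t)%E.
Proof.
move=> t0; have tE : `[0, +oo[%classic = `[0, t[%classic `|` `[t, +oo[%classic :> set R.
  apply/seteqP; split=> x /=; rewrite !in_itv/= !andbT.
    by move=> x0; have [xt|xt] := ltP x t; [left; rewrite x0|right].
  by move=> [/andP[]//|]; apply: le_trans; exact: ltW.
have -> : tail 0 = ((\int[leb]_(x in `[0%R, t[%classic) (gauss x)%:E) + tail t)%E.
  rewrite /tail tE ge0_integral_setU//.
  - by apply/measurable_EFinP; exact: measurable_gauss.
  - by move=> x _; rewrite lee_fin expR_ge0.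
  - apply/disj_setPS => x [/=]; rewrite !in_itv/= andbT => /andP[_ xt] tx.
    by move: xt; rewrite ltNge tx.
split; first by rewrite leeDr// integral_ge0// => x _; rewrite lee_fin expR_ge0.
rewrite leeD2r//.
have -> : t%:E = (\int[leb]_(x in `[0%R, t[%classic) (cst 1%E) x)%E.
  by rewrite integral_cst//= mul1e /leb lebesgue_measure_itv/= lte_fin t0 sube0.
apply: ge0_le_integral => //.
- by move=> x _; rewrite lee_fin expR_ge0.
- by apply/measurable_EFinP; exact: measurable_gauss.
- by move=> x _; rewrite lee_fin.
Qed.

(** [I] is the integral of [gauss] over the half-line. The left-end and right-end sums differ by one
    term, at most 2 t, and the missing piece [[0, t[] adds at most t. *)
Lemma H_sqrt_bounds : exists2 I : R, 0 < I &
  forall y, 0 < y -> I - 2 * Num.sqrt y <= 2 * Num.sqrt y * H y <= I + 2 * Num.sqrt y.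
Proof.
have fin t : 0 < t -> tail t \is a fin_num.
  move=> t0; rewrite ge0_fin_numE; last by apply: integral_ge0 => x _; rewrite lee_fin expR_ge0.
  exact: le_lt_trans (gauss_tail_le t0) (ltry _).
have fin0 : tail 0 \is a fin_num.
  rewrite ge0_fin_numE; last by apply: integral_ge0 => x _; rewrite lee_fin expR_ge0.
  have [_ h] := gauss_total ltr01; apply: (le_lt_trans h).
  by rewrite -(fineK (fin _ ltr01)) -EFinD ltry.
have bnd t : 0 < t -> [/\ 2 * t * (H (t ^+ 2) - gauss t) <= fine (tail 0) &
    fine (tail 0) <= t + 2 * t * H (t ^+ 2)].
  move=> t0; have [h1 h2] := gauss_total t0.
  rewrite -!lee_fin fineK//; split.
    exact: le_trans (gauss_tail_ge t0) h1.
  apply: (le_trans h2); rewrite EFinD leeD2l//; exact: gauss_tail_le.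
exists (fine (tail 0)).
  (* Positivity comes from t = 1: after removal of [gauss 1], the second term of H(1) is left. *)
  have [h _] := bnd 1 ltr01; apply: lt_le_trans h.
  rewrite mulr1 expr1n mulr_gt0// subr_gt0.
  apply: lt_le_trans (H_ge_partial 2 ltr01).
  rewrite !big_ord_recr big_ord0/= add0r.
  rewrite (_ : gauss 1 = expR (- (rate 0 * 1))) ?ltrDl ?expR_gt0//.
  by congr expR; rewrite /rate; field.
move=> y y0; have t0 : 0 < Num.sqrt y by rewrite sqrtr_gt0.
have [h1 h2] := bnd _ t0; move: h1 h2; rewrite sqr_sqrtr ?(ltW y0)// => h1 h2.
have g1 := gauss_le1 (Num.sqrt y).
have : 2 * Num.sqrt y * gauss (Num.sqrt y) <= 2 * Num.sqrt y.
  by rewrite ler_piMr// mulr_ge0// ltW.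
move: h1 h2; rewrite mulrBr; lra.
Qed.

End theta_integrals.

(** * Domination and scaling limit of the survival probability of the walk *)

Section walk_limit.
Context {R : realType}.

(** The part with a Gaussian dominating series; discarding the negative cosines costs at most
    1/(m+1) per term. *)
Let pos_term N m j : R := if 0 <= cos (@theta R N j) then walk_term N m j else 0.

Let pos_term_diff N m j : `|@walk_term R N m j - pos_term N m j| <= m.+1%:R^-1.
Proof.
rewrite /pos_term; case: ifPn => c0; first by rewrite subrr normr0 invr_ge0.
by rewrite subr0 walk_term_neg_bound// ltNge.
Qed.

Let pos_term_bound N m j : (j < N./2)%N ->
  `|pos_term N m j| <= 2 * expR 1 * expR (- (@rate R j * ((m.+1)%:R / N%:R ^+ 2 / 2))).
Proof.
move=> jN; rewrite /pos_term; case: ifPn => c0; first exact: walk_term_pos_bound.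
by rewrite normr0 !mulr_ge0 ?expR_ge0.
Qed.

Lemma walk_surv_bound : exists2 C : R, 0 < C & forall N m, (1 < N)%N ->
  N%:R * walk_surv N m 1 <= C * ((Num.sqrt (m.+1%:R / N%:R ^+ 2))^-1 + 1).
Proof.
have [I I0 HI] := @H_sqrt_bounds R.
have e0 := @expR_gt0 R 1.
exists (4 * expR 1 * (I + 1) + 1); first by rewrite addr_gt0// !mulr_gt0//; lra.
move=> N m N1; have N0 : 0 < N%:R :> R by rewrite ltr0n; lia.
set u := m.+1%:R / N%:R ^+ 2.
have m0 : 1 <= m.+1%:R :> R by rewrite ler1n.
have u0 : 0 < u by rewrite divr_gt0 ?exprn_gt0//; lra.
set r := Num.sqrt u; have r0 : 0 < r by rewrite sqrtr_gt0.
have rr : r ^+ 2 = u by rewrite sqr_sqrtr// ltW.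
have muN : m.+1%:R = u * N%:R ^+ 2 by rewrite /u divfK// gt_eqF// exprn_gt0.
(* Indeed (N r)^2 = m + 1. This bounds the negative-cosine part N/(m+1) = 1/(N r^2) by 1/r. *)
have Nr1 : 1 <= N%:R * r.
  have h : 1 <= (N%:R * r) ^+ 2 by rewrite exprMn rr mulrC -muN.
  have h0 : 0 < N%:R * r by rewrite mulr_gt0.
  by move: (N%:R * r) h h0 => x h h0; nra.
have neg : N%:R * m.+1%:R^-1 <= r^-1 :> R.
  rewrite muN -rr ler_pdivrMr; last by rewrite mulr_gt0 ?exprn_gt0.
  rewrite (_ : r^-1 * _ = N%:R * (N%:R * r)); last by field; rewrite gt_eqF.
  by rewrite ler_peMr// ltW.
have Hu : H (u / 2) <= (I + 1) * (r^-1 + 1).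
  have v0 : 0 < u / 2 by lra.
  have /andP[_ h] := HI _ v0.
  set t := Num.sqrt (u / 2) in h.
  have t0 : 0 < t by rewrite sqrtr_gt0.
  have tr : r <= 2 * t.
    rewrite -(@ler_pXn2r _ 2)// ?nnegrE ?mulr_ge0 ?ltW// exprMn rr sqr_sqrtr ?(ltW v0)//.
    by rewrite expr2; lra.
  have t20 : 0 < 2 * t by lra.
  have h2 : H (u / 2) <= I * (2 * t)^-1 + 1.
    rewrite -(ler_pM2l t20) (le_trans h)// mulrDr mulr1 mulrCA divff ?gt_eqF// mulr1.
    by rewrite lexx.
  apply: (le_trans h2).
  have h3 : (2 * t)^-1 <= r^-1 by rewrite lef_pV2.
  have h4 : 0 < r^-1 by rewrite invr_gt0.
  have h5 : I * (2 * t)^-1 <= I * r^-1 by rewrite ler_pM2l.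
  have -> : (I + 1) * (r^-1 + 1) = I / r + I + r^-1 + 1 by ring.
  lra.
rewrite walk_surv_fold//.
have s1 : \sum_(j < N./2) walk_term N m j <= 2 * expR 1 * H (u / 2) + N./2%:R * m.+1%:R^-1.
  apply: (@le_trans _ _ (\sum_(j < N./2) (2 * expR 1 * expR (- (@rate R j * (u / 2))) + m.+1%:R^-1))).
    apply: ler_sum => j _.
    rewrite -[leLHS](subrK (pos_term N m j)) addrC; apply: lerD.
      exact: le_trans (ler_norm _) (pos_term_bound m (ltn_ord j)).
    exact: le_trans (ler_norm _) (pos_term_diff N m j).
  rewrite big_split/= -mulr_sumr sumr_const card_ord -[m.+1%:R^-1 *+ _]mulr_natl lerD2r.
  rewrite ler_pM2l ?mulr_gt0//; apply: H_ge_partial; lra.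
have N2 : 2 * (N./2)%:R <= N%:R :> R.
  by rewrite -natrM ler_nat mul2n -[leqRHS]odd_double_half leq_addl.
apply: (@le_trans _ _ (4 * expR 1 * H (u / 2) + N%:R * m.+1%:R^-1)).
  apply: (@le_trans _ _ (2 * (2 * expR 1 * H (u / 2) + N./2%:R * m.+1%:R^-1))).
    by rewrite ler_pM2l.
  rewrite mulrDr; apply: lerD; first by rewrite !mulrA -natrM.
  by rewrite mulrA ler_wpM2r.
rewrite [leRHS](_ : _ = 4 * expR 1 * ((I + 1) * (r^-1 + 1)) + (r^-1 + 1)); last first.
  by move: (expR 1 : R) (r^-1) => a b; ring.
apply: lerD; last by apply: (le_trans neg); rewrite lerDl.
by apply: ler_wpM2l => //; rewrite mulr_ge0// ltW.
Qed.

Section sequences.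
Variables (N m : nat -> nat) (y : R).
Hypotheses (y0 : 0 < y) (N_oo : N k @[k --> \oo] --> \oo).
Hypothesis my : (m k)%:R / (N k)%:R ^+ 2 @[k --> \oo] --> y.

Let Nr_oo : (N k)%:R @[k --> \oo] --> (+oo : set_system R).
Proof. by apply: (cvg_comp _ _ N_oo); exact: cvgr_idn. Qed.

Let N_inv : ((N k)%:R^-1 : R) @[k --> \oo] --> (0 : R).
Proof.
apply/gtr0_cvgV0; last exact: Nr_oo.
by move/cvgnyPgt : N_oo => /(_ 0%N); apply: filterS => k; rewrite ltr0n.
Qed.

Let theta_cvg j : theta (N k) j @[k --> \oo] --> (0 : R).
Proof. by rewrite -[X in _ --> X](mulr0 (pi * (2 * j%:R + 1))); exact: cvgMr. Qed.

Let theta_sq_cvg j : (m k)%:R * (theta (N k) j ^+ 2 / 2) @[k --> \oo] --> rate j * y.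
Proof.
have -> : (fun k => (m k)%:R * (theta (N k) j ^+ 2 / 2)) =
    (fun k => @rate R j * ((m k)%:R / (N k)%:R ^+ 2)).
  apply/funext => k; rewrite theta_sq.
  by move: (@rate R j) ((m k)%:R : R) (((N k)%:R ^+ 2)^-1 : R) => a b c; field.
exact: cvgMr.
Qed.

Let cos_theta_cvg j : cos (@theta R (N k) j) @[k --> \oo] --> (1 : R).
Proof. by rewrite -cos0; apply: continuous_cvg => //; exact: continuous_cos. Qed.

Let near_theta j : \forall k \near \oo, 0 <= @theta R (N k) j <= pi.
Proof.
have : \forall k \near \oo, (j.+1 < (N k)./2)%N.
  move/cvgnyPgt : N_oo => /(_ (2 * j.+3)%N); apply: filterS => k h.
  by have := odd_double_half (N k); rewrite -mul2n; lia.
by apply: filterS => k h; apply: theta_lt_pi; lia.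
Qed.

(** With x = 1 - cos theta, m x is squeezed towards [rate j * y] by the quadratic and quartic
    bounds, and (1 - x)^m lies between exp(-m x / (1 - x)) and exp(-m x). *)
Let cos_pow_cvg j : cos (@theta R (N k) j) ^+ m k @[k --> \oo] --> expR (- (rate j * y)).
Proof.
pose x k := 1 - cos (@theta R (N k) j).
have x0 : x k @[k --> \oo] --> (0 : R).
  by rewrite -(subrr 1); apply: cvgB; [exact: cvg_cst|exact: cos_theta_cvg].
have mx : (m k)%:R * x k @[k --> \oo] --> rate j * y.
  apply: (@squeeze_cvgr _ _ _ _ (fun k => (m k)%:R * (theta (N k) j ^+ 2 / 2) * (1 - theta (N k) j ^+ 2 / 4))
     (fun k => (m k)%:R * (theta (N k) j ^+ 2 / 2))).
  - apply: filterS (near_theta j) => k tk; rewrite /x.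
    have := cos_ge_sq tk; have := cos_le_quartic tk.
    set t := @theta R (N k) j => h1 h2.
    have g1 : 1 - cos t <= t ^+ 2 / 2 by lra.
    have g2 : t ^+ 2 / 2 * (1 - t ^+ 2 / 4) <= 1 - cos t.
      by rewrite (_ : _ * _ = t ^+ 2 / 2 - t ^+ 4 / 8); [lra|field].
    by rewrite -mulrA !ler_wpM2l.
  - rewrite -[X in _ --> X]mulr1; apply: cvgM; first exact: theta_sq_cvg.
    rewrite -[X in _ --> X]subr0; apply: cvgB; first exact: cvg_cst.
    rewrite -[X in _ --> X](mul0r 4^-1); apply: cvgMl.
    have t2 : theta (N k) j * theta (N k) j @[k --> \oo] --> (0 * 0 : R) by exact: cvgM.
    by rewrite mulr0 in t2; under eq_fun do rewrite expr2; exact: t2.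
  - exact: theta_sq_cvg.
have x1 : \forall k \near \oo, 0 <= x k < 1.
  have : \forall k \near \oo, x k < 1 by apply: (cvgr_lt _ x0).
  apply: filterS => k ->.
  by rewrite andbT subr_ge0 cos_le1.
apply: (@squeeze_cvgr _ _ _ _ (fun k => expR (- ((m k)%:R * x k / (1 - x k))))
   (fun k => expR (- ((m k)%:R * x k)))).
- apply: filterS x1 => k /(expR_bounds_1Bx (m k)).
  by rewrite (_ : 1 - x k = cos (theta (N k) j))//; rewrite /x opprB addrC subrK.
- apply: continuous_cvg; first exact: continuous_expR.
  apply: cvgN; rewrite -[X in _ --> X]divr1; apply: cvgM => //.
  apply: cvgV => //; rewrite -[X in _ --> X]subr0.
  by apply: cvgB => //; exact: cvg_cst.
- by apply: continuous_cvg; [exact: continuous_expR|exact: cvgN].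
Qed.

Let pos_term_cvg j : pos_term (N k) (m k) j @[k --> \oo] --> 2 * expR (- (rate j * y)).
Proof.
have h : walk_term (N k) (m k) j @[k --> \oo] --> 2 * expR (- (rate j * y)).
  apply: cvgM; last exact: cos_pow_cvg.
  by rewrite (_ : 2 = 1 + 1)//; apply: cvgD; [exact: cvg_cst|exact: cos_theta_cvg].
apply: cvg_trans h; apply: near_eq_cvg.
have : \forall k \near \oo, 0 < cos (@theta R (N k) j) by apply: (cvgr_gt _ (cos_theta_cvg j)).
apply: filterS => k c0.
by rewrite /pos_term ltW.
Qed.

(** In the constant 4, one factor 2 is the folding of the angles about pi and the other is the limit
    of 1 + cos theta. *)
Lemma walk_surv_cvg : (N k)%:R * walk_surv (N k) (m k) 1 @[k --> \oo] --> 4 * H y.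
Proof.
have N1 : \forall k \near \oo, (1 < N k)%N by move/cvgnyPgt : N_oo; apply.
have my2 : \forall k \near \oo, y / 2 <= (m k)%:R / (N k)%:R ^+ 2.
  have : \forall k \near \oo, y / 2 < (m k)%:R / (N k)%:R ^+ 2.
    by apply: (cvgr_gt _ my); rewrite ltr_pdivrMr// ltr_pMr// ltr1n.
  by apply: filterS => k /ltW.
have half_oo : (N k)./2 @[k --> \oo] --> \oo.
  apply/cvgnyPge => A; move/cvgnyPgt : N_oo => /(_ (2 * A.+1)%N); apply: filterS => k h.
  by have := odd_double_half (N k); rewrite -mul2n; lia.
have pos : \sum_(j < (N k)./2) pos_term (N k) (m k) j @[k --> \oo] --> 2 * H y.
  (* The dominating series sits at y/4: eventually m/N^2 >= y/2, and [pos_term_bound] keeps half of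
     the exponent. *)
  apply: (@tannery R (fun k j => pos_term (N k) (m k) j) (fun j => 2 * expR (- (rate j * y)))
     (fun j => 2 * expR 1 * expR (- (rate j * (y / 4)))) (fun k => (N k)./2)) => //.
  - apply: filterS (filterI N1 my2) => k [k1 k2] j jk.
    apply: le_trans (pos_term_bound _ jk) _; rewrite ler_pM2l ?mulr_gt0 ?expR_gt0//.
    rewrite ler_expR lerN2 ler_pM2l ?rate_gt0//.
    have N0 : 0 < (N k)%:R ^+ 2 :> R by rewrite exprn_gt0// ltr0n; lia.
    have : (m k)%:R / (N k)%:R ^+ 2 <= (m k).+1%:R / (N k)%:R ^+ 2 :> R.
      by rewrite ler_pM2r ?invr_gt0// ler_nat.
    lra.
  - have y4 : 0 < y / 4 by rewrite divr_gt0.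
    apply/cvg_ex; exists (2 * expR 1 * H (y / 4)).
    by under eq_fun do rewrite -mulr_sumr; apply: cvgMr; exact: H_cvg.
  - by under eq_fun do rewrite -mulr_sumr; apply: cvgMr; exact: H_cvg.
(* At most N/2 terms, each at most 1/(m+1) with m + 1 >= (y/2) N^2, so the sum is O(1/N). *)
have neg : \sum_(j < (N k)./2) (walk_term (N k) (m k) j - pos_term (N k) (m k) j) @[k --> \oo] --> (0 : R).
  apply: norm_cvg0.
  apply: (@squeeze_cvgr _ _ _ _ (cst 0) (fun k => 2 / y * (N k)%:R^-1)); last 2 first.
  - exact: cvg_cst.
  - by rewrite -[X in _ --> X](mulr0 (2 / y)); exact: cvgMr.
  apply: filterS (filterI N1 my2) => k [k1 k2]; rewrite normr_ge0/=.
  apply: le_trans (ler_norm_sum _ _ _) _.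
  apply: (@le_trans _ _ (\sum_(j < (N k)./2) (m k).+1%:R^-1)).
    by apply: ler_sum => j _; exact: pos_term_diff.
  rewrite sumr_const card_ord -[X in X <= _]mulr_natl.
  have N0 : 0 < (N k)%:R :> R by rewrite ltr0n; lia.
  have m0 : 0 < (m k).+1%:R :> R by rewrite ltr0n.
  have hN : (N k)./2%:R <= (N k)%:R :> R.
    by rewrite ler_nat; have := odd_double_half (N k); rewrite -mul2n; lia.
  rewrite ler_pdivrMr// (le_trans hN)//.
  have h : y / 2 * (N k)%:R ^+ 2 <= (m k).+1%:R.
    by rewrite -ler_pdivlMr ?exprn_gt0//; apply: le_trans k2 _; rewrite ler_pM2r ?invr_gt0 ?exprn_gt0// ler_nat.
  apply: (@le_trans _ _ (2 / y * (N k)%:R^-1 * (y / 2 * (N k)%:R ^+ 2))).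
    by rewrite le_eqVlt; apply/orP; left; apply/eqP; field; rewrite !gt_eqF.
  by rewrite ler_wpM2l// mulr_ge0 ?invr_ge0 ?divr_ge0 ?ltW.
have : 2 * (\sum_(j < (N k)./2) pos_term (N k) (m k) j +
    \sum_(j < (N k)./2) (walk_term (N k) (m k) j - pos_term (N k) (m k) j)) @[k --> \oo] --> 4 * H y.
  rewrite (_ : 4 * H y = 2 * (2 * H y + 0)); last by ring.
  by apply: cvgMr; exact: cvgD.
apply: cvg_trans; apply: near_eq_cvg; apply: filterS N1 => k k1.
rewrite walk_surv_fold// -big_split/=; congr (_ * _); apply: eq_bigr => j _.
by rewrite addrC subrK.
Qed.

End sequences.
End walk_limit.

(** * Integrability of [H] and termwise integration *)

Section H_integrals.
Context {R : realType}.
Let leb : {measure set _ -> \bar R} := @lebesgue_measure R.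
Implicit Types (s c L rho v : R).

Lemma integrable_sqrt_inv L : 0 < L ->
  leb.-integrable (`]0, L]%classic : set R) (fun v => ((Num.sqrt v)^-1)%:E).
Proof.
move=> L0; apply/integrableP; split.
  by apply/measurable_EFinP; exact: measurable_sqrt_inv.
under eq_integral => v _ do rewrite abse_EFin ger0_norm ?invr_ge0 ?sqrtr_ge0//.
by rewrite integral_sqrt_inv// ltry.
Qed.

Lemma H_le_sqrt_inv c : 0 < c -> exists2 C, 0 < C & forall v, 0 < v <= 1 ->
  H (c * v) <= C * (Num.sqrt v)^-1.
Proof.
move=> c0; have [I I0 HI] := @H_sqrt_bounds R.
have r0 : 0 < Num.sqrt c by rewrite sqrtr_gt0.
exists (I / (2 * Num.sqrt c) + 1).
  by rewrite addr_gt0// divr_gt0// mulr_gt0.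
move=> v /andP[v0 v1]; have t0 : 0 < Num.sqrt v by rewrite sqrtr_gt0.
have t1 : Num.sqrt v <= 1 by rewrite -sqrtr1 ler_wsqrtr.
have /HI/andP[_] : 0 < c * v by rewrite mulr_gt0.
rewrite sqrtrM ?(ltW c0)// => h.
rewrite ler_pdivlMr//; set r := Num.sqrt c in r0 h *; set t := Num.sqrt v in t0 t1 h *.
rewrite -(ler_pM2l (_ : 0 < 2 * r)) ?mulr_gt0//.
apply: (@le_trans _ _ (I + 2 * (r * t))); first by apply: le_trans h; rewrite le_eqVlt; apply/orP; left; apply/eqP; ring.
have -> : 2 * r * (I / (2 * r) + 1) = I + 2 * r by field; rewrite gt_eqF.
by rewrite lerD2l ler_pM2l// ler_piMr// ltW.
Qed.

Lemma measurable_Hscale c L : 0 < c -> measurable_fun (`]0, L]%classic : set R) (fun v => H (c * v)).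
Proof.
move=> c0; apply: (measurable_fun_cvg (h := fun n v => \sum_(j < n) expR (- (rate j * (c * v))))).
  move=> n; apply: measurable_sum => j; apply: measurable_funTS.
  apply: continuous_measurable_fun => x.
  apply: continuous_comp; last exact: continuous_expR.
  by apply: cvgN; apply: cvgMr; apply: cvgMr; exact: cvg_id.
by move=> v /=; rewrite in_itv/= => /andP[v0 _]; apply: H_cvg; rewrite mulr_gt0.
Qed.

Lemma measurable_exp_scale s (D : set R) : measurable_fun D (fun v => expR (s * v)).
Proof.
apply: measurable_funTS; apply: continuous_measurable_fun => x.
apply: continuous_comp; last exact: continuous_expR.
by apply: cvgMr; exact: cvg_id.
Qed.

Lemma integrable_exp_H s c : 0 < c ->
  leb.-integrable (`]0, 1]%classic : set R) (fun v => (expR (s * v) * H (c * v))%:E).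
Proof.
move=> c0; have [C C0 HC] := H_le_sqrt_inv c0.
apply: (@le_integrable _ _ _ leb _ _ _ (fun v => ((expR `|s| * C)%:E * ((Num.sqrt v)^-1)%:E)%E)) => //.
3: by apply: integrableZl => //; exact: integrable_sqrt_inv.
  apply/measurable_EFinP; apply: measurable_funM; first exact: measurable_exp_scale.
  exact: measurable_Hscale.
move=> v /=; rewrite in_itv/= => /andP[v0 v1].
have v01 : 0 < v <= 1 by rewrite v0.
rewrite lee_fin normrM !normrM (ger0_norm (expR_ge0 _)).
rewrite (ger0_norm (ltW (H_gt0 _))) ?mulr_gt0//.
rewrite (ger0_norm (expR_ge0 _)) (gtr0_norm C0) (ger0_norm (_ : 0 <= (Num.sqrt v)^-1)) ?invr_ge0//.
rewrite -mulrA; apply: ler_pM; rewrite ?expR_ge0// ?HC ?(ltW (H_gt0 _)) ?mulr_gt0//.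
rewrite ler_expR (le_trans (ler_norm _))// normrM (gtr0_norm v0) ler_piMr//.
Qed.

Lemma integral_exp (a L : R) : 0 < L -> a != 0 ->
  (\int[leb]_(v in `[0%R, L]%classic) (expR (a * v))%:E)%E = ((expR (a * L) - 1) / a)%:E.
Proof.
move=> L0 a0; pose F v : R := expR (a * v) / a.
have cf : continuous (fun v : R => expR (a * v)).
  by move=> v; apply: continuous_comp; [apply: cvgMr; exact: cvg_id|exact: continuous_expR].
have dF (v : R) : is_derive v 1 F (expR (a * v)).
  rewrite /F; apply: is_derive_eq.
  by rewrite /GRing.scale/= !mulr1; field.
have -> : (expR (a * L) - 1) / a = F L - F 0.
  by rewrite /F mulr0 expR0; field.
rewrite EFinB; apply: continuous_FTC2 => //.
- exact: continuous_subspaceT.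
- split.
  + by move=> v _; exact: ex_derive.
  + by apply: cvg_at_right_filter; apply: cvgMl; exact: cf.
  + by apply: cvg_at_left_filter; apply: cvgMl; exact: cf.
- by move=> v _; rewrite derive1E; exact: derive_val.
Qed.

Lemma integral_exp_oc (a L : R) : 0 < L -> a != 0 ->
  (\int[leb]_(v in `]0%R, L]%classic) (expR (a * v))%:E)%E = ((expR (a * L) - 1) / a)%:E.
Proof.
move=> L0 a0; rewrite -integral_exp// integral_itv_obnd_cbnd//.
by apply/measurable_EFinP; exact: measurable_exp_scale.
Qed.

(** The integral of exp(- [rate j] y) over [0, rho]. *)
Definition theta_int_term rho j : R := (1 - expR (- (rate j * rho))) / rate j.

Lemma theta_int_term_itv rho j : 0 < rho -> 0 <= theta_int_term rho j <= (rate j)^-1.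
Proof.
move=> rho0; have a0 := @rate_gt0 R j.
have e1 : expR (- (rate j * rho)) <= 1 by rewrite expR_le1 oppr_le0 mulr_ge0// ltW.
have e0 := expR_ge0 (- (rate j * rho)).
rewrite divr_ge0 ?subr_ge0// ?(ltW a0)//=.
by rewrite -[leRHS]mul1r ler_pM2r ?invr_gt0//; lra.
Qed.

Lemma cvg_sum_le (u : nat -> R) B : (forall j, 0 <= u j) ->
  (forall n, \sum_(j < n) u j <= B) -> cvgn (fun n => \sum_(j < n) u j).
Proof.
move=> u0 uB; apply: nondecreasing_is_cvgn.
  by apply/nondecreasing_seqP => n; rewrite big_ord_recr/= lerDl.
by exists B => _ [n _ <-].
Qed.

Lemma integral_Hscale c L : 0 < c -> 0 < L -> exists2 U : R,
  \sum_(j < n) theta_int_term (c * L) j @[n --> \oo] --> U &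
  (\int[leb]_(v in `]0%R, L]%classic) (H (c * v))%:E)%E = (U / c)%:E.
Proof.
move=> c0 L0; have cL0 : 0 < c * L by rewrite mulr_gt0.
have cv : cvgn (fun n => \sum_(j < n) theta_int_term (c * L) j).
  apply: (@cvg_sum_le _ 2) => [j|n]; first by have /andP[] := theta_int_term_itv j cL0.
  apply: le_trans (sum_inv_rate_le n); apply: ler_sum => j _.
  by have /andP[] := theta_int_term_itv j cL0.
exists (limn (fun n => \sum_(j < n) theta_int_term (c * L) j)) => //.
transitivity (\int[leb]_(v in `]0%R, L]%classic) (\sum_(0 <= j <oo) (expR (- (rate j * c) * v))%:E))%E.
  apply: eq_integral => v; rewrite inE/= in_itv/= => /andP[v0 _].
  apply/esym/nneseries_EFin; under eq_fun do under eq_bigr do rewrite mulNr -mulrA.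
  by apply: H_cvg; rewrite mulr_gt0.
rewrite integral_nneseries//; last first.
  by move=> j; apply/measurable_EFinP; exact: measurable_exp_scale.
transitivity (\sum_(0 <= j <oo) (theta_int_term (c * L) j / c)%:E)%E.
  apply: eq_eseriesr => j _; have a0 := @rate_gt0 R j.
  have nz : - (rate j * c) != 0 by rewrite oppr_eq0 gt_eqF// mulr_gt0.
  rewrite (integral_exp_oc L0 nz).
  congr EFin; rewrite /theta_int_term mulNr -(mulrA (rate j)).
  by move: (expR (- (rate j * (c * L)))) (rate j) a0 => e r a0; field; rewrite !gt_eqF.
by apply: nneseries_EFin; under eq_fun do rewrite -mulr_suml; apply: cvgMl.
Qed.

(** No change of variables is made: in [integral_Hscale] the series depends only on the product
    [c * L], so both integrals are the same series up to the factor 1/c. *)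
Lemma Rintegral_Hscale rho : 0 < rho ->
  \int[leb]_(v in `]0, 1]) H (rho * v) = rho^-1 * \int[leb]_(y in `]0, rho]) H y.
Proof.
move=> rho0; have [U hU e1] := integral_Hscale rho0 ltr01.
have [V hV e2] := integral_Hscale ltr01 rho0.
have UV : U = V.
  rewrite mulr1 in hU; rewrite mul1r in hV.
  by rewrite -(cvg_lim _ hU)// (cvg_lim _ hV).
have e3 : (\int[leb]_(v in `]0%R, rho]%classic) (H v)%:E)%E = V%:E.
  by rewrite -[V]divr1 -e2; apply: eq_integral => v _; rewrite mul1r.
by rewrite /Rintegral e1 e3 UV /= mulrC.
Qed.

End H_integrals.

(** * The cycle sum as a Riemann sum *)

Section riemann_sum.
Context {R : realType}.
Let leb : {measure set _ -> \bar R} := @lebesgue_measure R.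
Variables (N : nat -> nat) (rho s : R).
Hypotheses (rho0 : 0 < rho) (N_oo : N M @[M --> \oo] --> \oo).
Hypothesis Nrho : M%:R / (N M)%:R ^+ 2 @[M --> \oo] --> rho.

Definition cycle_term M n : R :=
  if (n < M)%N then (N M)%:R * walk_surv (N M) n 1 * expR (s / M%:R) ^+ n else 0.

Definition cycle_integral : R := \int[leb]_(v in `]0, 1]) (expR (s * v) * H (rho * v)).

Let D : set R := `]0, +oo[%classic.
Let f_ M (v : R) : R := cycle_term M (Num.truncn ((v - 0) * M%:R)).
(** Cut off at 1 exclusively: at v = 1 the index is already [M], where [cycle_term] is 0. *)
Let f : R -> R := (fun v => 4 * (expR (s * v) * H (rho * v))) \_ `]0, 1[%classic.

Lemma cvg_natV : (n%:R^-1 : R) @[n --> \oo] --> (0 : R).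
Proof. by rewrite -(cvg_shiftS (fun n => n%:R^-1 : R)); exact: cvg_harmonic. Qed.

Let cycle_term_ge0 M n : 0 <= cycle_term M n.
Proof.
rewrite /cycle_term; case: ifP => // _; rewrite !mulr_ge0 ?exprn_ge0 ?expR_ge0//.
by have /andP[] := @walk_surv_itv R (N M) n 1.
Qed.

Let trunc_cvg v : 0 < v -> (Num.truncn (v * M%:R))%:R / (N M)%:R ^+ 2 @[M --> \oo] --> rho * v.
Proof.
move=> v0.
apply: (@squeeze_cvgr _ _ _ _ (fun M => v * (M%:R / (N M)%:R ^+ 2) - (N M)%:R ^- 2)
   (fun M => v * (M%:R / (N M)%:R ^+ 2))).
- near=> M; have N0 : 0 <= (N M)%:R ^- 2 :> R by rewrite invr_ge0 exprn_ge0.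
  have /truncn_itv/andP[h1 h2] : 0 <= v * M%:R by rewrite mulr_ge0// ltW.
  rewrite mulrA -[X in _ - X]mul1r -mulrBl !ler_wpM2r//.
  by rewrite lerBlDr natr1 ltW.
- rewrite (mulrC rho) -[X in _ --> X]subr0; apply: cvgB; first exact: cvgMr.
  have N_inv : ((N k)%:R^-1 : R) @[k --> \oo] --> (0 : R).
    apply/gtr0_cvgV0; last by apply: (cvg_comp _ _ N_oo); exact: cvgr_idn.
    by move/cvgnyPgt : N_oo => /(_ 0%N); apply: filterS => k; rewrite ltr0n.
  have N_inv2 : (N k)%:R^-1 * (N k)%:R^-1 @[k --> \oo] --> (0 * 0 : R) by exact: cvgM.
  by rewrite mulr0 in N_inv2; under eq_fun do rewrite expr2 invfM; exact: N_inv2.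
- by rewrite (mulrC rho); exact: cvgMr.
Unshelve. all: by end_near. Qed.

Let f_cvg v : D v -> f_ M v @[M --> \oo] --> f v.
Proof.
rewrite /D /= in_itv/= andbT => v0; rewrite /f patchE.
case: ifPn; rewrite ?notin_setE ?inE/= in_itv/= v0/= => v1; last first.
  apply: cvg_near_cst; near=> M.
  rewrite /f_ /cycle_term subr0 truncn_lt_nat ?mulr_ge0 ?(ltW v0)//.
  rewrite gtr_pMl; last by rewrite ltr0n; near: M; exists 1%N.
  by move/negP/negbTE : v1 => ->.
have lim : (N M)%:R * walk_surv (N M) (Num.truncn (v * M%:R)) 1 *
    expR (s * ((Num.truncn (v * M%:R))%:R / M%:R)) @[M --> \oo] --> 4 * H (rho * v) * expR (s * v).
  apply: cvgM; first by apply: walk_surv_cvg => //; [rewrite mulr_gt0|exact: trunc_cvg].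
  apply: continuous_cvg; first exact: continuous_expR.
  apply: cvgMr.
  apply: (@squeeze_cvgr _ _ _ _ (fun M => v - M%:R^-1) (cst v)).
  - near=> M; have M0 : 0 < M%:R :> R by rewrite ltr0n; near: M; exists 1%N.
    have /truncn_itv/andP[h1 h2] : 0 <= v * M%:R by rewrite mulr_ge0// ltW.
    rewrite /= ler_pdivrMr// h1 andbT ler_pdivlMr// mulrBl mulVf ?gt_eqF// lerBlDr natr1.
    exact: ltW.
  - rewrite -[X in _ --> X]subr0; apply: cvgB; first exact: cvg_cst.
    exact: cvg_natV.
  - exact: cvg_cst.
rewrite (_ : 4 * _ = 4 * H (rho * v) * expR (s * v)); last by ring.
apply: cvg_trans lim; apply: near_eq_cvg; near=> M.
have M0 : 0 < M%:R :> R by rewrite ltr0n; near: M; exists 1%N.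
rewrite /f_ /cycle_term subr0 truncn_lt_nat ?mulr_ge0 ?(ltW v0)// gtr_pMl// v1.
by rewrite -expRM_natl; congr (_ * expR _); field; rewrite gt_eqF.
Unshelve. all: by end_near. Qed.

Let f_bound : exists C M0, forall M, (M0 <= M)%N -> forall v, D v ->
  `|f_ M v| <= ((fun v => C * (Num.sqrt v)^-1) \_ `]0, 1]%classic) v.
Proof.
have [C C0 HC] := @walk_surv_bound R.
have N1 : \forall k \near \oo, (1 < N k)%N by move/cvgnyPgt : N_oo; apply.
have hr : \forall k \near \oo, rho / 2 < k%:R / (N k)%:R ^+ 2.
  by apply: (cvgr_gt _ Nrho); rewrite ltr_pdivrMr// ltr_pMr// ltr1n.
have [M0 _ hM] := filterI N1 hr.
pose r := Num.sqrt (rho / 2); have r0 : 0 < r by rewrite sqrtr_gt0 divr_gt0.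
exists (C * (r^-1 + 1) * expR `|s|), M0.+1 => M MM v; rewrite /D /= in_itv/= andbT => v0.
have [N1M rM] := hM M (ltnW MM).
have Mp : 0 < M%:R :> R by rewrite ltr0n (leq_trans _ MM).
rewrite ger0_norm ?cycle_term_ge0// /f_ /cycle_term subr0.
rewrite truncn_lt_nat ?mulr_ge0 ?(ltW v0)// gtr_pMl//.
have t0 : 0 < Num.sqrt v by rewrite sqrtr_gt0.
rewrite patchE; case: ltP => v1; last first.
  by case: ifP => // _; rewrite !mulr_ge0 ?expR_ge0 ?addr_ge0 ?invr_ge0 ?ltW.
rewrite mem_set/=; last by rewrite in_itv/= v0 ltW.
set n := Num.truncn (v * M%:R).
have /truncn_itv/andP[h1 h2] : 0 <= v * M%:R by rewrite mulr_ge0// ltW.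
have nM : n%:R / M%:R <= 1 :> R.
  by rewrite ler_pdivrMr// mul1r (le_trans h1)// ger_pMl// ltW.
have e1 : expR (s / M%:R) ^+ n <= expR `|s|.
  rewrite -expRM_natl ler_expR (le_trans (ler_norm _))// normrM normrM.
  rewrite (ger0_norm (_ : 0 <= n%:R)) ?ler0n// (gtr0_norm (_ : 0 < M%:R^-1)) ?invr_gt0//.
  by rewrite mulrCA -[leRHS]mulr1 ler_wpM2l// mulrC.
have N2 : 0 < (N M)%:R ^+ 2 :> R by rewrite exprn_gt0// ltr0n ltnW.
pose u : R := n.+1%:R / (N M)%:R ^+ 2.
(* Truncation gives n + 1 > v M, and M/N^2 > rho/2 for large M, hence u >= (rho/2) v. The additive 1
   of [walk_surv_bound] is later absorbed by 1 / sqrt v >= 1. *)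
have uv : r * Num.sqrt v <= Num.sqrt u.
  rewrite -sqrtrM ?divr_ge0 ?(ltW rho0)//; apply: ler_wsqrtr.
  apply: (@le_trans _ _ (M%:R / (N M)%:R ^+ 2 * v)); first by rewrite ler_wpM2r ?(ltW v0)// ltW.
  by rewrite mulrAC ler_wpM2r ?invr_ge0 ?(ltW N2)// mulrC ltW.
have u1 : (Num.sqrt u)^-1 <= r^-1 * (Num.sqrt v)^-1.
  by rewrite -invfM lef_pV2 ?posrE// ?mulr_gt0// (lt_le_trans _ uv)// mulr_gt0.
have v1' : 1 <= (Num.sqrt v)^-1.
  by rewrite -[leLHS]invr1 lef_pV2 ?posrE// -sqrtr1 ler_wsqrtr// ltW.
have q1 : (N M)%:R * walk_surv (N M) n 1 <= C * (r^-1 + 1) * (Num.sqrt v)^-1.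
  apply: le_trans (HC _ _ N1M) _; rewrite -mulrA ler_wpM2l ?(ltW C0)//.
  by rewrite mulrDl mul1r lerD.
have q0 : 0 <= (N M)%:R * walk_surv (N M) n 1 :> R.
  by rewrite mulr_ge0//; have /andP[] := @walk_surv_itv R (N M) n 1.
rewrite (mulrAC _ (expR `|s|)); apply: ler_pM => //.
Qed.

Let measurable_f_ M : (0 < M)%N -> measurable_fun D (f_ M).
Proof.
move=> M0; apply: (measurable_funS (measurable_itv `[0, +oo[)).
  by move=> x; rewrite /D /= !in_itv/= !andbT; exact: ltW.
by apply: measurable_step; rewrite ltr0n.
Qed.

Let integral_f_ M : (0 < M)%N ->
  (\int[leb]_(v in D) (f_ M v)%:E)%E = (M%:R^-1 * \sum_(n < M) cycle_term M n)%:E.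
Proof.
move=> M0; have Mp : 0 < M%:R :> R by rewrite ltr0n.
rewrite /D integral_itv_obnd_cbnd; last by apply/measurable_EFinP; exact: measurable_f_.
rewrite (integral_step 0 Mp)//; apply: nneseries_EFin.
under eq_fun do rewrite -mulr_suml mulrC.
apply: cvgMr; apply: cvg_near_cst; exists M => // L /= ML.
rewrite (big_ord_widen L (cycle_term M) ML) [RHS]big_mkcond; apply: eq_bigr => i _.
by case: ifPn => // /negbTE iM; rewrite /cycle_term iM.
Qed.

Let measurable_f : measurable_fun D f.
Proof.
rewrite /f; apply/measurable_restrict; [exact: measurable_itv|exact: measurable_itv|].
apply: (measurable_funS (measurable_itv `]0, 1])).
  by move=> x /= [_]; rewrite !in_itv/= => /andP[-> /ltW ->].
apply: measurable_funM => //; apply: measurable_funM; first exact: measurable_exp_scale.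
exact: measurable_Hscale.
Qed.

Lemma cycle_sum_cvg :
  M%:R^-1 * \sum_(n < M) cycle_term M n @[M --> \oo] --> 4 * cycle_integral.
Proof.
have [C [M0 HC]] := f_bound.
pose g : R -> R := (fun v => C * (Num.sqrt v)^-1) \_ `]0, 1]%classic.
have mD : measurable D by exact: measurable_itv.
have mP : measurable (`]0, 1]%classic : set R) by exact: measurable_itv.
have ig : leb.-integrable D (EFin \o g).
  have i1 : leb.-integrable (`]0, 1]%classic : set R) (fun v => (C%:E * ((Num.sqrt v)^-1)%:E)%E).
    by apply: integrableZl => //; exact: integrable_sqrt_inv.
  have i0 : leb.-integrable setT ((fun v => (C%:E * ((Num.sqrt v)^-1)%:E)%E) \_ `]0, 1]%classic).
    by apply: (iffLR (integrable_mkcond _ _)) => //; exact: measurable_itv.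
  have i2 : leb.-integrable D ((fun v => (C%:E * ((Num.sqrt v)^-1)%:E)%E) \_ `]0, 1]%classic).
    by apply: (integrableS _ _ _ i0) => //; exact: measurable_itv.
  apply: eq_integrable i2 => // v _; rewrite /g /= !patchE; case: ifP => // _.
have lim : (\int[leb]_(v in D) (f_ M v)%:E @[M --> \oo] --> \int[leb]_(v in D) (f v)%:E)%E.
  apply: (@lebesgue_dominated_cvg R D f_ f g M0.+1) => //.
  - by move=> M /(leq_ltn_trans (leq0n _)) M1; exact: measurable_f_.
  - by apply: aeW => v; exact: f_cvg.
  - by move=> M v /ltnW M1; exact: HC.
have fE : (\int[leb]_(v in D) (f v)%:E)%E = (4 * cycle_integral)%:E.
  have fP : EFin \o f = (fun v => (4 * (expR (s * v) * H (rho * v)))%:E) \_ `]0, 1[%classic.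
    by apply/funext => v; rewrite /f /= !patchE; case: ifP.
  rewrite -[LHS]/(\int[leb]_(v in D) (EFin \o f) v)%E fP -integral_mkcondr.
  have -> : D `&` `]0, 1[%classic = `]0, 1[%classic.
    by rewrite setIC; apply: setIidl => v; rewrite /D /= !in_itv/= andbT => /andP[].
  have i0 := integrable_exp_H s rho0.
  rewrite integral_itv_bndo_bndc; last first.
    apply: (measurable_funS mP); first by move=> v /=; rewrite !in_itv/= => /andP[-> /ltW ->].
    apply/measurable_EFinP; apply: measurable_funM => //.
    by move/measurable_int: i0 => /measurable_EFinP.
  under eq_integral do rewrite EFinM.
  rewrite integralZl// EFinM; congr (_ * _)%E.
  by rewrite /cycle_integral /Rintegral fineK// integrable_fin_num.
move: lim; rewrite fE => /fine_cvg; apply: cvg_trans; apply: near_eq_cvg.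
by exists 1%N => // M /= M1; rewrite integral_f_.
Qed.

End riemann_sum.

(** * Convergence in distribution from exponential moments *)

Section separation.
Context {R : realType}.
Implicit Types (y u eps : R) (n K : nat).

Lemma one_sub_pow_ge u K : 0 <= u <= 1 -> 1 - K%:R * u <= (1 - u) ^+ K.
Proof.
move=> /andP[u0 u1]; elim: K => [|K IH]; first by rewrite mul0r expr0; lra.
rewrite exprSr -natr1; have K0 : 0 <= K%:R :> R by rewrite ler0n.
have : (1 - K%:R * u) * (1 - u) <= (1 - u) ^+ K * (1 - u) by rewrite ler_wpM2r//; lra.
apply: le_trans; nra.
Qed.

Lemma one_sub_pow_le u K : 0 <= u <= 1 -> (1 - u) ^+ K * (1 + K%:R * u) <= 1.
Proof.
move=> /andP[u0 u1]; elim: K => [|K IH]; first by rewrite mul0r expr0; lra.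
have K0 : 0 <= K%:R :> R by rewrite ler0n.
apply: le_trans IH; rewrite exprSr -mulrA ler_wpM2l ?exprn_ge0//; first lra.
by rewrite -natr1; nra.
Qed.

(* Brosowski and Deutsch: for large [n] some [K] lies between [A ^- n] and
   [B ^- n], and then [1 - y^n]^K is close to 1 below A and to 0 above B. *)
Lemma separating_power (A B eps : R) : 0 < A < B -> B <= 1 -> 0 < eps ->
  exists n K, [/\ (0 < n)%N, forall y, 0 <= y <= A -> 1 - eps <= (1 - y ^+ n) ^+ K &
    forall y, B <= y <= 1 -> (1 - y ^+ n) ^+ K <= eps].
Proof.
move=> /andP[A0 AB] B1 e0; have B0 : 0 < B by lra.
pose r := A / B; have r0 : 0 <= r by rewrite divr_ge0; lra.
have r1 : r < 1 by rewrite ltr_pdivrMr// mul1r.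
have A1 : A < 1 by lra.
(* [K] is chosen with K A^n just below m. Once (A/B)^n <= m^2, K B^n >= m / (A/B)^n - 1 >= 1/m - 1,
   and [one_sub_pow_le] gives (1 - y^n)^K <= m above B. *)
pose m : R := Num.min 1 (eps / 2).
have m0 : 0 < m by rewrite lt_min; lra.
have me : m <= eps / 2 by rewrite ge_min lexx orbT.
have m1 : m <= 1 by rewrite ge_min lexx.
have rc : r ^+ n @[n --> \oo] --> (0 : R) by apply: cvg_expr; rewrite ger0_norm.
have ac : A ^+ n @[n --> \oo] --> (0 : R) by apply: cvg_expr; rewrite gtr0_norm.
have h1 : \forall n \near \oo, `|0 - r ^+ n| <= m ^+ 2.
  by move/cvgrPdist_le : rc; apply; rewrite exprn_gt0.
have h2 : \forall n \near \oo, `|0 - A ^+ n| <= m.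
  by move/cvgrPdist_le : ac; apply.
have h3 : \forall n \near \oo, (0 < n)%N by exists 1%N.
have [n [[hr ha] n0]] := filter_ex (filterI (filterI h1 h2) h3).
move: hr ha; rewrite !sub0r !normrN !ger0_norm ?exprn_ge0 ?(ltW A0)// => hr ha.
pose K := (Num.truncn (m / A ^+ n)).
have An0 : 0 < A ^+ n by rewrite exprn_gt0.
have Bn0 : 0 < B ^+ n by rewrite exprn_gt0.
have mA0 : 0 <= m / A ^+ n by rewrite divr_ge0 ?(ltW m0) ?(ltW An0).
have KA : K%:R * A ^+ n <= m by rewrite -ler_pdivlMr// truncn_le.
have KB : m <= (K%:R + 1) * A ^+ n.
  by rewrite -ler_pdivrMr// natr1 ltW// truncnS_gt.
exists n, K; split=> // y /andP[y0 y1].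
  have yn : 0 <= y ^+ n <= 1 by rewrite exprn_ge0//= exprn_ile1//; lra.
  apply: le_trans (one_sub_pow_ge K yn).
  rewrite lerD2l lerN2; apply: (@le_trans _ _ (K%:R * A ^+ n)); last lra.
  by rewrite ler_wpM2l// lerXn2r// nnegrE; lra.
have y0' : 0 <= y by lra.
have yn : 0 <= y ^+ n <= 1 by rewrite exprn_ge0//= exprn_ile1.
have := one_sub_pow_le K yn.
have : m / r ^+ n - 1 <= K%:R * y ^+ n.
  apply: (@le_trans _ _ (K%:R * B ^+ n)); last first.
    by rewrite ler_wpM2l// lerXn2r// nnegrE; lra.
  rewrite /r expr_div_n invf_div mulrA.
  rewrite -(ler_pM2r An0) mulrBl divfK ?gt_eqF// mul1r.
  have Bn1 : B ^+ n <= 1 by rewrite exprn_ile1//; lra.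
  by nra.
have : m^-1 <= m / r ^+ n.
  have rn0 : 0 < r ^+ n by rewrite exprn_gt0// divr_gt0.
  by rewrite ler_pdivlMr// mulrC ler_pdivrMr// -expr2.
have zz : 0 <= (1 - y ^+ n) ^+ K by rewrite exprn_ge0//; lra.
move: ((1 - y ^+ n) ^+ K) zz => z zz g1 g2 g3.
have g4 : z * m^-1 <= 1.
  apply: le_trans g3; rewrite ler_wpM2l//; lra.
by move: g4; rewrite ler_pdivrMr// mul1r; lra.
Qed.

End separation.

Section weak_limit.
Context {R : realType}.
Implicit Types (x a b eps : R).

(* [g k] is the probability of the value [k / M], and [e j] is the expectation
   of the j-th power of [expR (- k / M)]. *)
Record lattice_law (M : nat) (g e : nat -> R) : Prop := LatticeLaw {
  lattice_ge0 : forall k, 0 <= g k ;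
  lattice_total : e 0%N = 1 ;
  lattice_exp : forall j,
    \sum_(k < L) g k * expR (- (j%:R * (k%:R / M%:R))) @[L --> \oo] --> e j }.

Definition lattice_cdf (M : nat) (g : nat -> R) x : R :=
  if x < 0 then 0 else \sum_(k < (Num.truncn (x * M%:R)).+1) g k.

Lemma lattice_cdf_itv M g e x : lattice_law M g e -> 0 <= lattice_cdf M g x <= 1.
Proof.
move=> [g0 e1 ge]; rewrite /lattice_cdf; case: ifP; rewrite ?lexx ?ler01// => _.
rewrite sumr_ge0//=; have := ge 0%N.
under eq_fun do under eq_bigr do rewrite mul0r oppr0 expR0 mulr1.
rewrite e1 => /cvg_lim <- //; apply: nondecreasing_cvgn_le.
  by apply/nondecreasing_seqP => i; rewrite big_ord_recr/= lerDl.
by apply/cvg_ex; exists 1; have := ge 0%N; under eq_fun do under eq_bigr do rewrite mul0r oppr0 expR0 mulr1; rewrite e1.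
Qed.

(** The order of quantifiers is the point: the level [l] depends on the limit moments [m] only. Any
    two families with these limit moments are separated by the same [l], which makes their
    distribution functions comparable. *)
Lemma lattice_cdf_sep (m : nat -> R) a b eps : a < b -> 0 < eps -> exists l,
  forall g e, (\forall M \near \oo, lattice_law M (g M) (e M)) ->
    (forall j, e M j @[M --> \oo] --> m j) ->
  \forall M \near \oo, lattice_cdf M (g M) a <= l + eps /\
    l - eps <= lattice_cdf M (g M) b.
Proof.
move=> ab eps0; have [a0|a0] := ltP a 0.
  exists 0 => g e gl _; near=> M.
  have Ml : lattice_law M (g M) (e M) by near: M.
  rewrite {1}/lattice_cdf a0; split; first lra.
  by have := lattice_cdf_itv b Ml; lra.
(* exp(-x) reverses the order: values up to a give y >= B, where (1 - y^n)^K is small, and values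
   beyond b give y <= A, where it is close to 1. Its mean thus approximates the mass above the
   gap. *)
pose A := expR (- b); pose B := expR (- a).
have AB : 0 < A < B by rewrite expR_gt0 ltr_expR ltrN2.
have B1 : B <= 1 by rewrite expR_le1; lra.
have eps2 : 0 < eps / 2 by lra.
have [n [K [n0 hA hB]]] := separating_power AB B1 eps2.
(* The binomial expansion of (1 - y^n)^K with each power y^(n i) replaced by [f (n * i)]; applied to
   moments it is the mean of the polynomial. *)
pose lin (f : nat -> R) : R := \sum_(i < K.+1) (-1) ^+ i * f (n * i)%N *+ 'C(K, i).
exists (1 - lin m) => g e gl em.
have lin_cvg : lin (e M) @[M --> \oo] --> lin m.
  by apply: cvg_big => [|i _]; [exact: add_continuous|apply: cvgMn; apply: cvgMr; exact: em].
have le2 : \forall M \near \oo, `|lin m - lin (e M)| <= eps / 2.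
  by move/cvgrPdist_le : lin_cvg; apply.
near=> M.
have [g0 e1 ge] : lattice_law M (g M) (e M) by near: M.
have M0 : 0 < M%:R :> R by rewrite ltr0n; near: M; exists 1%N.
have dlin : `|lin m - lin (e M)| <= eps / 2 by near: M.
pose y k : R := expR (- (k%:R / M%:R)).
have y01 k : 0 <= y k <= 1.
  by rewrite expR_ge0 expR_le1 oppr_le0 divr_ge0.
pose be k := (1 - y k ^+ n) ^+ K.
have be01 k : 0 <= be k <= 1.
  have /andP[y0 y1] := y01 k.
  have h : 0 <= 1 - y k ^+ n <= 1.
    by rewrite subr_ge0 exprn_ile1//= lerBlDr lerDl exprn_ge0.
  by case/andP: h => h0 h1; rewrite exprn_ge0//= exprn_ile1.
have be_cvg : \sum_(k < L) g M k * be k @[L --> \oo] --> lin (e M).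
  have -> : (fun L => \sum_(k < L) g M k * be k) = (fun L => \sum_(i < K.+1)
     (-1) ^+ i * (\sum_(k < L) g M k * expR (- ((n * i)%N%:R * (k%:R / M%:R)))) *+ 'C(K, i)).
    apply/funext => L.
    under [RHS]eq_bigr do rewrite mulr_sumr -sumrMnl.
    rewrite exchange_big; apply: eq_bigr => k _.
    rewrite /be exprBn mulr_sumr; apply: eq_bigr => i _.
    rewrite expr1n mulr1 -!mulrnAr mulrCA; congr (_ * (_ * _)).
    congr (_ *+ _).
    rewrite -exprM -expRM_natl.
    by rewrite mulrN.
  by apply: cvg_big => [|i _]; [exact: add_continuous|apply: cvgMn; apply: cvgMr; exact: ge].
have g_cvg : \sum_(k < L) g M k @[L --> \oo] --> (1 : R).
  have := ge 0%N; rewrite e1.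
  by under eq_fun do under eq_bigr do rewrite mul0r oppr0 expR0 mulr1.
have lt_trunc x k : 0 <= x -> (k < (Num.truncn (x * M%:R)).+1)%N = (k%:R / M%:R <= x).
  by move=> x0; rewrite ler_pdivrMr// ltnNge truncn_lt_nat ?mulr_ge0// -leNgt.
have b0 : 0 <= b by lra.
pose n_ x := (Num.truncn (x * M%:R)).+1.
have cdfE x : 0 <= x -> lattice_cdf M (g M) x = \sum_(k < n_ x) g M k.
  by move=> x0; rewrite /lattice_cdf ltNge x0.
have upper : lin (e M) <= 1 - lattice_cdf M (g M) a + eps / 2.
  have lim : \sum_(k < L) g M k - \sum_(k < n_ a) g M k + eps / 2 * \sum_(k < L) g M k @[L --> \oo] --> 1 - lattice_cdf M (g M) a + eps / 2.
    rewrite -[X in _ --> _ + X]mulr1 cdfE//; apply: cvgD; last exact: cvgMr.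
    by apply: cvgB => //; exact: cvg_cst.
  apply: ler_cvg_to be_cvg lim _; exists (n_ a) => // L /= aL.
  rewrite -(subnKC aL) !big_split_ord/= mulrDr.
  have h1 : \sum_(k < n_ a) g M k * be k <= eps / 2 * \sum_(k < n_ a) g M k.
    rewrite mulr_sumr; apply: ler_sum => k _; rewrite mulrC ler_wpM2r//.
    have := ltn_ord k; rewrite lt_trunc// => ka.
    apply: hB; have /andP[_ ->] := y01 k; rewrite andbT.
    by rewrite ler_expR lerN2.
  have h2 : \sum_(k < L - n_ a) g M (n_ a + k)%N * be (n_ a + k)%N <= \sum_(k < L - n_ a) g M (n_ a + k)%N.
    by apply: ler_sum => k _; rewrite ler_piMr//; have /andP[] := be01 (n_ a + k)%N.
  have h3 : 0 <= eps / 2 * \sum_(k < L - n_ a) g M (n_ a + k)%N.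
    by rewrite mulr_ge0 ?sumr_ge0//; lra.
  lra.
have lower : (1 - eps / 2) * 1 - lattice_cdf M (g M) b <= lin (e M).
  have lim : (1 - eps / 2) * \sum_(k < L) g M k - \sum_(k < n_ b) g M k @[L --> \oo] --> (1 - eps / 2) * 1 - lattice_cdf M (g M) b.
    rewrite cdfE//; apply: cvgB; last exact: cvg_cst.
    exact: cvgMr.
  apply: ler_cvg_to lim be_cvg _; exists (n_ b) => // L /= bL.
  rewrite -(subnKC bL) !big_split_ord/= mulrDr.
  have h1 : 0 <= \sum_(k < n_ b) g M k * be k.
    by apply: sumr_ge0 => k _; rewrite mulr_ge0//; have /andP[] := be01 k.
  have h2 : (1 - eps / 2) * \sum_(k < L - n_ b) g M (n_ b + k)%N <= \sum_(k < L - n_ b) g M (n_ b + k)%N * be (n_ b + k)%N.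
    rewrite mulr_sumr; apply: ler_sum => k _; rewrite mulrC ler_wpM2l//.
    apply: hA; have /andP[-> _] := y01 (n_ b + k)%N; rewrite /= ler_expR lerN2 ltW//.
    by rewrite ltNge -lt_trunc// -leqNgt leq_addr.
  have h3 : (1 - eps / 2) * \sum_(k < n_ b) g M k <= \sum_(k < n_ b) g M k.
    have s0 : 0 <= \sum_(k < n_ b) g M k by apply: sumr_ge0.
    by rewrite ler_piMl//; lra.
  lra.
by move: dlin; rewrite ler_norml => /andP[d1 d2]; split; lra.
Unshelve. all: by end_near. Qed.

End weak_limit.

(** * The limit distribution function and a variable that has it *)

Section limit_distribution.
Context {R : realType}.
Implicit Types (x y eps : R).

Section limit_cdf.
Variables (m : nat -> R) (g0 e0 : nat -> nat -> R).
Hypothesis law0 : \forall M \near \oo, lattice_law M (g0 M) (e0 M).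
Hypothesis mom0 : forall j, e0 M j @[M --> \oo] --> m j.
Hypothesis tight0 : forall eps, 0 < eps ->
  exists x, \forall M \near \oo, 1 - eps <= lattice_cdf M (g0 M) x.

Let A x := [set c : R | exists2 y, x < y & \forall M \near \oo, lattice_cdf M (g0 M) y <= c].

(* The right-continuous version of the upper limit of the distribution
   functions. *)
Definition limit_cdf x := inf (A x).

Let A1 x : A x 1.
Proof.
exists (x + 1); first lra.
by near=> M; have /(lattice_cdf_itv (x + 1))/andP[] : lattice_law M (g0 M) (e0 M) by near: M.
Unshelve. all: by end_near. Qed.

Let A_ge0 x c : A x c -> 0 <= c.
Proof.
move=> [y xy yc]; have [M [Ml Mc]] := filter_ex (filterI law0 yc).
by apply: le_trans Mc; have /andP[] := lattice_cdf_itv y Ml.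
Qed.

Let A_inf x : has_inf (A x).
Proof. by split; [exists 1|exists 0 => c /A_ge0]. Qed.

Let limit_cdf_le x c : A x c -> limit_cdf x <= c.
Proof. by move=> Ac; apply: ge_inf => //; exists 0 => c' /A_ge0. Qed.

Lemma limit_cdf_ge0 x : 0 <= limit_cdf x.
Proof. by apply: lb_le_inf; [exists 1|move=> c /A_ge0]. Qed.

Lemma limit_cdf_le1 x : limit_cdf x <= 1.
Proof. exact: limit_cdf_le. Qed.

Lemma limit_cdf_nd : nondecreasing limit_cdf.
Proof.
move=> x y xy; apply: lb_le_inf; first by exists 1.
by move=> c [y' yy' h]; apply: limit_cdf_le; exists y' => //; apply: le_lt_trans yy'.
Qed.

Lemma limit_cdf_rc : right_continuous limit_cdf.
Proof.
move=> x; apply/cvgrPdist_le => eps eps0.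
have [c Ac cx] := inf_adherent eps0 (A_inf x).
have [y xy yc] := Ac.
near=> t.
have xt : x < t by near: t; exact: nbhs_right_gt.
have ty : t < y by near: t; exact: nbhs_right_lt.
have h1 := limit_cdf_nd (ltW xt).
have h2 : limit_cdf t <= c by apply: limit_cdf_le; exists y.
rewrite ler0_norm; last by rewrite subr_le0.
by move: cx; rewrite -/(limit_cdf x); lra.
Unshelve. all: by end_near. Qed.

Lemma limit_cdf_lt0 x : x < 0 -> limit_cdf x = 0.
Proof.
move=> x0; apply/eqP; rewrite eq_le limit_cdf_ge0 andbT; apply: limit_cdf_le.
exists (x / 2); first lra.
by apply: nearW => M; rewrite /lattice_cdf ifT//; lra.
Qed.

Section convergence.
Variables (g e : nat -> nat -> R).
Hypothesis law : \forall M \near \oo, lattice_law M (g M) (e M).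
Hypothesis mom : forall j, e M j @[M --> \oo] --> m j.

(** The reference family at a slightly larger point bounds the common level [l] from above, and [l]
    bounds the given family at x. The lower bound works in the same way to the left of x. *)
Lemma lattice_cdf_limsup x eps : 0 < eps ->
  \forall M \near \oo, lattice_cdf M (g M) x <= limit_cdf x + eps.
Proof.
move=> eps0; have eps3 : 0 < eps / 3 by lra.
have [c [y xy yc] cx] := inf_adherent eps3 (A_inf x).
have [l hl] := @lattice_cdf_sep R m x y (eps / 3) xy eps3.
have h0 := hl _ _ law0 mom0; have h := hl _ _ law mom.
have [M [[_ h1] h2]] := filter_ex (filterI h0 yc).
apply: filterS h => M' [h3 _]; move: cx; rewrite -/(limit_cdf x); lra.
Qed.

Lemma lattice_cdf_liminf x y eps : y < x -> 0 < eps ->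
  \forall M \near \oo, limit_cdf y - eps <= lattice_cdf M (g M) x.
Proof.
move=> yx eps0; have eps3 : 0 < eps / 2 by lra.
have yz : (y + x) / 2 < x by lra.
have [l hl] := @lattice_cdf_sep R m ((y + x) / 2) x (eps / 2) yz eps3.
have h0 := hl _ _ law0 mom0; have h := hl _ _ law mom.
have : limit_cdf y <= l + eps / 2.
  apply: limit_cdf_le; exists ((y + x) / 2); first lra.
  by apply: filterS h0 => M [].
move=> hy; apply: filterS h => M [_ h1]; lra.
Qed.

(** For a monotone right-continuous function the hypothesis amounts to continuity at x. In this form
    it can be supplied both by the absence of an atom and by a continuity point. *)
Lemma lattice_cdf_cvg x :
  (forall eps, 0 < eps -> exists2 y, y < x & limit_cdf x - eps <= limit_cdf y) ->
  lattice_cdf M (g M) x @[M --> \oo] --> limit_cdf x.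
Proof.
move=> xc; apply/cvgrPdist_le => eps eps0; have eps2 : 0 < eps / 2 by lra.
have [y yx hy] := xc _ eps2.
have h1 := lattice_cdf_limsup x eps0; have h2 := lattice_cdf_liminf yx eps2.
apply: filterS (filterI h1 h2) => M [g1 g2].
by rewrite ler_norml; apply/andP; split; lra.
Qed.

End convergence.

Lemma limit_cdf_y : limit_cdf x @[x --> +oo] --> (1 : R).
Proof.
apply/cvgrPdist_le => eps eps0; have eps2 : 0 < eps / 2 by lra.
have [x0 hx] := tight0 eps2.
near=> x.
have h1 := lattice_cdf_limsup law0 mom0 x0 eps2.
have [M [g1 g2]] := filter_ex (filterI hx h1).
have xx : x0 <= x by near: x; apply: nbhs_pinfty_ge; exact: num_real.
have := limit_cdf_nd xx; have := limit_cdf_le1 x => g3 g4.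
rewrite ger0_norm; [lra|by rewrite subr_ge0].
Unshelve. all: by end_near. Qed.

Lemma limit_cdf_Ny : limit_cdf x @[x --> -oo] --> (0 : R).
Proof.
apply: cvg_near_cst; near=> x; apply: limit_cdf_lt0.
by near: x; apply: nbhs_ninfty_lt; exact: num_real.
Unshelve. all: by end_near. Qed.

End limit_cdf.

Lemma exists_rv_of_cdf (F : R -> R) : nondecreasing F -> right_continuous F ->
  F @ -oo --> (0 : R) -> F @ +oo --> (1 : R) -> (forall x, x < 0 -> F x = 0) ->
  exists (d' : measure_display) (T' : measurableType d') (P' : probability T' R)
    (X : {RV P' >-> R}), (forall w, 0 <= X w) /\
    forall x, P' [set w | X w <= x] = (F x)%:E.
Proof.
move=> nd rc FNy Fy F0.
pose f1 := isCumulative.Build R _ R F nd rc.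
pose f2 := isCumulativeBounded.Build R 0 1 F FNy Fy.
pose f : cumulativeBounded (0 : R) (1 : R) := HB.pack F f1 f2.
pose P' := lebesgue_stieltjes_measure f.
(* Under this measure the identity is nonnegative only almost surely. Truncation makes it
   nonnegative everywhere and keeps the distribution function, which vanishes on the negative
   reals. *)
pose X0 : measurableTypeR R -> R := fun w => Num.max w 0.
have mX0 : measurable_fun setT X0 by apply: measurable_maxr.
pose X : {RV P' >-> R} := HB.pack X0 (isMeasurableFun.Build _ _ _ _ X0 mX0).
exists _, (measurableTypeR R), P', X; split=> [w|x]; first by rewrite /= le_max lexx orbT.
have cdfE := cdf_lebesgue_stieltjes_id f x.
have [x0|x0] := ltP x 0.
  rewrite F0// (_ : [set _ | _] = set0) ?measure0// -subset0 => w /=.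
  by rewrite /X0 ge_max => /andP[_]; rewrite leNgt x0.
rewrite -[F x]/(f x) -cdfE /cdf /distribution /pushforward preimage_id.
congr (P' _); apply/seteqP; split=> w /=; rewrite in_itv/= /X0 ge_max x0 andbT//.
Qed.

End limit_distribution.

(** * Limits of the generating functions *)

Section G_alternative.
Context {R : realType}.
Implicit Types (rho s : R).
Let leb : {measure set _ -> \bar R} := @lebesgue_measure R.

Lemma integrable_exp s : leb.-integrable (`]0, 1]%classic : set R) (fun v => (expR (s * v))%:E).
Proof.
apply: (@le_integrable _ _ _ leb _ _ _ (fun v => ((expR `|s|)%:E * ((Num.sqrt v)^-1)%:E)%E)) => //.
3: by apply: integrableZl => //; exact: integrable_sqrt_inv.
  by apply/measurable_EFinP; exact: measurable_exp_scale.
move=> v /=; rewrite in_itv/= => /andP[v0 v1].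
have t0 : 0 < Num.sqrt v by rewrite sqrtr_gt0.
have v1' : 1 <= (Num.sqrt v)^-1.
  by rewrite -[leLHS]invr1 lef_pV2 ?posrE// -sqrtr1 ler_wsqrtr.
rewrite lee_fin ger0_norm ?expR_ge0// ger0_norm ?mulr_ge0 ?expR_ge0 ?invr_ge0//.
apply: (@le_trans _ _ (expR `|s|)); last by rewrite ler_peMr ?expR_ge0.
rewrite ler_expR (le_trans (ler_norm _))//.
by rewrite normrM (gtr0_norm v0) ler_piMr.
Qed.

(** Integrating out the constant [H rho] leaves the form in which the limit of the generating
    functions appears. *)
Lemma onem_G rho s : 0 < rho -> 1 - G rho s = expR s - s * cycle_integral rho s / H rho.
Proof.
move=> rho0; have h0 := H_gt0 rho0.
have [->|s0] := eqVneq s 0; first by rewrite /G !mul0r expR0.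
rewrite /G.
have -> : \int[leb]_(v in `]0, 1]) (expR (s * v) * (H (v * rho) - H rho)) =
    cycle_integral rho s - (expR s - 1) / s * H rho.
  transitivity (\int[leb]_(v in `]0, 1]) (expR (s * v) * H (rho * v) - expR (s * v) * H rho)).
    by apply: eq_Rintegral => v _; rewrite mulrBr (mulrC v).
  rewrite RintegralB//.
  - rewrite RintegralZr//; last exact: integrable_exp.
    rewrite [X in _ - X * _]/Rintegral integral_exp_oc// mulr1.
    by [].
  - exact: integrable_exp_H.
  - apply: (eq_integrable _ _ _ _ (integrableZr _ (H rho) (integrable_exp s))) => //.
by field; rewrite s0 gt_eqF.
Qed.

End G_alternative.

Section generating_functions.
Context {R : realType}.
Variables (N : nat -> nat) (rho : R).
Hypotheses (rho0 : 0 < rho) (N_oo : N M @[M --> \oo] --> \oo).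
Hypothesis Nrho : M%:R / (N M)%:R ^+ 2 @[M --> \oo] --> rho.
Implicit Types s : R.

Let q M n : R := walk_surv (N M) n 1.
Let T M n : R := fc_tail (N M) M n.
Let z s M : R := expR (s / M%:R).

(** The numerator tends to 0 like 1/N because a cycle starts next to the boundary; [q M M] has the
    same order and normalizes it. *)
Definition cycle_den s M : R := (1 - z s M * cycle_gf M (q M) (z s M)) / q M M.

(** Closed form of the sum over n of P(lambda > n) z^n, with z = exp(s/M), provided by [tsum_cvg]
    when the denominator is positive. *)
Definition tail_sum s M : R :=
  (tail_gf M (q M) (z s M) + cycle_gf M (q M) (z s M)) / (1 - z s M * cycle_gf M (q M) (z s M)).

Let q0 M : (1 < N M)%N -> q M 0 = 1.
Proof. by move=> h; rewrite /q /= h. Qed.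

Let zM s M : (0 < M)%N -> z s M ^+ M = expR s.
Proof.
by move=> M0; rewrite /z -expRM_natl mulrC divfK// pnatr_eq0; lia.
Qed.

Let Nq_cvg : (N M)%:R * q M M @[M --> \oo] --> 4 * H rho.
Proof. exact: walk_surv_cvg. Qed.

Lemma walk_surv_gt0_near : \forall M \near \oo, [/\ (0 < M)%N, (1 < N M)%N & 0 < q M M].
Proof.
have h1 : \forall M \near \oo, (1 < N M)%N by move/cvgnyPgt : N_oo; apply.
have h2 : \forall M \near \oo, 0 < (N M)%:R * q M M.
  by apply: (cvgr_gt _ Nq_cvg); rewrite mulr_gt0 ?H_gt0.
near=> M; split; [by near: M; exists 1%N|by near: M|].
have N1 : (1 < N M)%N by near: M.
have : 0 < (N M)%:R * q M M by near: M.
by rewrite pmulr_rgt0// ltr0n ltnW.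
Unshelve. all: by end_near. Qed.

Let z_cvg s : z s M @[M --> \oo] --> (1 : R).
Proof.
have h : (s / M%:R) @[M --> \oo] --> (0 : R).
  by rewrite -[X in _ --> X](mulr0 s); apply: cvgMr; exact: cvg_natV.
rewrite -[X in _ --> X](@expR0 R) /z.
apply: (@continuous_cvg _ _ _ _ _ (fun M : nat => s / M%:R) expR) => //.
exact: continuous_expR.
Qed.

Let expR_sub1 (x : R) : x <= expR x - 1 <= x * expR x.
Proof.
rewrite lerBrDl expR_ge1Dx/=.
have := ler_wpM2l (expR_ge0 x) (expR_ge1Dx (- x)).
rewrite -expRD subrr expR0 => h; lra.
Qed.

Lemma Mz_cvg s : M%:R * (z s M - 1) @[M --> \oo] --> s.
Proof.
apply: (@squeeze_cvgr _ _ _ _ (cst s) (fun M => s * z s M)).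
- exists 1%N => // M /= M0; have Mp : 0 < M%:R :> R by rewrite ltr0n.
  have /andP[h1 h2] := expR_sub1 (s / M%:R).
  rewrite -ler_pdivrMl// mulrC h1/= -ler_pdivlMl// (le_trans h2)//.
  by rewrite le_eqVlt; apply/orP; left; apply/eqP; rewrite /z; ring.
- exact: cvg_cst.
- by rewrite -[X in _ --> X]mulr1; apply: cvgMr; exact: z_cvg.
Qed.

Let NM_cvg : (N M)%:R / M%:R @[M --> \oo] --> (0 : R).
Proof.
have N_inv : ((N k)%:R^-1 : R) @[k --> \oo] --> (0 : R).
  apply/gtr0_cvgV0; last by apply: (cvg_comp _ _ N_oo); exact: cvgr_idn.
  by move/cvgnyPgt : N_oo => /(_ 0%N); apply: filterS => k; rewrite ltr0n.
have h : (N M)%:R^-1 / (M%:R / (N M)%:R ^+ 2) @[M --> \oo] --> 0 / rho.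
  by apply: cvgM => //; apply: cvgV => //; rewrite gt_eqF.
rewrite mul0r in h; apply: cvg_trans h; apply: near_eq_cvg.
near=> M; have [M0 N1 _] : [/\ (0 < M)%N, (1 < N M)%N & 0 < q M M].
  by near: M; exact: walk_surv_gt0_near.
by field; rewrite !pnatr_eq0; lia.
Unshelve. all: by end_near. Qed.

Let tail_cvg s : tail_gf M (q M) (z s M) / (M%:R * q M M) @[M --> \oo] -->
  cycle_integral rho s / H rho.
Proof.
have h : (M%:R^-1 * \sum_(n < M) cycle_term N s M n) / ((N M)%:R * q M M) @[M --> \oo] -->
    4 * cycle_integral rho s / (4 * H rho).
  apply: cvgM; first exact: cycle_sum_cvg.
  by apply: cvgV => //; rewrite mulf_neq0// gt_eqF// H_gt0.
have -> : cycle_integral rho s / H rho = 4 * cycle_integral rho s / (4 * H rho).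
  by field; rewrite gt_eqF// H_gt0.
apply: cvg_trans h; apply: near_eq_cvg; near=> M.
have [M0 N1 qM] : [/\ (0 < M)%N, (1 < N M)%N & 0 < q M M].
  by near: M; exact: walk_surv_gt0_near.
have -> : \sum_(n < M) cycle_term N s M n = (N M)%:R * tail_gf M (q M) (z s M).
  by rewrite mulr_sumr; apply: eq_bigr => i _; rewrite /cycle_term ltn_ord mulrA.
by move: (tail_gf _ _ _) => t; field; rewrite !pnatr_eq0 gt_eqF//; lia.
Unshelve. all: by end_near. Qed.

(** By [cycle_gfE] the numerator is (1 - z) + z q(M) e^s - z (z - 1) [tail_gf]. Divided by q(M), the
    first term is of order N/M and vanishes; the others give e^s and the integral in [onem_G]. *)
Lemma cycle_den_cvg s : cycle_den s M @[M --> \oo] --> 1 - G rho s.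
Proof.
rewrite onem_G//.
have h : - ((N M)%:R / M%:R) * (M%:R * (z s M - 1)) / ((N M)%:R * q M M) + z s M * expR s
    - z s M * (M%:R * (z s M - 1)) * (tail_gf M (q M) (z s M) / (M%:R * q M M)) @[M --> \oo] -->
  - 0 * s / (4 * H rho) + 1 * expR s - 1 * s * (cycle_integral rho s / H rho).
  apply: cvgB; last first.
    by apply: cvgM; [apply: cvgM; [exact: z_cvg|exact: Mz_cvg]|exact: tail_cvg].
  apply: cvgD; last by apply: cvgMl; exact: z_cvg.
  apply: cvgM; first by apply: cvgM; [apply: cvgN; exact: NM_cvg|exact: Mz_cvg].
  by apply: cvgV => //; rewrite mulf_neq0// gt_eqF// H_gt0.
rewrite oppr0 !mul0r add0r !mul1r mulrA in h.
apply: cvg_trans h; apply: near_eq_cvg; near=> M.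
have [M0 N1 qM] : [/\ (0 < M)%N, (1 < N M)%N & 0 < q M M].
  by near: M; exact: walk_surv_gt0_near.
rewrite /cycle_den cycle_gfE ?q0// zM//.
move: (tail_gf _ _ _) => t; move: (z s M) (expR s) => u v.
have N0 : (N M)%:R != 0 :> R by rewrite pnatr_eq0; lia.
have Mn0 : M%:R != 0 :> R by rewrite pnatr_eq0; lia.
by move: ((N M)%:R : R) (M%:R : R) (q M M) qM N0 Mn0 => a b c c0 a0 b0; field; rewrite a0 b0 gt_eqF.
Unshelve. all: by end_near. Qed.

Lemma cycle_den_gt0 s : G rho s < 1 -> \forall M \near \oo, 0 < 1 - z s M * cycle_gf M (q M) (z s M).
Proof.
move=> G1.
have h : \forall M \near \oo, 0 < cycle_den s M.
  by apply: (cvgr_gt _ (@cycle_den_cvg s)); rewrite subr_gt0.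
apply: filterS (filterI walk_surv_gt0_near h) => M [[_ _ qM]].
by rewrite /cycle_den pmulr_lgt0// invr_gt0.
Qed.

Lemma fc_tail_sum_cvg M s : (1 < N M)%N -> 0 < 1 - z s M * cycle_gf M (q M) (z s M) ->
  \sum_(n < K) T M n * z s M ^+ n @[K --> \oo] --> tail_sum s M.
Proof.
move=> N1 d0; apply: tsum_cvg; rewrite ?q0//.
- by move=> n; exact: walk_surv_ni.
- by move=> n; have /andP[] := @fc_surv_itv R (N M) M n 1 M.
- by move=> n; rewrite /T fc_tail_renewal.
- exact: expR_gt0.
by move=> n; have /andP[] := @walk_surv_itv R (N M) n 1.
Qed.

(** The left side is E z^lambda, by summation by parts. The right side is the geometric sum over
    completed cycles followed by a last one of exactly [M] steps. *)
Lemma tail_sum_mgf M s : (0 < M)%N -> (1 < N M)%N -> 0 < q M M ->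
  0 < 1 - z s M * cycle_gf M (q M) (z s M) ->
  1 + (z s M - 1) * tail_sum s M = expR s / cycle_den s M.
Proof.
move=> M0 N1 qM d0; rewrite /tail_sum /cycle_den; move: d0.
rewrite cycle_gfE ?q0// zM//.
move: (tail_gf _ _ _) => t; move: (z s M) (expR s) (q M M) qM => x e u u0 d0.
by field; rewrite !gt_eqF.
Qed.

Lemma tail_sum_cvg s : s != 0 -> G rho s < 1 ->
  tail_sum s M / M%:R @[M --> \oo] --> (expR s * phi rho s - 1) / s.
Proof.
move=> s0 G1.
have h : (expR s / cycle_den s M - 1) / (M%:R * (z s M - 1)) @[M --> \oo] --> (expR s * phi rho s - 1) / s.
  apply: cvgM; last by apply: cvgV => //; exact: Mz_cvg.
  apply: cvgB; last exact: cvg_cst.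
  apply: cvgMr; apply: cvgV; last exact: cycle_den_cvg.
  by rewrite gt_eqF// subr_gt0.
apply: cvg_trans h; apply: near_eq_cvg; near=> M.
have [M0 N1 qM] : [/\ (0 < M)%N, (1 < N M)%N & 0 < q M M].
  by near: M; exact: walk_surv_gt0_near.
have d0 : 0 < 1 - z s M * cycle_gf M (q M) (z s M) by near: M; exact: cycle_den_gt0.
rewrite -tail_sum_mgf// addrAC subrr add0r.
have z1 : z s M - 1 != 0.
  apply/eqP => /subr0_eq h; have /eqP : s / M%:R = 0 by apply: expR_inj; rewrite expR0.
  by rewrite mulf_eq0 (negbTE s0) invr_eq0 pnatr_eq0; lia.
have Mn0 : M%:R != 0 :> R by rewrite pnatr_eq0; lia.
by move: (tail_sum s M) (z s M - 1) z1 => t u u0; field; rewrite Mn0.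
Unshelve. all: by end_near. Qed.

(** At s = 0 the quotient used in [tail_sum_cvg] is 0/0. Directly, 1 - [cycle_gf] = q(M), and the
    mean is ([tail_gf] + 1 - q(M)) / q(M). *)
Lemma tail_sum0_cvg : tail_sum 0 M / M%:R @[M --> \oo] --> 1 + mu rho.
Proof.
have h : tail_gf M (q M) (z 0 M) / (M%:R * q M M) +
    ((N M)%:R / M%:R) / ((N M)%:R * q M M) - M%:R^-1 @[M --> \oo] -->
    cycle_integral rho 0 / H rho + 0 / (4 * H rho) - 0.
  apply: cvgB; last exact: cvg_natV.
  apply: cvgD; first exact: tail_cvg.
  by apply: cvgM => //; apply: cvgV => //; rewrite mulf_neq0// gt_eqF// H_gt0.
have -> : 1 + mu rho = cycle_integral rho 0 / H rho + 0 / (4 * H rho) - 0.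
  rewrite mul0r addr0 subr0.
  have -> : cycle_integral rho 0 = \int[lebesgue_measure]_(v in `]0, 1]) H (rho * v).
    by apply: eq_Rintegral => v _; rewrite mul0r expR0 mul1r.
  rewrite Rintegral_Hscale// /mu invfM.
  by move: (Rintegral _ _ _) => I; field; rewrite !gt_eqF// H_gt0.
apply: cvg_trans h; apply: near_eq_cvg; near=> M.
have [M0 N1 qM] : [/\ (0 < M)%N, (1 < N M)%N & 0 < q M M].
  by near: M; exact: walk_surv_gt0_near.
have z1 : z 0 M = 1 by rewrite /z mul0r expR0.
rewrite /tail_sum cycle_gfE ?q0// z1 expr1n.
move: (tail_gf _ _ _) => t.
have N0 : (N M)%:R != 0 :> R by rewrite pnatr_eq0; lia.
have Mn0 : M%:R != 0 :> R by rewrite pnatr_eq0; lia.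
have qn0 : q M M != 0 by rewrite gt_eqF.
move: ((N M)%:R : R) (M%:R : R) (q M M) qn0 N0 Mn0 => a b c c0 a0 b0.
have -> : 1 - 1 * (1 + (1 - 1) * t - c * 1) = c by ring.
by field; rewrite a0 b0 c0.
Unshelve. all: by end_near. Qed.

(** The mass P(lambda = k), where [refill] supplies the value 1 of the tail before time 0. By
    summation by parts [e M j] is E exp(-j lambda / M). *)
Let g M k : R := refill (T M) k - T M k.
Let e M j : R := 1 + (z (- j%:R) M - 1) * tail_sum (- j%:R) M.

Lemma fc_cdf_lattice M x : fc_cdf (N M) M x = lattice_cdf M (g M) x.
Proof.
rewrite /fc_cdf /lattice_cdf; case: ifP => // _.
elim: (Num.truncn _) => [|n IH]; first by rewrite big_ord1.
by rewrite big_ord_recr/= -IH /g /T /=; ring.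
Qed.

Lemma cycle_gf_lt1 M s : (1 < N M)%N -> 0 < q M M -> s <= 0 ->
  0 < 1 - z s M * cycle_gf M (q M) (z s M).
Proof.
move=> N1 qM s0; have z0 := expR_gt0 (s / M%:R); rewrite -/(z s M) in z0.
have z1 : z s M <= 1 by rewrite expR_le1 mulr_le0_ge0 ?invr_ge0.
have c0 : 0 <= cycle_gf M (q M) (z s M).
  by apply: sumr_ge0 => m _; rewrite mulr_ge0 ?subr_ge0 ?walk_surv_ni// exprn_ge0// ltW.
have c1 : cycle_gf M (q M) (z s M) <= 1 - q M M.
  have := @cycle_gfE R M (q M) 1 (q0 N1); rewrite subrr mul0r addr0 expr1n mulr1 => <-.
  apply: ler_sum => m _; rewrite ler_wpM2l ?subr_ge0 ?walk_surv_ni//.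
  by rewrite expr1n exprn_ile1// ltW.
have : z s M * cycle_gf M (q M) (z s M) <= cycle_gf M (q M) (z s M) by rewrite ler_piMl.
lra.
Qed.

Lemma fc_lattice_law : \forall M \near \oo, lattice_law M (g M) (e M).
Proof.
apply: filterS walk_surv_gt0_near => M [M0 N1 qM]; split.
- move=> [|k]; rewrite /g /T /= subr_ge0; last exact: fc_surv_ni.
  by have /andP[] := @fc_surv_itv R (N M) M 0 1 M.
- by rewrite /e /z oppr0 mul0r expR0 subrr mul0r addr0.
- move=> j; have d0 : 0 < 1 - z (- j%:R) M * cycle_gf M (q M) (z (- j%:R) M).
    by apply: cycle_gf_lt1 => //; rewrite oppr_le0.
  have hT := fc_tail_sum_cvg N1 d0.
  set x := z (- j%:R) M in hT *.
  have hb : \sum_(n < K) refill (T M) n * x ^+ n @[K --> \oo] --> 1 + x * tail_sum (- j%:R) M.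
    rewrite -(cvg_shiftS (fun K => \sum_(n < K) _)) /=.
    under eq_fun do rewrite bsumS.
    by apply: cvgD; [exact: cvg_cst|apply: cvgMr].
  rewrite /e -/x (_ : 1 + _ * _ = 1 + x * tail_sum (- j%:R) M - tail_sum (- j%:R) M); last by ring.
  suff -> : (fun L => \sum_(k < L) g M k * expR (- (j%:R * (k%:R / M%:R)))) =
      (fun K => \sum_(n < K) refill (T M) n * x ^+ n - \sum_(n < K) T M n * x ^+ n).
    exact: cvgB.
  apply/funext => K; rewrite -sumrB; apply: eq_bigr => k _; rewrite /g mulrBl.
  by rewrite -mulrBl -mulrBl /x /z -expRM_natl; congr (_ * expR _); ring.
Qed.

Lemma fc_moment_cvg j : G rho (- j%:R) < 1 ->
  e M j @[M --> \oo] --> expR (- j%:R) * phi rho (- j%:R).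
Proof.
move=> G1.
have h : expR (- j%:R) / cycle_den (- j%:R) M @[M --> \oo] --> expR (- j%:R) * phi rho (- j%:R).
  by apply: cvgMr; apply: cvgV; [rewrite gt_eqF// subr_gt0|exact: cycle_den_cvg].
apply: cvg_trans h; apply: near_eq_cvg; near=> M.
have [M0 N1 qM] : [/\ (0 < M)%N, (1 < N M)%N & 0 < q M M].
  by near: M; exact: walk_surv_gt0_near.
by rewrite /e tail_sum_mgf//; apply: cycle_gf_lt1 => //; rewrite oppr_le0.
Unshelve. all: by end_near. Qed.

End generating_functions.

(** * Exponential moments of the limit *)

Section exponential_moments.
Context {R : realType} (d : measure_display) (T : measurableType d) (P : probability T R).
Implicit Types s : R.
Let leb : {measure set _ -> \bar R} := @lebesgue_measure R.

(** The integral of exp(s y) over [0, x]. Keeping s = 0 lets the mean and the exponential moments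
    come from one Tonelli identity. *)
Definition exp_primitive s (x : R) : R := if s == 0 then x else (expR (s * x) - 1) / s.

Lemma integral_exp_primitive s x : 0 <= x ->
  (\int[leb]_(y in `[0%R, x[%classic) (expR (s * y))%:E)%E = (exp_primitive s x)%:E.
Proof.
rewrite le_eqVlt => /predU1P[<-|x0].
  rewrite set_itvco0 integral_set0 /exp_primitive mulr0 expR0 subrr mul0r.
  by case: eqP.
rewrite integral_itv_bndo_bndc; last by apply/measurable_EFinP; exact: measurable_exp_scale.
rewrite /exp_primitive; case: eqVneq => [->|s0]; last exact: integral_exp.
under eq_integral do rewrite mul0r expR0.
by rewrite integral_cst//= mul1e /leb lebesgue_measure_itv/= lte_fin x0 sube0.
Qed.

Lemma integral_exp_tail (X : {RV P >-> R}) s : (forall w, 0 <= X w) ->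
  (\int[leb]_(x in `[0%R, +oo[%classic) ((expR (s * x))%:E * P [set w | (x < X w)%R]))%E =
  (\int[P]_w (exp_primitive s (X w))%:E)%E.
Proof.
move=> X0; pose GR := measurableTypeR R.
pose k (w : T) (x : R) : R := expR (s * x) * \1_(`[0, X w[%classic : set R) x.
transitivity (\int[P]_w \int[leb]_x (k w x)%:E)%E; last first.
  apply: eq_integral => w _; rewrite -integral_exp_primitive//.
  rewrite [RHS]integral_mkcond; apply: eq_integral => x _.
  rewrite /k patchE indicE; case: ifP => _; [by rewrite mulr1|by rewrite mulr0].
have mX : measurable_fun setT X by exact: measurable_funPT.
have mlt x : measurable [set w | x < X w].
  have : measurable_fun setT (fun w => x < X w) by apply: measurable_fun_ltr.
  by move=> /(_ measurableT [set true]); rewrite setTI; exact.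
rewrite (fubini_tonelli (fun p : T * GR => (k p.1 p.2)%:E))//=; last 2 first.
- apply/measurable_EFinP; apply: measurable_funM.
    by apply: measurableT_comp; [exact: measurable_expR|apply: measurable_funM].
  pose fsnd (p : T * GR) := (0 <= p.2)%R.
  pose f21 (p : T * GR) := (p.2 < X p.1)%R.
  have -> : (fun p : T * GR => \1_(`[0, X p.1[%classic : set R) p.2 : R) =
      (\1_(fsnd @^-1` [set true] `&` f21 @^-1` [set true])).
    apply/funext => p; rewrite !indicE; congr (nat_of_bool _)%:R.
    apply/idP/idP; rewrite !inE/= in_itv/=; first by move=> /andP.
    by move=> [] h1 h2; apply/andP.
  apply: measurable_indic; apply: measurableI.
  - have : measurable_fun setT fsnd by exact: measurable_fun_ler.
    by move=> /(_ measurableT [set true]); rewrite setTI; exact.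
  - have : measurable_fun setT f21.
      by apply: measurable_fun_ltr => //; exact: (measurableT_comp mX).
    by move=> /(_ measurableT [set true]); rewrite setTI; exact.
- by move=> p; rewrite lee_fin mulr_ge0 ?expR_ge0.
rewrite [LHS]integral_mkcond; apply: eq_integral => x _; rewrite patchE.
case: ifPn => [|/negP]; rewrite inE/= in_itv/= andbT => x0.
  transitivity (\int[P]_w ((expR (s * x))%:E * (\1_[set w | x < X w] w)%:E))%E.
    rewrite ge0_integralZl//; last by apply/measurable_EFinP; exact: measurable_indic.
    by rewrite integral_indic// setIT.
  apply: eq_integral => w _; rewrite -EFinM /k !indicE; congr (_ * _%:R)%:E.
  by congr nat_of_bool; apply/idP/idP; rewrite !inE/= in_itv/= x0.
apply/esym/integral0_eq => w _; rewrite /k indicE memNset ?mulr0//= in_itv/=.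
by case/andP.
Qed.

Lemma exp_primitive_ge0 s x : 0 <= x -> 0 <= exp_primitive s x.
Proof.
move=> x0; rewrite -lee_fin -integral_exp_primitive//.
by apply: integral_ge0 => y _; rewrite lee_fin expR_ge0.
Qed.

Lemma measurable_exp_primitive s : measurable_fun setT (exp_primitive s).
Proof.
rewrite /exp_primitive; case: eqP => _; first exact: measurable_id.
by apply: measurable_funM => //; apply: measurable_funB => //; exact: measurable_exp_scale.
Qed.

Let integral_const c : (\int[P]_w c%:E = c%:E)%E.
Proof.
rewrite (integral_cst P (@measurableT _ T) c%:E) -[RHS]mule1.
by congr (_ * _)%E; exact: probability_setT.
Qed.

Lemma integrable_exp_primitive (X : {RV P >-> R}) s L : (forall w, 0 <= X w) ->
  (\int[leb]_(x in `[0%R, +oo[%classic) ((expR (s * x))%:E * P [set w | (x < X w)%R]) = L%:E)%E ->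
  P.-integrable setT (fun w => (exp_primitive s (X w))%:E) /\
  (\int[P]_w (exp_primitive s (X w))%:E = L%:E)%E.
Proof.
move=> X0; rewrite integral_exp_tail// => hL; split=> //; apply/integrableP; split.
  apply/measurable_EFinP; apply: measurableT_comp; first exact: measurable_exp_primitive.
  exact: measurable_funPT.
under eq_integral do rewrite gee0_abs ?lee_fin ?exp_primitive_ge0//.
by rewrite hL ltry.
Qed.

Lemma mmt_gen_fun_shift (X : {RV P >-> R}) (Y : T -> R) s L :
  s != 0 -> (forall w, 0 <= X w) -> (forall w, Y w = X w - 1) ->
  (\int[leb]_(x in `[0%R, +oo[%classic) ((expR (s * x))%:E * P [set w | (x < X w)%R]) = L%:E)%E ->
  'M_P Y s = (expR (- s) * (1 + s * L))%:E.
Proof.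
move=> s0 X0 YX /(integrable_exp_primitive X0)[iX eX].
rewrite /mmt_gen_fun unlock.
transitivity (\int[P]_w ((expR (- s))%:E + (expR (- s) * s)%:E * (exp_primitive s (X w))%:E))%E.
  apply: eq_integral => w _; rewrite /= YX -EFinM -EFinD; congr EFin.
  rewrite /exp_primitive (negbTE s0) mulrBl mul1r addrC expRD (mulrC (X w)).
  by move: (expR (- s)) => a; field.
rewrite integralD//; last 2 first.
- exact: finite_measure_integrable_cst.
- exact: integrableZl.
rewrite integralZl// eX integral_const -EFinM -EFinD.
by congr EFin; ring.
Qed.

Lemma expectation_shift (X : {RV P >-> R}) (Y : T -> R) L :
  (forall w, 0 <= X w) -> (forall w, Y w = X w - 1) ->
  (\int[leb]_(x in `[0%R, +oo[%classic) ((expR (0 * x))%:E * P [set w | (x < X w)%R]) = L%:E)%E ->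
  ('E_P[Y] = (L - 1)%:E)%E.
Proof.
move=> X0 YX /(integrable_exp_primitive X0)[iX eX].
rewrite unlock.
transitivity (\int[P]_w ((exp_primitive 0 (X w))%:E - (cst 1%:E) w))%E.
  by apply: eq_integral => w _; rewrite /= YX /exp_primitive eqxx EFinB.
rewrite integralB//; last exact: finite_measure_integrable_cst.
by rewrite eX integral_const EFinB.
Qed.

End exponential_moments.

(** * Growth of [G] in its second argument *)

Section G_growth.
Context {R : realType}.
Implicit Types (rho s : R).
Let leb : {measure set _ -> \bar R} := @lebesgue_measure R.

Let K rho s (v : R) := expR (s * v) * (H (v * rho) - H rho).

Let integrable_K rho s : 0 < rho -> leb.-integrable (`]0, 1]%classic : set R) (fun v => (K rho s v)%:E).
Proof.
move=> rho0.
have h1 := integrable_exp_H s rho0; have h2 := integrableZr _ (H rho) (integrable_exp s).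
apply: (eq_integrable _ _ _ _ (integrableB _ h1 (h2 _))) => //.
move=> v _; rewrite -EFinM -EFinB; congr EFin; rewrite /K.
by rewrite mulrBr (mulrC rho).
Qed.

Let K_ge0 rho s v : 0 < rho -> 0 < v <= 1 -> 0 <= K rho s v.
Proof.
move=> rho0 /andP[v0 v1]; rewrite mulr_ge0 ?expR_ge0// subr_ge0 H_ni//.
  by rewrite mulr_gt0.
by rewrite ler_piMl// ltW.
Qed.

Lemma G_le0 rho s : 0 < rho -> s <= 0 -> G rho s <= 0.
Proof.
move=> rho0 s0; rewrite /G mulr_le0_ge0//.
  by rewrite mulr_le0_ge0// invr_ge0 ltW// H_gt0.
by apply: Rintegral_ge0 => v; rewrite /= in_itv/=; exact: K_ge0.
Qed.

Lemma G_ge0 rho s : 0 < rho -> 0 <= s -> 0 <= G rho s.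
Proof.
move=> rho0 s0; rewrite /G mulr_ge0//.
  by rewrite divr_ge0// ltW// H_gt0.
by apply: Rintegral_ge0 => v; rewrite /= in_itv/=; exact: K_ge0.
Qed.

(** G(rho, s)/s is nondecreasing, because exp(s v) <= exp(t v) is integrated against H(v rho) -
    H(rho) >= 0. *)
Lemma G_le_scale rho s t : 0 < rho -> 0 < t -> 0 <= s <= t -> G rho s <= s / t * G rho t.
Proof.
move=> rho0 t0 /andP[s0 st]; rewrite /G.
rewrite (_ : s / t * _ = s / H rho * \int[leb]_(v in `]0, 1]) K rho t v); last first.
  by rewrite /K; move: (Rintegral _ _ _) => I; field; rewrite !gt_eqF// H_gt0.
rewrite ler_wpM2l ?divr_ge0//; first by rewrite ltW// H_gt0.
apply: le_Rintegral => //; [exact: integrable_K|exact: integrable_K|].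
move=> v; rewrite /= in_itv/= => /andP[v0 v1].
rewrite /K ler_wpM2r//; last by rewrite ler_expR ler_wpM2r// ltW.
rewrite subr_ge0 H_ni//; first by rewrite mulr_gt0.
by rewrite ler_piMl// ltW.
Qed.

Lemma exists_G_lt1 rho : 0 < rho -> exists2 s, 0 < s & G rho s < 1.
Proof.
(* Comparison with t = 1 gives G(s) <= s G(1) = G(1) / (1 + G(1)) < 1. *)
move=> rho0; have g0 := G_ge0 rho0 ler01; pose s := (1 + G rho 1)^-1.
have p0 : 0 < 1 + G rho 1 by lra.
have s0 : 0 < s by rewrite invr_gt0.
exists s => //; apply: (@le_lt_trans _ _ (s / 1 * G rho 1)).
  by apply: G_le_scale => //; rewrite ltW//= invf_le1//; lra.
by rewrite divr1 /s mulrC ltr_pdivrMr// mul1r; lra.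
Qed.

(** The room between [s] and [t] is what makes exp(s x) times an exp(-t x) tail integrable. *)
Lemma lt_s_ rho s : 0 < rho -> (s%:E < s_ rho)%E ->
  exists2 t, s < t /\ 0 < t & G rho t < 1 /\ G rho s < 1.
Proof.
move=> rho0 /ereal_sup_gt[_ [t [t0 tG] <-]]; rewrite lte_fin => st.
exists t => //; split=> //; have [s0|s0] := leP s 0.
  by apply: le_lt_trans (G_le0 rho0 s0) ltr01.
apply: le_lt_trans tG; apply: le_trans (G_le_scale rho0 t0 _) _.
  by rewrite !ltW.
by rewrite ler_piMl//; [apply: G_ge0 => //; exact: ltW|rewrite ler_pdivrMr// mul1r ltW].
Qed.

End G_growth.

(** * Exponential tail bound and limit of the weighted tail integrals *)

Section tail_limit.
Context {R : realType}.
Variables (N : nat -> nat) (rho : R).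
Hypotheses (rho0 : 0 < rho) (N_oo : N M @[M --> \oo] --> \oo).
Hypothesis Nrho : M%:R / (N M)%:R ^+ 2 @[M --> \oo] --> rho.
Implicit Types s t x : R.
Let leb : {measure set _ -> \bar R} := @lebesgue_measure R.

Let T M n : R := fc_tail (N M) M n.
Let z s M : R := expR (s / M%:R).

Let T_itv M n : (1 < N M)%N -> 0 <= T M n <= 1.
Proof. by move=> N1; apply: fc_surv_itv. Qed.

Let T_ni M n : (1 < N M)%N -> T M n.+1 <= T M n.
Proof. by move=> N1; apply: fc_surv_ni. Qed.

Let near_M t : G rho t < 1 -> \forall M \near \oo, [/\ (0 < M)%N, (1 < N M)%N,
  0 < walk_surv (N M) M 1 :> R & 0 < 1 - z t M * cycle_gf M (fun n => walk_surv (N M) n 1) (z t M)].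
Proof.
move=> tG; apply: filterS (filterI (walk_surv_gt0_near rho0 N_oo Nrho) (cycle_den_gt0 rho0 N_oo Nrho tG)).
by move=> M [[]].
Qed.

(** Markov's inequality for u^lambda, written with the tails S n = P(lambda > n). *)
Let tail_le_gf (S : nat -> R) (u : R) n : S 0 <= 1 -> (forall k, S k.+1 <= S k) -> 1 <= u ->
  S n * u ^+ n.+1 <= 1 + (u - 1) * \sum_(k < n.+1) S k * u ^+ k.
Proof.
move=> S1 Sni u1; elim: n => [|n IH]; first by rewrite big_ord1 expr0 expr1; lra.
rewrite big_ord_recr/= mulrDr addrA.
have : S n.+1 * u ^+ n.+1 <= S n * u ^+ n.+1 by rewrite ler_wpM2r// exprn_ge0; lra.
rewrite [u ^+ n.+2]exprS => h.
move: IH h; move: (\sum_(k < _) _) (u ^+ n.+1) (S n.+1) (S n) => a b c e h1 h2; nra.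
Qed.

Let sum_le_tail M t n : (1 < N M)%N ->
  0 < 1 - z t M * cycle_gf M (fun n => walk_surv (N M) n 1) (z t M) ->
  \sum_(k < n) T M k * z t M ^+ k <= tail_sum N t M.
Proof.
move=> N1 d0; have hT := fc_tail_sum_cvg N1 d0; rewrite -(cvg_lim _ hT)//.
apply: (@nondecreasing_cvgn_le _ (fun K => \sum_(k < K) T M k * z t M ^+ k)).
  apply/nondecreasing_seqP => k; rewrite big_ord_recr/= lerDl mulr_ge0//.
    by have /andP[] := T_itv k N1.
  by rewrite exprn_ge0// expR_ge0.
by apply/cvg_ex; exists (tail_sum N t M).
Qed.

Lemma fc_tail_exp_bound t : 0 < t -> G rho t < 1 ->
  exists2 C, 0 < C & \forall M \near \oo, forall x, 0 <= x ->
    fc_tail (N M) M (Num.truncn (x * M%:R)) <= C * expR (- (t * x)).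
Proof.
move=> t0 tG; have g1 : 0 < 1 - G rho t by rewrite subr_gt0.
(* The limit of E exp(t lambda / M), plus 1 so that it exceeds the values for large M. *)
pose C := expR t / (1 - G rho t) + 1.
have C0 : 0 < C by rewrite addr_gt0// divr_gt0// expR_gt0.
exists C => //.
have hC : \forall M \near \oo, expR t / cycle_den N t M < C.
  apply: (@cvgr_lt _ _ _ _ _ (expR t / (1 - G rho t))); last by rewrite ltrDl.
  by apply: cvgMr; apply: cvgV; [rewrite gt_eqF|exact: cycle_den_cvg].
apply: filterS (filterI (near_M tG) hC) => M [[M0 N1 qM d0] dC] x x0.
have Mp : 0 < M%:R :> R by rewrite ltr0n.
set n := Num.truncn _.
have z1 : 1 <= z t M by rewrite /z -[leLHS]expR0 ler_expR divr_ge0// ltW.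
have T01 : T M 0 <= 1 by have /andP[] := T_itv 0 N1.
have h1 := tail_le_gf n T01 (fun k => T_ni k N1) z1.
have h2 : \sum_(k < n.+1) T M k * z t M ^+ k <= tail_sum N t M.
  exact: sum_le_tail.
have h3 : T M n * z t M ^+ n.+1 <= C.
  apply: le_trans h1 _; apply: le_trans (ltW dC).
  have <- : 1 + (z t M - 1) * tail_sum N t M = expR t / cycle_den N t M by exact: tail_sum_mgf.
  by rewrite lerD2l ler_wpM2l// subr_ge0.
rewrite expRN ler_pdivlMr ?expR_gt0//; apply: le_trans h3.
rewrite ler_wpM2l//; first by have /andP[] := T_itv n N1.
rewrite /z -expRM_natl ler_expR mulrA ler_pdivlMr// -mulrA mulrC ler_pM2r//.
by rewrite ltW// truncnS_gt.
Qed.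

Let D : set R := `[0, +oo[%classic.

Let f_ s M (x : R) : R :=
  T M (Num.truncn ((x - 0) * M%:R)) * z s M ^+ Num.truncn ((x - 0) * M%:R).

Let integral_f_ s M : (0 < M)%N -> (1 < N M)%N ->
  0 < 1 - z s M * cycle_gf M (fun n => walk_surv (N M) n 1) (z s M) ->
  (\int[leb]_(x in D) (f_ s M x)%:E)%E = (tail_sum N s M / M%:R)%:E.
Proof.
move=> M0 N1 d0; have Mp : 0 < M%:R :> R by rewrite ltr0n.
rewrite /D (integral_step 0 Mp (c := fun n => T M n * z s M ^+ n)); last first.
  move=> n; rewrite mulr_ge0//; first by have /andP[] := T_itv n N1.
  by rewrite exprn_ge0// expR_ge0.
apply: nneseries_EFin; under eq_fun do rewrite -mulr_suml.
by apply: cvgMl; exact: fc_tail_sum_cvg.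
Qed.

Let trunc_cvg x : 0 <= x -> (Num.truncn (x * M%:R))%:R / M%:R @[M --> \oo] --> x.
Proof.
move=> x0; apply: (@squeeze_cvgr _ _ _ _ (fun M => x - M%:R^-1) (cst x)).
- near=> M; have M0 : 0 < M%:R :> R by rewrite ltr0n; near: M; exists 1%N.
  have /truncn_itv/andP[h1 h2] : 0 <= x * M%:R by rewrite mulr_ge0.
  rewrite /= ler_pdivrMr// h1 andbT ler_pdivlMr// mulrBl mulVf ?gt_eqF// lerBlDr natr1.
  exact: ltW.
- by rewrite -[X in _ --> X]subr0; apply: cvgB; [exact: cvg_cst|exact: cvg_natV].
- exact: cvg_cst.
Unshelve. all: by end_near. Qed.

Let zE s M n : z s M ^+ n = expR (s * (n%:R / M%:R)).
Proof. by rewrite /z -expRM_natl; congr expR; ring. Qed.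

Let z_cvg s x : 0 <= x -> z s M ^+ Num.truncn (x * M%:R) @[M --> \oo] --> expR (s * x).
Proof.
move=> x0; under eq_fun do rewrite zE.
apply: (@continuous_cvg _ _ _ _ _ (fun M : nat => s * ((Num.truncn (x * M%:R))%:R / M%:R)) expR) => //.
  exact: continuous_expR.
by apply: cvgMr; exact: trunc_cvg.
Qed.

Let integrable_exp_neg r : 0 < r -> leb.-integrable D (fun x => (expR (- (r * x)))%:E).
Proof.
move=> r0.
have h : leb.-integrable D (EFin \o exponential_pdf r).
  by apply: (integrableS _ _ _ (integrable_exponential_pdf r0)) => //; exact: measurable_itv.
have h2 := integrableZl _ r^-1 h.
apply: (eq_integrable _ _ _ _ (h2 _)) => //.
- exact: measurable_itv.
- move=> x; rewrite inE /D/= in_itv/= andbT => x0; rewrite /= exponential_pdfE//.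
  by rewrite -EFinM mulrA mulVf ?gt_eqF// mul1r mulNr.
- exact: measurable_itv.
Qed.

(** [tail_sum] / M is the integral of a step function, whose tail factor converges almost
    everywhere; almost everywhere suffices, so atoms of the limit law do no harm. *)
Lemma tail_integral_cvg s t (S : R -> R) : 0 < t -> s < t -> G rho t < 1 -> G rho s < 1 ->
  measurable_fun D S ->
  {ae leb, forall x, D x -> fc_tail (N M) M (Num.truncn (x * M%:R)) @[M --> \oo] --> S x} ->
  ((tail_sum N s M / M%:R)%:E @[M --> \oo] -->
    \int[leb]_(x in D) (expR (s * x) * S x)%:E)%E.
Proof.
move=> t0 st tG sG mS Scvg.
have [C C0 HC] := fc_tail_exp_bound t0 tG.
have [M0 _ HM] := filterI (near_M sG) HC.
have lim : (\int[leb]_(x in D) (f_ s M x)%:E @[M --> \oo] -->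
    \int[leb]_(x in D) (expR (s * x) * S x)%:E)%E.
  (* The factor exp|s| covers the replacement of the truncated time by x, a difference of at most
     1/M <= 1. *)
  apply: (@lebesgue_dominated_cvg R D (f_ s) _
    (fun x => C * expR `|s| * expR (- ((t - s) * x))) M0) => //.
  - exact: measurable_itv.
  - move=> M MM0; have [[Mp _ _ _] _] := HM M MM0.
    by apply: (@measurable_step R 0 M%:R (fun n => T M n * z s M ^+ n)); rewrite ltr0n.
  - by apply: measurable_funM => //; exact: measurable_exp_scale.
  - apply: (eq_integrable _ _ _ _ (integrableZl _ (C * expR `|s|) (integrable_exp_neg _))) => //.
    + exact: measurable_itv.
    + exact: measurable_itv.
    + by rewrite subr_gt0.
  - case: Scvg => B [mB B0 sB]; exists B; split=> // x nh; apply: sB => h; apply: nh => Dx.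
    have x0 : 0 <= x by move: Dx; rewrite /D/= in_itv/= andbT.
    rewrite /f_ subr0 mulrC; apply: cvgM; [exact: h|exact: z_cvg].
  - move=> M x MM0 Dx; have x0 : 0 <= x by move: Dx; rewrite /D/= in_itv/= andbT.
    have [[Mp N1 _ _] hC] := HM M MM0.
    have M1 : 1 <= M%:R :> R by rewrite ler1n.
    rewrite /f_ subr0 ger0_norm; last first.
      rewrite mulr_ge0 ?exprn_ge0 ?expR_ge0//.
      by have /andP[] := T_itv (Num.truncn (x * M%:R)) N1.
    rewrite [leRHS](_ : _ = C * expR (- (t * x)) * expR (`|s| + s * x)); last first.
      rewrite expRD (_ : - ((t - s) * x) = - (t * x) + s * x) ?expRD; last by ring.
      by ring.
    apply: ler_pM.
    + by have /andP[] := T_itv (Num.truncn (x * M%:R)) N1.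
    + by rewrite exprn_ge0// expR_ge0.
    + exact: hC.
    rewrite zE ler_expR -lerBlDr -mulrBr (le_trans (ler_norm _))// normrM.
    rewrite ler_piMr//.
    have /truncn_itv/andP[] : 0 <= x * M%:R by rewrite mulr_ge0.
    set n := Num.truncn _ => h1 h2.
    have -> : n%:R / M%:R - x = - ((x * M%:R - n%:R) / M%:R) :> R.
      by field; rewrite gt_eqF// (lt_le_trans _ M1).
    rewrite normrN ger0_norm ?divr_ge0 ?subr_ge0//.
    rewrite ler_pdivrMr ?mul1r; last exact: lt_le_trans M1.
    by rewrite (le_trans _ M1)// lerBlDr addrC natr1 ltW.
move: lim; apply: cvg_trans; apply: near_eq_cvg.
exists M0 => // M /= /HM[[Mp N1 _ d0] _].
by rewrite integral_f_.
Qed.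

End tail_limit.

(** * A reference sequence and the continuity points of a distribution function *)

Section reference_sides.
Context {R : realType}.
Variable rho : R.
Hypothesis rho0 : 0 < rho.

(** A concrete sequence with M/N^2 -> rho, so that the law of xi is built from rho alone. *)
Definition diffusive_side M : nat := (Num.truncn (Num.sqrt (M%:R / rho))).+1.

Let side_itv M : (diffusive_side M)%:R - 1 <= Num.sqrt (M%:R / rho) <= (diffusive_side M)%:R.
Proof.
have /truncn_itv/andP[h1 h2] : 0 <= Num.sqrt (M%:R / rho) by exact: sqrtr_ge0.
by rewrite /diffusive_side (ltW h2) andbT -natr1 addrK.
Qed.

Lemma diffusive_side_oo : diffusive_side M @[M --> \oo] --> \oo.
Proof.
apply/cvgnyPge => A; near=> M.
have h : A%:R ^+ 2 * rho <= M%:R.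
  by near: M; apply: nbhs_infty_ger; exact: num_real.
rewrite -(ler_nat R); have /andP[_] := side_itv M; apply: le_trans.
by rewrite -(ger0_norm (ler0n R A)) -sqrtr_sqr ler_wsqrtr// ler_pdivlMr.
Unshelve. all: by end_near. Qed.

Lemma diffusive_side_rho : M%:R / (diffusive_side M)%:R ^+ 2 @[M --> \oo] --> rho.
Proof.
have ratio : Num.sqrt (M%:R / rho) / (diffusive_side M)%:R @[M --> \oo] --> (1 : R).
  apply: (@squeeze_cvgr _ _ _ _ (fun M => 1 - (diffusive_side M)%:R^-1) (cst 1)).
  - near=> M; have /andP[h1 h2] := side_itv M.
    have s0 : 0 < (diffusive_side M)%:R :> R by rewrite ltr0n.
    by rewrite ler_pdivrMr// mul1r h2 andbT ler_pdivlMr// mulrBl mul1r mulVf ?gt_eqF.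
  - rewrite -[X in _ --> X]subr0; apply: cvgB; first exact: cvg_cst.
    apply/gtr0_cvgV0; last by apply: (cvg_comp _ _ diffusive_side_oo); exact: cvgr_idn.
    by apply: nearW => k; rewrite ltr0n.
  - exact: cvg_cst.
have h : rho * (Num.sqrt (M%:R / rho) / (diffusive_side M)%:R) ^+ 2 @[M --> \oo] --> rho * (1 * 1).
  by apply: cvgMr; under eq_fun do rewrite expr2; exact: cvgM.
rewrite !mulr1 in h; apply: cvg_trans h; apply: near_eq_cvg; apply: nearW => M.
rewrite expr_div_n sqr_sqrtr ?divr_ge0 ?(ltW rho0)//.
by rewrite mulrA (mulrC rho) divfK// gt_eqF.
Unshelve. all: by end_near. Qed.

End reference_sides.

Section cdf_jumps.
Context {R : realType} (d : measure_display) (T : measurableType d) (P : probability T R).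
Let leb : {measure set _ -> \bar R} := @lebesgue_measure R.
Variables (X : {RV P >-> R}) (F : R -> R).
Hypothesis XF : forall x, P [set w | X w <= x] = (F x)%:E.

Lemma measurable_rv_le x : measurable [set w | X w <= x].
Proof.
have mX : measurable_fun setT X by exact: measurable_funPT.
have : measurable_fun setT (fun w => X w <= x) by apply: measurable_fun_ler.
by move=> /(_ measurableT [set true]); rewrite setTI; exact.
Qed.

Let mX (B : set R) : measurable B -> measurable (X @^-1` B).
Proof.
have mX : measurable_fun setT X by exact: measurable_funPT.
by move=> mB; rewrite -[X in measurable X]setTI; exact: mX.
Qed.

(** The intervals from x - 1/(n+1) to x shrink to {x}, so their probabilities tend to the mass of x,
    which is 0. *)
Lemma cdf_left_approx x : pmf X x = 0 -> forall eps, 0 < eps ->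
  exists2 y, y < x & F x - eps <= F y.
Proof.
move=> px eps eps0.
pose A n := X @^-1` `]x - n.+1%:R^-1, x]%classic.
have mA n : measurable (A n) by apply: mX; exact: measurable_itv.
have IA : \bigcap_n A n = X @^-1` [set x].
  apply/seteqP; split=> w /= h; last first.
    by move=> n _; rewrite /A/= h in_itv/= lexx andbT ltrBlDr ltrDl invr_gt0.
  apply/eqP; rewrite eq_le; apply/andP; split.
    by have := h 0 I; rewrite /A/= in_itv/= => /andP[].
  rewrite leNgt; apply/negP => Xx.
  have /ltr_add_invr[k] := Xx; rewrite -ltrBrDr => hk.
  have := h k I; rewrite /A/= in_itv/= => /andP[h1 _].
  by have := lt_trans hk h1; rewrite ltxx.
have PA : (P \o A) n @[n --> \oo] --> (0 : R)%:E.
  have -> : (0 : R)%:E = P (\bigcap_n A n).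
    rewrite IA; move: px; rewrite /pmf => px.
    by rewrite -[RHS]fineK ?fin_num_measure// px.
  apply: nonincreasing_cvg_mu => //.
  - by apply: (le_lt_trans (probability_le1 _ _)) => //; exact: ltry.
  - exact: bigcap_measurable.
  - move=> n m nm; apply/subsetPset => w; rewrite /A/= !in_itv/= => /andP[h1 ->].
    by rewrite andbT (le_lt_trans _ h1)// lerB// lef_pV2 ?posrE// ler_nat.
have /fine_cvg/cvgrPdist_le/(_ eps eps0)[n _ /(_ n (leqnn n))] := PA.
rewrite /= sub0r normrN ger0_norm ?fine_ge0// => hn.
exists (x - n.+1%:R^-1); first by rewrite ltrBlDr ltrDl invr_gt0.
rewrite lerBlDr -lee_fin EFinD -!XF.
have -> : [set w | X w <= x] = [set w | X w <= x - n.+1%:R^-1] `|` A n.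
  apply/seteqP; split=> w /=; rewrite /A/= in_itv/=.
    by move=> ->; rewrite andbT; case: leP => _; [left|right].
  by case=> [/le_trans|/andP[]//]; apply; rewrite lerBlDr lerDl invr_ge0.
apply: (le_trans (measureU2 _ (measurable_rv_le _) (mA n))); apply: leeD => //.
by rewrite -[leLHS]fineK ?fin_num_measure// lee_fin.
Qed.

(** A law has countably many atoms, and a countable set is Lebesgue-null. *)
Lemma ae_pmf0 (Q : R -> Prop) : (forall x, pmf X x = 0 -> Q x) -> {ae leb, forall x, Q x}.
Proof.
move=> h; exists [set r | 0 < pmf X r]; split.
- exact/countable_measurable/pmf_gt0_countable.
- exact/countable_lebesgue_measure0/pmf_gt0_countable.
- move=> x /= nQ; rewrite lt_neqAle pmf_ge0 andbT eq_sym; apply/eqP => /h.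
  exact: nQ.
Qed.

End cdf_jumps.

(** * The limit variable and its Laplace transform *)

Section limit_variable.
Context {R : realType}.
Variable rho : R.
Hypothesis rho0 : 0 < rho.
Let leb : {measure set _ -> \bar R} := @lebesgue_measure R.
Let N0 := diffusive_side rho.
Let N0_oo : N0 M @[M --> \oo] --> \oo .
Proof. exact: diffusive_side_oo. Qed.
Let N0_rho : M%:R / (N0 M)%:R ^+ 2 @[M --> \oo] --> rho .
Proof. exact: diffusive_side_rho. Qed.

(** The value of the integral over x >= 0 of exp(s x) P(X > x), with X the limit of lambda / M; at s
    = 0 it is the mean of X. *)
Definition tail_laplace (s : R) : R :=
  if s == 0 then 1 + mu rho else (expR s * phi rho s - 1) / s.

Lemma tail_laplace_cvg s : G rho s < 1 ->
  tail_sum N0 s M / M%:R @[M --> \oo] --> tail_laplace s.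
Proof.
rewrite /tail_laplace; case: eqVneq => [-> _|s0 sG].
  exact: tail_sum0_cvg.
exact: tail_sum_cvg.
Qed.

Let G_neg j : G rho (- j%:R) < 1.
Proof. by apply: le_lt_trans ltr01; apply: G_le0 => //; rewrite oppr_le0. Qed.

Let fc_cdf_tight (eps : R) : 0 < eps ->
  exists x, \forall M \near \oo, 1 - eps <= fc_cdf (N0 M) M x.
Proof.
move=> eps0; have [t t0 tG] := exists_G_lt1 rho0.
have [C C0 HC] := fc_tail_exp_bound rho0 N0_oo N0_rho t0 tG.
(* At this point the tail bound is C exp(-C/eps), at most eps since exp(-a) <= 1/a. *)
have x0 : 0 < C / (t * eps) by rewrite divr_gt0// mulr_gt0.
exists (C / (t * eps)); apply: filterS HC => M /(_ _ (ltW x0)) h.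
rewrite /fc_cdf ltNge (ltW x0)/= lerD2l lerN2; apply: le_trans h _.
have e1 : t * (C / (t * eps)) = C / eps by field; rewrite !gt_eqF.
rewrite e1 -ler_pdivlMl//; have Ce : 0 < C / eps by rewrite divr_gt0.
by apply: le_trans (expR_le_inv Ce) _; rewrite invf_div mulrC.
Qed.

(** [X] and [F] come from the reference sequence, while the last clause holds for every admissible
    [N], because the limit moments depend on rho only. *)
Lemma exists_limit_variable : exists (d' : measure_display) (T' : measurableType d')
    (P' : probability T' R) (X : {RV P' >-> R}) (F : R -> R),
  [/\ forall w, 0 <= X w, forall x, P' [set w | X w <= x] = (F x)%:E,
      forall s t : R, 0 < t -> s < t -> G rho t < 1 -> G rho s < 1 ->
        (\int[leb]_(x in `[0%R, +oo[%classic) ((expR (s * x))%:E * P' [set w | (x < X w)%R]) =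
         (tail_laplace s)%:E)%E &
      forall N : nat -> nat, N M @[M --> \oo] --> \oo ->
        M%:R / (N M)%:R ^+ 2 @[M --> \oo] --> rho ->
        forall x, (forall eps : R, 0 < eps -> exists2 y, y < x & F x - eps <= F y) ->
        fc_cdf (N M) M x @[M --> \oo] --> F x].
Proof.
pose g0 M k : R := refill (fc_tail (N0 M) M) k - fc_tail (N0 M) M k.
pose e0 M j : R := 1 + (expR (- j%:R / M%:R) - 1) * tail_sum N0 (- j%:R) M.
have law0 : \forall M \near \oo, lattice_law M (g0 M) (e0 M).
  exact: (fc_lattice_law rho0 N0_oo N0_rho).
have mom0 j : e0 M j @[M --> \oo] --> expR (- j%:R) * phi rho (- j%:R).
  exact: (fc_moment_cvg rho0 N0_oo N0_rho (G_neg j)).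
have tight0 (eps : R) : 0 < eps -> exists x, \forall M \near \oo, 1 - eps <= lattice_cdf M (g0 M) x.
  move=> /fc_cdf_tight[x hx]; exists x; apply: filterS hx => M.
  by rewrite (fc_cdf_lattice N0 M x).
pose F := limit_cdf g0.
have nd : nondecreasing F by exact: (limit_cdf_nd law0).
have rc : right_continuous F by exact: (limit_cdf_rc law0).
have FNy : F x @[x --> -oo] --> (0 : R) by exact: (limit_cdf_Ny law0).
have Fy : F x @[x --> +oo] --> (1 : R) by exact: (limit_cdf_y law0 mom0 tight0).
have F0 x : x < 0 -> F x = 0 by exact: (limit_cdf_lt0 law0).
have [d' [T' [P' [X [X0 XF]]]]] := exists_rv_of_cdf nd rc FNy Fy F0.
have cvgF (N : nat -> nat) : N M @[M --> \oo] --> \oo ->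
    M%:R / (N M)%:R ^+ 2 @[M --> \oo] --> rho ->
    forall x, (forall eps : R, 0 < eps -> exists2 y, y < x & F x - eps <= F y) ->
    fc_cdf (N M) M x @[M --> \oo] --> F x.
  move=> N_oo Nrho x xF.
  have := lattice_cdf_cvg law0 mom0 (fc_lattice_law rho0 N_oo Nrho)
    (fun j => fc_moment_cvg rho0 N_oo Nrho (G_neg j)) xF.
  apply: cvg_trans; apply: near_eq_cvg; apply: nearW => M.
  by rewrite (fc_cdf_lattice N M x).
exists d', T', P', X, F; split=> // s t t0 st tG sG.
have mF : measurable_fun setT F by exact: nondecreasing_measurable.
have PX x : P' [set w | x < X w] = (1 - F x)%:E.
  rewrite EFinB -XF -probability_setC; last exact: measurable_rv_le.
  congr (P' _); apply/seteqP; split=> w /=; first by rewrite ltNge => /negP.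
  by move/negP; rewrite -ltNge.
have h := @tail_integral_cvg R N0 rho rho0 N0_oo N0_rho s t (fun x => 1 - F x) t0 st tG sG.
have {}h : ((tail_sum N0 s M / M%:R)%:E @[M --> \oo] -->
    \int[leb]_(x in `[0%R, +oo[%classic) (expR (s * x) * (1 - F x))%:E)%E.
  apply: h; first by apply: measurable_funB => //; exact: measurable_funTS.
  apply: (ae_pmf0 (X := X)) => x px; rewrite /= in_itv/= andbT => x0.
  have c := cvgF _ N0_oo N0_rho x (cdf_left_approx XF px).
  have {}c : 1 - fc_cdf (N0 M) M x @[M --> \oo] --> 1 - F x by apply: cvgB => //; exact: cvg_cst.
  apply: cvg_trans c; apply: near_eq_cvg; apply: nearW => M.
  by rewrite /fc_cdf ltNge x0/= opprB addrC subrK.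
under eq_integral do rewrite PX -EFinM.
(* The same sequence converges to the tail integral and to the closed form, so the two agree. *)
have c2 : ((tail_sum N0 s M / M%:R)%:E @[M --> \oo] --> (tail_laplace s)%:E)%E.
  by apply: cvg_EFin; [exact: nearW|exact: tail_laplace_cvg].
exact: cvg_unique h c2.
Qed.

End limit_variable.

(** * Asymptotics of the mean *)

Section odd_basel.
Context {R : realType}.

Let sum_fold (F : nat -> R) n : (forall j, (j < n + n)%N -> F (n + n - j.+1)%N = F j) ->
  \sum_(j < n + n) F j = 2 * \sum_(j < n) F j.
Proof.
move=> FE; rewrite big_split_ord/= mulrDl mul1r; congr (_ + _).
rewrite (reindex_inj rev_ord_inj)/=; apply: eq_bigr => j _.
have jn := ltn_ord j; rewrite -(FE j); last lia.
by congr F; lia.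
Qed.

Let half_sum n : (0 < n)%N ->
  \sum_(j < n) (sin (@theta R (n + n) j / 2) ^- 2) = 2 * n%:R ^+ 2.
Proof.
move=> n0; have N1 : (1 < n + n)%N by lia.
have := @sum_inv_sin2 R _ N1.
rewrite (sum_fold (F := fun j => sin (@theta R (n + n) j / 2) ^- 2)).
  rewrite natrD; move: (\sum_(j < n) _) (n%:R : R) => a b; lra.
move=> j jn; rewrite theta_rev//; congr (_ ^- 2).
have -> : (pi *+ 2 - @theta R (n + n) j) / 2 = pi - @theta R (n + n) j / 2.
  by rewrite -mulr_natr; field.
by rewrite sinB sinpi cospi mul0r sub0r mulN1r opprK.
Qed.

(** Equivalent to cot^2 x <= 1/x^2 <= 1/sin^2 x, the squeeze in Cauchy's proof of the Basel
    identity. *)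
Let inv_sin2_itv (x : R) : 0 < x <= pi / 2 -> x ^- 2 <= sin x ^- 2 <= 1 + x ^- 2.
Proof.
move=> /andP[x0 xp]; have s0 : 0 < sin x by rewrite sin_gt0_pi// x0/=; have := @pi_gt0 R; lra.
apply/andP; split.
  by rewrite lef_pV2 ?posrE ?exprn_gt0// ler_sqr ?nnegrE ?(ltW s0) ?(ltW x0)// sin_le_id// ltW.
have xc : x * cos x <= sin x by rewrite mul_cos_le_sin// ltW.
have c0 : 0 <= cos x.
  by apply: cos_ge0_pihalf; rewrite xp (le_trans _ (ltW x0))// oppr_le0 divr_ge0// pi_ge0.
have h : (x * cos x) ^+ 2 <= sin x ^+ 2.
  by rewrite ler_sqr ?nnegrE ?(ltW s0) ?mulr_ge0// ltW.
have cE : cos x ^+ 2 = 1 - sin x ^+ 2 by rewrite -[X in X - _](cos2Dsin2 x) addrK.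
rewrite exprMn cE in h.
rewrite -lerBlDl -subr_ge0.
rewrite (_ : _ - _ = (sin x ^+ 2 - x ^+ 2 * (1 - sin x ^+ 2)) / (x ^+ 2 * sin x ^+ 2)).
  by apply: divr_ge0; [rewrite subr_ge0|rewrite mulr_ge0 ?sqr_ge0].
by move: (sin x) s0 => s s0; field; rewrite !gt_eqF.
Qed.

(** The value 1/4 encodes the sum pi^2/8 of the odd inverse squares. For a walk of side 2n the
    half-angles satisfy x^-2 = 8 n^2 / [rate j], and the n errors of at most 1 weigh n/(8 n^2) =
    1/(8n). *)
Lemma sum_inv_rate_cvg : \sum_(j < n) (@rate R j)^-1 @[n --> \oo] --> (4^-1 : R).
Proof.
apply: (@squeeze_cvgr _ _ _ _ (fun n => 4^-1 - n%:R^-1 * 8^-1) (cst 4^-1)).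
- exists 1%N => // n /= n0; have np : 0 < n%:R :> R by rewrite ltr0n.
  have hs := half_sum n0.
  have xE (j : 'I_n) : (@theta R (n + n) j / 2) ^- 2 = 8 * n%:R ^+ 2 * (@rate R j)^-1.
    rewrite expr_div_n theta_sq natrD.
    have := @rate_gt0 R j; move: (rate j) (n%:R : R) np => a b b0 a0.
    by field; rewrite !gt_eqF//; lra.
  have b j : (j < n)%N -> 8 * n%:R ^+ 2 * (@rate R j)^-1 <= sin (@theta R (n + n) j / 2) ^- 2
      <= 1 + 8 * n%:R ^+ 2 * (@rate R j)^-1.
    move=> jn; rewrite -(xE (Ordinal jn))/=; apply: inv_sin2_itv.
    have /andP[h1 _] := @theta_half_itv R (n + n) j ltac:(lia).
    by rewrite h1 ler_pM2r//; have /andP[] := @theta_lt_pi R (n + n) j ltac:(lia).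
  have h1 : 8 * n%:R ^+ 2 * \sum_(j < n) (@rate R j)^-1 <= 2 * n%:R ^+ 2.
    by rewrite -hs mulr_sumr; apply: ler_sum => j _; have /andP[] := b j (ltn_ord j).
  have h2 : 2 * n%:R ^+ 2 <= n%:R + 8 * n%:R ^+ 2 * \sum_(j < n) (@rate R j)^-1.
    have nE : \sum_(j < n) (1 : R) = n%:R by rewrite sumr_const card_ord.
    rewrite -hs -[X in X + _]nE mulr_sumr -big_split/=.
    by apply: ler_sum => j _; have /andP[] := b j (ltn_ord j).
  move: h1 h2; move: (\sum_(j < n) _) (n%:R : R) np => S a a0 h1 h2.
  apply/andP; split.
    rewrite lerBlDl -(ler_pM2l (x := 8 * a ^+ 2)) ?mulr_gt0 ?exprn_gt0// mulrDr.
    rewrite (_ : 8 * a ^+ 2 * (a^-1 * 8^-1) = a); last by field; rewrite gt_eqF.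
    rewrite (_ : 8 * a ^+ 2 / 4 = 2 * a ^+ 2)//; by field.
  rewrite -(ler_pM2l (x := 8 * a ^+ 2)) ?mulr_gt0 ?exprn_gt0//.
  by rewrite (_ : 8 * a ^+ 2 / 4 = 2 * a ^+ 2)//; field.
- rewrite -[X in _ --> X]subr0; apply: cvgB; first exact: cvg_cst.
  by rewrite -[X in _ --> X](mul0r 8^-1); apply: cvgMl; exact: cvg_natV.
- exact: cvg_cst.
Qed.

End odd_basel.

Section mean_asymptotics.
Context {R : realType}.
Implicit Types r : R.
Let leb : {measure set _ -> \bar R} := @lebesgue_measure R.

(** The first term of the series dominates: [rate j.+1] >= [rate j] + [rate 0], so the remaining
    terms are at most exp(- [rate 0] r) times a sum bounded by 2/r. *)
Lemma H_exp_itv r : 0 < r -> 1 <= H r * expR (rate 0 * r) <= 1 + 2 / r.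
Proof.
move=> r0; apply/andP; split.
  have := H_ge_partial 1 r0; rewrite big_ord1 => h.
  by apply: le_trans (ler_wpM2r (expR_ge0 _) h); rewrite -expRD addNr expR0.
rewrite -ler_pdivlMr ?expR_gt0// -expRN.
apply: (ler_cvg_to (H_cvg r0) (cvg_cst _)); near=> n.
have n0 : (0 < n)%N by near: n; exists 1%N.
rewrite -(prednK n0) big_ord_recl/= mulrDl mul1r lerD2l.
apply: (@le_trans _ _ ((\sum_(j < n.-1) expR (- (rate j * r))) * expR (- (rate 0 * r)))).
  rewrite mulr_suml; apply: ler_sum => j _; rewrite -expRD ler_expR /bump/= add1n.
  rewrite -opprD lerN2 -mulrDl ler_pM2r// /rate -(natr1 j).
  have p0 : 0 <= pi ^+ 2 :> R by exact: sqr_ge0.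
  have j0 : 0 <= j%:R :> R by rewrite ler0n.
  rewrite mulr0 add0r expr1n mulr1 -mulrDl ler_pM2r// -[X in _ + X]mulr1 -mulrDr ler_wpM2l//.
  by move: (j%:R : R) j0 => x x0; nra.
by rewrite ler_wpM2r ?expR_ge0// theta_sum_le.
Unshelve. all: by end_near. Qed.

(** Termwise, the integral is the sum of (1 - exp(- [rate j] r)) / [rate j]; the sum of 1/[rate j]
    is 1/4, and [rate j] >= 1 bounds the defect by the theta sum. *)
Lemma integral_H_itv r : 0 < r ->
  4^-1 - 2 / r <= \int[leb]_(y in `]0, r]) H y <= 4^-1.
Proof.
move=> r0; have [U hU e] := @integral_Hscale R 1 r ltr01 r0.
have -> : \int[leb]_(y in `]0, r]) H y = U.
  rewrite /Rintegral -[RHS]/(fine U%:E); congr fine.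
  rewrite -[U]divr1 -e; apply: eq_integral => v _; by rewrite mul1r.
rewrite mul1r in hU; apply/andP; split; last first.
  apply: (ler_cvg_to hU sum_inv_rate_cvg); apply: nearW => n; apply: ler_sum => j _.
  by have /andP[] := theta_int_term_itv j r0.
have h : (\sum_(j < n) (rate j)^-1) - 2 / r @[n --> \oo] --> 4^-1 - 2 / r.
  by apply: cvgB; [exact: sum_inv_rate_cvg|exact: cvg_cst].
apply: (ler_cvg_to h hU); apply: nearW => n.
rewrite lerBlDr -lerBlDl -sumrB; apply: le_trans (theta_sum_le n r0).
apply: ler_sum => j _; rewrite /theta_int_term -[X in X - _]mul1r -mulrBl opprB addrC subrK.
rewrite ler_pdivrMr ?rate_gt0// ler_peMr ?expR_ge0//; exact: rate_ge1.
Qed.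

(** The integral tends to 1/4 and H(r) behaves like exp(-pi^2 r / 2), whence the constant 1/(4 r);
    the -1 in [mu] contributes only r exp(-pi^2 r / 2), which vanishes. *)
Lemma mu_exp_cvg : mu r * (4 * r) * expR (- (pi ^+ 2 * r / 2)) @[r --> +oo] --> (1 : R).
Proof.
have inv0 : (r^-1 @[r --> +oo] --> (0 : R)).
  apply/gtr0_cvgV0; last exact: cvg_id.
  near=> r; near: r; apply: nbhs_pinfty_gt; exact: num_real.
have c2 : 2 / r @[r --> +oo] --> (0 : R) by rewrite -[X in _ --> X](mulr0 2); exact: cvgMr.
have hH : H r * expR (rate 0 * r) @[r --> +oo] --> (1 : R).
  apply: (@squeeze_cvgr _ _ _ _ (cst 1) (fun r => 1 + 2 / r)).
  - near=> r; apply: H_exp_itv; near: r; apply: nbhs_pinfty_gt; exact: num_real.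
  - exact: cvg_cst.
  - by rewrite -[X in _ --> X]addr0; apply: cvgD; [exact: cvg_cst|].
have hV : \int[leb]_(y in `]0, r]) H y @[r --> +oo] --> (4^-1 : R).
  apply: (@squeeze_cvgr _ _ _ _ (fun r => 4^-1 - 2 / r) (cst 4^-1)).
  - near=> r; apply: integral_H_itv; near: r; apply: nbhs_pinfty_gt; exact: num_real.
  - by rewrite -[X in _ --> X]subr0; apply: cvgB; [exact: cvg_cst|].
  - exact: cvg_cst.
have hE : r * expR (- (rate 0 * r)) @[r --> +oo] --> (0 : R).
  (* Splitting the exponential into two equal factors, each at most 2/r, leaves r (2/r)^2 = 4/r. *)
  apply: (@squeeze_cvgr _ _ _ _ (cst 0) (fun r => 4 * r^-1)).
  - near=> r; have r0 : 0 < r by near: r; apply: nbhs_pinfty_gt; exact: num_real.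
    rewrite mulr_ge0 ?expR_ge0 ?(ltW r0)//=.
    have a1 := @rate_ge1 R 0.
    have h : expR (- (rate 0 * r / 2)) <= (r / 2)^-1.
      apply: le_trans (expR_le_inv _); last by rewrite divr_gt0.
      by rewrite ler_expR lerN2 -mulrA ler_peMl// divr_ge0// ltW.
    rewrite (_ : - (rate 0 * r) = - (rate 0 * r / 2) + - (rate 0 * r / 2)); last by field.
    rewrite expRD; have e0 := expR_ge0 (- (rate 0 * r / 2)).
    apply: (@le_trans _ _ (r * ((r / 2)^-1 * (r / 2)^-1))).
      by rewrite ler_wpM2l ?(ltW r0)// ler_pM.
    by rewrite le_eqVlt; apply/orP; left; apply/eqP; field; rewrite gt_eqF.
  - exact: cvg_cst.
  - by rewrite -[X in _ --> X](mulr0 4); apply: cvgMr.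
have h : 4 * (\int[leb]_(y in `]0, r]) H y) / (H r * expR (rate 0 * r)) -
    4 * (r * expR (- (rate 0 * r))) @[r --> +oo] --> (4 * 4^-1 / 1 - 4 * 0 : R).
  apply: cvgB; last exact: cvgMr.
  by apply: cvgM; [exact: cvgMr|apply: cvgV].
rewrite mulr0 subr0 divr1 divff// in h; apply: cvg_trans h; apply: near_eq_cvg.
near=> r; have r0 : 0 < r by near: r; apply: nbhs_pinfty_gt; exact: num_real.
have -> : pi ^+ 2 * r / 2 = rate 0 * r :> R by rewrite /rate mulr0 add0r; field.
rewrite /mu; have h0 := H_gt0 r0; have e0 := expR_gt0 (rate 0 * r).
rewrite expRN; move: (expR _) (H r) (Rintegral _ _ _) e0 h0 => E h I E0 h0.
by field; rewrite !gt_eqF.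
Unshelve. all: by end_near. Qed.

Let integrable_const a : leb.-integrable (`]0, 1]%classic : set R) (fun=> a%:E).
Proof.
apply: (eq_integrable _ _ _ _ (integrableZl _ a (integrable_exp 0))) => //.
by move=> v _; rewrite mul0r expR0 mule1.
Qed.

Let integrable_affine c a :
  leb.-integrable (`]0, 1]%classic : set R) (fun v => (c * (Num.sqrt v)^-1 + a)%:E).
Proof.
have iS := integrable_sqrt_inv (@ltr01 R).
apply: (eq_integrable _ _ _ _ (integrableD _ (integrableZl _ c iS) (integrable_const a))) => //.
Qed.

Let Rintegral_affine c a : \int[leb]_(v in `]0, 1]) (c * (Num.sqrt v)^-1 + a) = 2 * c + a.
Proof.
have iS := integrable_sqrt_inv (@ltr01 R).
rewrite /Rintegral; under eq_integral do rewrite EFinD EFinM.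
rewrite integralD//=; last exact: integrableZl.
rewrite integralZl// integral_sqrt_inv// integral_cst//= /leb lebesgue_measure_itv/=.
by rewrite lte_fin ltr01 sqrtr1 sube0 mule1 mulr1 mulrC.
Qed.

(** H(r v) is close to I / (2 sqrt(r v)), and 1 / sqrt v has integral 2 over ]0, 1]. So sqrt r times
    the mean of H(r v) tends to I while sqrt r H(r) tends to I/2; the ratio is 2, and the -1 leaves
    1. *)
Lemma mu_cvg0 : mu r @[r --> (0 : R)^'+] --> (1 : R).
Proof.
have [I I0 HI] := @H_sqrt_bounds R.
have s0 : Num.sqrt r @[r --> (0 : R)^'+] --> (0 : R).
  by apply: cvg_at_right_filter; rewrite -[X in _ --> X](@sqrtr0 R); exact: sqrt_continuous.
have iA r : 0 < r -> I - Num.sqrt r <=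
    Num.sqrt r * \int[leb]_(v in `]0, 1]) H (r * v) <= I + Num.sqrt r.
  move=> r0; have q0 : 0 < Num.sqrt r by rewrite sqrtr_gt0.
  have iH : leb.-integrable (`]0, 1]%classic : set R) (fun v => (H (r * v))%:E).
    apply: (eq_integrable _ _ _ _ (integrable_exp_H 0 r0)) => // v _.
    by rewrite mul0r expR0 mul1r.
  have b v : v \in (`]0, 1] : interval R) ->
      I / (2 * Num.sqrt r) * (Num.sqrt v)^-1 + (- 1) <= H (r * v) <=
      I / (2 * Num.sqrt r) * (Num.sqrt v)^-1 + 1.
    rewrite in_itv/= => /andP[v0 _]; have := HI _ (mulr_gt0 r0 v0).
    rewrite (sqrtrM _ (ltW r0)); have p0 : 0 < Num.sqrt v by rewrite sqrtr_gt0.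
    have e0 : 0 < 2 * (Num.sqrt r * Num.sqrt v) by rewrite !mulr_gt0.
    rewrite -(ler_pM2l e0 _ (H _)) -(ler_pM2l e0 (H _)).
    move: (H _) (Num.sqrt r) (Num.sqrt v) q0 p0 {e0} => h x y x0 y0.
    rewrite (_ : 2 * (x * y) * (I / (2 * x) / y + - 1) = I - 2 * (x * y)); last first.
      by field; rewrite !gt_eqF.
    rewrite (_ : 2 * (x * y) * (I / (2 * x) / y + 1) = I + 2 * (x * y)) //.
    by field; rewrite !gt_eqF.
  have h1 : \int[leb]_(v in `]0, 1]) H (r * v) <= 2 * (I / (2 * Num.sqrt r)) + 1.
    rewrite -Rintegral_affine; apply: le_Rintegral => //; first exact: integrable_affine.
    by move=> v /b/andP[].
  have h2 : 2 * (I / (2 * Num.sqrt r)) + (- 1) <= \int[leb]_(v in `]0, 1]) H (r * v).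
    rewrite -Rintegral_affine; apply: le_Rintegral => //; first exact: integrable_affine.
    by move=> v /b/andP[].
  move: h1 h2; move: (Rintegral _ _ _) (Num.sqrt r) q0 => K x x0.
  rewrite (_ : 2 * (I / (2 * x)) = I / x); last by field; rewrite gt_eqF.
  rewrite -(ler_pM2l x0 _ K) -(ler_pM2l x0 K) !mulrDr (mulrC x (I / x)) divfK ?gt_eqF//.
  by rewrite mulr1 mulrN1 => -> ->.
have hA : Num.sqrt r * \int[leb]_(v in `]0, 1]) H (r * v) @[r --> (0 : R)^'+] --> I.
  apply: (@squeeze_cvgr _ _ _ _ (fun r => I - Num.sqrt r) (fun r => I + Num.sqrt r)).
  - near=> r; apply: iA; near: r; exact: nbhs_right_gt.
  - by rewrite -[X in _ --> X]subr0; apply: cvgB => //; exact: cvg_cst.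
  - by rewrite -[X in _ --> X]addr0; apply: cvgD => //; exact: cvg_cst.
have hB : 2 * Num.sqrt r * H r @[r --> (0 : R)^'+] --> I.
  apply: (@squeeze_cvgr _ _ _ _ (fun r => I - 2 * Num.sqrt r) (fun r => I + 2 * Num.sqrt r)).
  - near=> r; apply: HI; near: r; exact: nbhs_right_gt.
  - rewrite -[X in _ --> X]subr0 -[X in _ - X](mulr0 2).
    by apply: cvgB; [exact: cvg_cst|exact: cvgMr].
  - rewrite -[X in _ --> X]addr0 -[X in _ + X](mulr0 2).
    by apply: cvgD; [exact: cvg_cst|exact: cvgMr].
have h : 2 * ((Num.sqrt r * \int[leb]_(v in `]0, 1]) H (r * v)) / (2 * Num.sqrt r * H r)) - 1
    @[r --> (0 : R)^'+] --> (2 * (I / I) - 1 : R).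
  apply: cvgB; last exact: cvg_cst.
  by apply: cvgMr; apply: cvgM => //; apply: cvgV => //; rewrite gt_eqF.
have e1 : 2 * (I / I) - 1 = 1 by rewrite divff ?gt_eqF//; lra.
rewrite e1 in h; apply: cvg_trans h; apply: near_eq_cvg; near=> r.
have r0 : 0 < r by near: r; exact: nbhs_right_gt.
have q0 : 0 < Num.sqrt r by rewrite sqrtr_gt0.
rewrite Rintegral_Hscale// /mu; have h0 := H_gt0 r0.
move: (Rintegral _ _ _) (H r) (Num.sqrt r) h0 q0 => K h b h0 b0.
by field; rewrite !gt_eqF.
Unshelve. all: by end_near. Qed.

End mean_asymptotics.

Section scaling_limit.
Context {R : realType}.
Implicit Types rho : R.

Lemma G0 rho : G rho 0 = 0.
Proof. by rewrite /G !mul0r. Qed.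

Lemma continuous_left_approx (F : R -> R) x : {for x, continuous (EFin \o F)} ->
  forall eps : R, 0 < eps -> exists2 y, y < x & F x - eps <= F y.
Proof.
move=> /fine_cvg/= Fc eps eps0.
have /cvgrPdist_le/(_ eps eps0) := cvg_at_left_filter Fc.
move=> h.
have [y [h1 h2]] := filter_ex (filterI h (nbhs_left_lt x)).
by exists y => //; move: h1; rewrite /= ler_norml lerBlDr lerBlDl => /andP[_].
Qed.

(** [xi] is X - 1 with X the limit of lambda / M, and it is fixed before the sequence, the
    probability spaces and the chains. *)
Lemma lifetime_limit rho : 0 < rho ->
    exists (d' : measure_display) (T' : measurableType d')
      (P' : probability T' R) (xi : {RV P' >-> R}),
      [/\ (forall s : R, (s%:E < s_ rho)%E -> 'M_P' xi s = (phi rho s)%:E),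
          'E_P'[xi]%E = (mu rho)%:E &
          forall (N : nat -> nat) (d : nat -> measure_display)
            (T : forall M, measurableType (d M))
            (P : forall M, probability (T M) R)
            (zeta : forall M, nat -> T M -> fc_state (N M) M),
            (forall M, (0 < M)%N -> (0 < N M)%N) ->
            (forall M, (0 < M)%N -> (1 < N M)%N ->
              fc_model (P M) (inord 1, ord_max) (zeta M)) ->
            N M @[M --> \oo] --> \oo ->
            (M%:R / (N M)%:R ^+ 2 : R) @[M --> \oo] --> rho ->
            cvg_in_distribution P
              (fun M w => (M%:R^-1)%:E * lifetime R (zeta M) w)%E
              P' (fun w => 1 + xi w) /\
            ((M%:R^-1)%:E * \int[P M]_w lifetime R (zeta M) w)%E
              @[M --> \oo] --> (1 + mu rho)%:E].
Proof.
move=> rho0.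
have [d' [T' [P' [X [F [X0 XF XL cvgF]]]]]] := exists_limit_variable rho0.
have mxi : measurable_fun setT (fun w => X w - 1).
  by apply: measurable_funB => //; exact: measurable_funPT.
pose xi : {RV P' >-> R} := HB.pack (fun w : T' => X w - 1)
  (isMeasurableFun.Build _ _ _ _ (fun w : T' => X w - 1) mxi).
exists d', T', P', xi; split.
- move=> s /(lt_s_ rho0)[t [st t0] [tG sG]].
  (* The formula through [tail_laplace] multiplies and divides by s; at s = 0 both sides are 1. *)
  have [->|s0] := eqVneq s 0.
    rewrite /mmt_gen_fun /phi G0 subr0 invr1 -[RHS](expectation_cst P' 1).
    by rewrite !unlock; apply: eq_integral => w _; rewrite /= mulr0 expR0.
  rewrite (mmt_gen_fun_shift s0 X0 (fun=> erefl) (XL _ _ t0 st tG sG)).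
  congr EFin; rewrite /tail_laplace (negbTE s0) mulrCA divff// mulr1 addrCA subrr addr0.
  by rewrite mulrA -expRD addNr expR0 mul1r.
- have [t t0 tG] := exists_G_lt1 rho0.
  have G01 : G rho 0 < 1 by rewrite G0.
  rewrite (expectation_shift X0 (fun=> erefl) (XL _ _ t0 t0 tG G01)).
  by rewrite /tail_laplace eqxx addrAC subrr add0r.
move=> N d T P zeta N0 chain N_oo Nrho.
have good : \forall M \near \oo, [/\ (0 < M)%N, (1 < N M)%N & 0 < walk_surv (N M) M 1 :> R].
  exact: (walk_surv_gt0_near rho0 N_oo Nrho).
split.
- have xiE w : 1 + xi w = X w by rewrite /= addrCA subrr addr0.
  have F'E : distribution_function P' (EFin \o (fun w => 1 + xi w)) = EFin \o F.
    apply/funext => y; rewrite /distribution_function [RHS]/= -XF; congr (P' _).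
    by apply/seteqP; split=> w; rewrite /mkset [(EFin \o _) w]/comp lee_fin xiE.
  rewrite /cvg_in_distribution F'E => x /continuous_left_approx xF.
  have h : (fc_cdf (N M) M x)%:E @[M --> \oo] --> (F x)%:E.
    by apply: cvg_EFin; [exact: nearW|exact: cvgF].
  apply: cvg_trans h; apply: near_eq_cvg; apply: filterS good => M [M0 N1 _].
  by rewrite lifetime_distribution//; exact: chain.
have h : (tail_sum N 0 M / M%:R)%:E @[M --> \oo] --> (1 + mu rho)%:E.
  by apply: cvg_EFin; [exact: nearW|exact: tail_sum0_cvg].
apply: cvg_trans h; apply: near_eq_cvg; apply: filterS good => M [M0 N1 qM].
rewrite lifetime_mean//; last exact: chain.
rewrite (@nneseries_EFin _ _ (tail_sum N 0 M)); first by rewrite -EFinM mulrC.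
have h := fc_tail_sum_cvg N1 (cycle_gf_lt1 N1 qM (lexx 0)).
apply: cvg_trans h; apply: near_eq_cvg; apply: nearW => K.
by apply: eq_bigr => k _; rewrite mul0r expR0 expr1n mulr1.
Qed.

End scaling_limit.

Theorem theorem2p7 (R : realType) :
  (forall rho : R, 0 < rho ->
    exists (d' : measure_display) (T' : measurableType d')
      (P' : probability T' R) (xi : {RV P' >-> R}),
      [/\ (forall s : R, (s%:E < s_ rho)%E -> 'M_P' xi s = (phi rho s)%:E),
          'E_P'[xi]%E = (mu rho)%:E &
          forall (N : nat -> nat) (d : nat -> measure_display)
            (T : forall M, measurableType (d M))
            (P : forall M, probability (T M) R)
            (zeta : forall M, nat -> T M -> fc_state (N M) M),
            (forall M, (0 < M)%N -> (0 < N M)%N) ->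
            (forall M, (0 < M)%N -> (1 < N M)%N ->
              fc_model (P M) (inord 1, ord_max) (zeta M)) ->
            N M @[M --> \oo] --> \oo ->
            (M%:R / (N M)%:R ^+ 2 : R) @[M --> \oo] --> rho ->
            cvg_in_distribution P
              (fun M w => (M%:R^-1)%:E * lifetime R (zeta M) w)%E
              P' (fun w => 1 + xi w) /\
            ((M%:R^-1)%:E * \int[P M]_w lifetime R (zeta M) w)%E
              @[M --> \oo] --> (1 + mu rho)%:E])
  /\ mu rho @[rho --> (0 : R)^'+] --> (1 : R)
  /\ exists eps : R -> R,
      eps r @[r --> +oo] --> (0 : R) /\
      forall r : R, 0 < r ->
        mu r = expR (pi ^+ 2 * r / 2) / (4 * r) * (1 + eps r).
Proof.
split; first exact: lifetime_limit.
split; first exact: mu_cvg0.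
exists (fun r => mu r * (4 * r) * expR (- (pi ^+ 2 * r / 2)) - 1); split.
  by rewrite -[X in _ --> X](subrr 1); apply: cvgB; [exact: mu_exp_cvg|exact: cvg_cst].
move=> r r0; rewrite addrC subrK expRN.
have e0 := expR_gt0 (pi ^+ 2 * r / 2).
by move: (expR _) (mu r) e0 => E m E0; field; rewrite !gt_eqF.
Qed.
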